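(* Let $w:\mathbb{N}\times\mathbb{N}\to\mathbb{Q}$ be a tractable weight function and let $Q$ be a fixed Boolean OMQ that admits a $\mathsf{UCQ}^{\neq}$-rewriting. Then the WSMS value $\phi^w_{\mathsf{wsms}}(\mathcal{A},Q,\alpha)$ can be computed in polynomial time in the size of $\mathcal{A}$, given as input an ABox $\mathcal{A}$ and an assertion $\alpha\in\mathcal{A}$ (i.e., the problem is in $\mathsf{FP}$ in data complexity). In particular, for every tractable weight function $w$, WSMS computation for OMQs $(\mathcal{T},q)$ with $\mathcal{T}$ a DL-Lite$_\mathcal{R}$ TBox and $q$ a Boolean UCQ is in $\mathsf{FP}$ in data complexity.
   Context: An ABox is a finite set of assertions $A(c)$ and $r(b,c)$ (concept names $A$, role names $r$, individuals $b,c$). A Boolean ontology-mediated query (OMQ) is a pair $Q=(\mathcal{T},q)$ of a description-logic TBox $\mathcal{T}$ and a Boolean query $q$; we write $\mathcal{A}\models Q$ if $q$ holds in every model of $(\mathcal{A},\mathcal{T})$. A minimal support of $Q$ in $\mathcal{A}$ is an inclusion-minimal subset $S\subseteq\mathcal{A}$ with $S\models Q$; $\mathrm{MS}_Q(\mathcal{A})$ denotes the set of these. For a weight function $w:\mathbb{N}\times\mathbb{N}\to\mathbb{Q}$, the WSMS responsibility score of $\alpha\in\mathcal{A}$ is $\phi^w_{\mathsf{wsms}}(\mathcal{A},Q,\alpha)=\sum_{S\in \mathrm{MS}_Q(\mathcal{A}),\,\alpha\in S} w(|S|,|\mathcal{A}|)$ (equivalently, a Shapley value of a suitable cooperative game on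 $\mathcal{A}$). ''Tractable'' weight function is a mild technical condition (from Bienvenu, Figueira, Lafourcade, PODS 2025) satisfied e.g. by $w(n,k)=1/n$. A query $q^*$ is a $\mathsf{UCQ}^{\neq}$-rewriting of $Q=(\mathcal{T},q)$ if $q^*$ is a union of conjunctive queries possibly with inequality atoms and, for every ABox $\mathcal{A}$ (viewed as a database), $\mathcal{A}\models Q$ iff $\mathcal{A}\models q^*$. DL-Lite$_\mathcal{R}$ TBoxes contain inclusions $B\sqsubseteq C$ and $R\sqsubseteq S$ with $B::=A\mid\exists R$, $C::=B\mid\neg B$, $R$ a role name or inverse role $r^-$, $S::=R\mid\neg R$. *)

(* Defs.v *)
From Stdlib Require Import List Arith ZArith QArith ClassicalEpsilon.
Import ListNotations.

(* ABoxes.  Concept names, role names and individuals are naturals.    *)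
Inductive assertion : Type :=
| CA (A c : nat)
| RA (r b c : nat).

(* An ABox is a finite set of assertions, represented by a duplicate-free
   list (the well-formedness NoDup is imposed where ABoxes are quantified). *)
Definition abox := list assertion.

Inductive term : Type := TVar (x : nat) | TCst (a : nat).

Inductive qatom : Type :=
| QC (A : nat) (t : term)
| QR (r : nat) (t1 t2 : term)
| QNeq (t1 t2 : term).

Definition cq := list qatom.
Definition ucq := list cq.

Definition tval (f : nat -> nat) (t : term) : nat :=
  match t with TVar x => f x | TCst a => a end.

Definition holdsDB (Ab : abox) (f : nat -> nat) (atm : qatom) : Prop :=
  match atm with
  | QC A t => In (CA A (tval f t)) Ab
  | QR r t1 t2 => In (RA r (tval f t1) (tval f t2)) Ab
  | QNeq t1 t2 => tval f t1 <> tval f t2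
  end.

Definition evalDB (Ab : abox) (q : ucq) : Prop :=
  exists c, In c q /\ exists f : nat -> nat, forall atm, In atm c -> holdsDB Ab f atm.

(* A Boolean query semantics on ABoxes ("A |= Q") admits a UCQ^{<>}-rewriting *)
Definition UCQneq_rewritable (ent : abox -> Prop) : Prop :=
  exists qs : ucq, forall Ab : abox, ent Ab <-> evalDB Ab qs.

Definition is_UCQ (q : ucq) : Prop :=
  forall c atm, In c q -> In atm c -> match atm with QNeq _ _ => False | _ => True end.

Inductive brole : Type := RN (r : nat) | RInv (r : nat).
Inductive bconc : Type := CN (A : nat) | Ex (R : brole).
Inductive dlaxiom : Type :=
| CIncl (B B' : bconc)
| CNegIncl (B B' : bconc)
| RIncl (R R' : brole)
| RNegIncl (R R' : brole).
Definition tbox := list dlaxiom.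

Record interp : Type := {
  dom : Type;
  iconc : nat -> dom -> Prop;
  irole : nat -> dom -> dom -> Prop;
  iind : nat -> dom }.

Definition roleI (I : interp) (R : brole) (d e : dom I) : Prop :=
  match R with RN r => irole I r d e | RInv r => irole I r e d end.
Definition concI (I : interp) (B : bconc) (d : dom I) : Prop :=
  match B with CN A => iconc I A d | Ex R => exists e, roleI I R d e end.

Definition satAx (I : interp) (ax : dlaxiom) : Prop :=
  match ax with
  | CIncl B B' => forall d, concI I B d -> concI I B' d
  | CNegIncl B B' => forall d, concI I B d -> ~ concI I B' d
  | RIncl R R' => forall d e, roleI I R d e -> roleI I R' d e
  | RNegIncl R R' => forall d e, roleI I R d e -> ~ roleI I R' d e
  end.

Definition satAssert (I : interp) (a : assertion) : Prop :=
  match a with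
  | CA A c => iconc I A (iind I c)
  | RA r b c => irole I r (iind I b) (iind I c)
  end.

(* models of (A,T), under the unique name assumption *)
Definition is_model (I : interp) (T : tbox) (Ab : abox) : Prop :=
  (forall ax, In ax T -> satAx I ax) /\
  (forall a, In a Ab -> satAssert I a) /\
  (forall b c, iind I b = iind I c -> b = c).

Definition tvalI (I : interp) (f : nat -> dom I) (t : term) : dom I :=
  match t with TVar x => f x | TCst a => iind I a end.

Definition holdsI (I : interp) (f : nat -> dom I) (atm : qatom) : Prop :=
  match atm with
  | QC A t => iconc I A (tvalI I f t)
  | QR r t1 t2 => irole I r (tvalI I f t1) (tvalI I f t2)
  | QNeq t1 t2 => tvalI I f t1 <> tvalI I f t2
  end.

Definition satQ (I : interp) (q : ucq) : Prop :=
  exists c, In c q /\ exists f : nat -> dom I, forall atm, In atm c -> holdsI I f atm.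

Definition entails (T : tbox) (q : ucq) (Ab : abox) : Prop :=
  forall I : interp, is_model I T Ab -> satQ I q.

Definition bdec (P : Prop) : bool :=
  if excluded_middle_informative P then true else false.

(* all sub-lists (= all subsets, when the list is duplicate-free) *)
Fixpoint sublists {X : Type} (l : list X) : list (list X) :=
  match l with
  | [] => [[]]
  | x :: l' => map (cons x) (sublists l') ++ sublists l'
  end.

Definition min_support (ent : abox -> Prop) (Ab S : abox) : Prop :=
  incl S Ab /\ ent S /\ (forall S', incl S' S -> ent S' -> incl S S').

Definition wsms (w : nat -> nat -> Q) (ent : abox -> Prop) (Ab : abox)
  (alpha : assertion) : Q :=
  fold_right Qplus 0
    (map (fun S => w (length S) (length Ab))
       (filter (fun S => bdec (min_support ent Ab S /\ In alpha S)) (sublists Ab))).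

(* Symbols are naturals; 0 is the blank.  Fixed I/O alphabet:
   1 = bit 0, 2 = bit 1, 3 = separator, 4 = minus sign,
   5 = concept-assertion tag, 6 = role-assertion tag, 7 = end of ABox. *)
Inductive move := MLeft | MRight | MStay.

Local Open Scope nat_scope.
Record TM : Type := {
  nstates : nat;
  nsyms : nat;
  delta : nat -> nat -> nat * nat * move;
  qstart : nat;
  qhalt : nat;
  tm_start_ok : qstart < nstates;
  tm_halt_ok : qhalt < nstates;
  tm_syms_ok : 8 <= nsyms;
  tm_delta_ok : forall q s, q < nstates -> s < nsyms ->
      fst (fst (delta q s)) < nstates /\ snd (fst (delta q s)) < nsyms }.

Record config : Type := { cstate : nat; cleft : list nat; chead : nat; cright : list nat }.

Definition step (M : TM) (c : config) : config :=
  if Nat.eqb (cstate c) (qhalt M) then c else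
  match delta M (cstate c) (chead c) with
  | (q', s', MStay) => Build_config q' (cleft c) s' (cright c)
  | (q', s', MLeft) =>
      match cleft c with
      | [] => Build_config q' [] 0 (s' :: cright c)
      | x :: l => Build_config q' l x (s' :: cright c)
      end
  | (q', s', MRight) =>
      match cright c with
      | [] => Build_config q' (s' :: cleft c) 0 []
      | x :: r => Build_config q' (s' :: cleft c) x r
      end
  end.

Definition init_config (M : TM) (w : list nat) : config :=
  match w with
  | [] => Build_config (qstart M) [] 0 []
  | x :: r => Build_config (qstart M) [] x r
  end.

Fixpoint run (M : TM) (n : nat) (c : config) : config :=
  match n with 0 => c | S n' => run M n' (step M c) end.

Fixpoint take_nonblank (l : list nat) : list nat :=
  match l with
  | [] => []
  | x :: r => if Nat.eqb x 0 then [] else x :: take_nonblank r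
  end.

Definition halts_within (M : TM) (w : list nat) (t : nat) (out : list nat) : Prop :=
  exists k, k <= t /\
    let c := run M k (init_config M w) in
    cstate c = qhalt M /\ take_nonblank (chead c :: cright c) = out.

Fixpoint encP (p : positive) : list nat :=          (* binary, LSB first *)
  match p with xH => [2] | xO p' => 1 :: encP p' | xI p' => 2 :: encP p' end.

Definition encN (n : nat) : list nat :=
  match N.of_nat n with N0 => [1] | Npos p => encP p end.

Definition encZ (z : Z) : list nat :=
  match z with Z0 => [1] | Zpos p => encP p | Zneg p => 4 :: encP p end.

Definition encodesQ (out : list nat) (v : Q) : Prop :=
  exists (z : Z) (p : positive), out = encZ z ++ [3] ++ encP p /\ Qeq (z # p) v.

Definition encAssertion (a : assertion) : list nat :=
  match a with
  | CA A c => 5 :: encN A ++ 3 :: encN c ++ [3]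
  | RA r b c => 6 :: encN r ++ 3 :: encN b ++ 3 :: encN c ++ [3]
  end.

Definition encInput (Ab : abox) (alpha : assertion) : list nat :=
  concat (map encAssertion Ab) ++ 7 :: encAssertion alpha.

(* w is tractable: w(n,k) (n <= k) is computable in time polynomial in k,
   i.e. polynomial in the size of the unary input 1^n ; 1^k. *)
Definition tractable (w : nat -> nat -> Q) : Prop :=
  exists (M : TM) (c d : nat), forall n k, n <= k ->
    let inp := repeat 2 n ++ 3 :: repeat 2 k in
    exists t out, t <= c * (S (length inp)) ^ d /\
      halts_within M inp t out /\ encodesQ out (w n k).

Definition wsms_in_FP (w : nat -> nat -> Q) (ent : abox -> Prop) : Prop :=
  exists (M : TM) (c d : nat), forall (Ab : abox) (alpha : assertion),
    NoDup Ab -> In alpha Ab ->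
    exists t out, t <= c * (S (length (encInput Ab alpha))) ^ d /\
      halts_within M (encInput Ab alpha) t out /\
      encodesQ out (wsms w ent Ab alpha).

(* Main.v *)
Require Import Defs.
From Stdlib Require Import List Arith ZArith QArith.
From Stdlib Require Import Lia Classical ClassicalEpsilon FunctionalExtensionality.
Import ListNotations.
Local Open Scope nat_scope.

(* Idea. A Boolean query that admits a UCQ-with-inequalities rewriting, and also
   (T, q) for T in DL-Lite_R, is monotone, invariant under renamings that fix
   finitely many names, and has supports of size bounded by a constant m; for
   DL-Lite_R this holds because every fact of the canonical model is derived from
   a single assertion. Hence the score of al is the sum over n <= m of
   cnt_n * w(n, |A|), where cnt_n counts the n-element subsets of A that are
   minimal supports containing al; whether a tuple is one depends only on the
   equalities between its components and the fixed names, so cnt_n is found by n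
   nested loops over A, evaluating a fixed decision tree of equality tests.

   For the machine model, programs over finitely many stacks are compiled to
   single-tape machines, stack i being track i of the tape. The class [FP] of
   string functions computed by such programs in polynomial time is closed under
   composition, case distinction and bounded recursion on notation; integer
   arithmetic, the simulation of the machine for w, and the counting loops are
   all expressed through these closure properties. *)

(** * Stack programs and their compilation to Turing machines *)

(** An explicit single-tape machine with an explicit polynomial is required, while [wsms] sums over
    exponentially many subsets filtered by a classical predicate. No program for entailment is ever
    written: for a fixed query and fixed n there are finitely many equality patterns of tuples, and
    the answer for each is placed at a leaf of a decision tree by excluded middle. This is sound
    because tuples of equal pattern are related by an injective renaming. Stacks are convenient
    because an operation touches one end of one track, so nothing on the tape is ever shifted. A
    program pushes at most one symbol per time unit, so every time bound is also a length bound, and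
    composition needs only one polynomial per function. The alphabet size [B] stays a parameter
    because the machine for w may have any number of states and symbols, and its configurations have
    to fit on the stacks. Fractions are never reduced: the output format accepts any representative
    of the value, and the number of summands is the constant m + 1. *)

Notation str := (list nat).
Definition regs := nat -> str.
Definition upd (g : regs) (x : nat) (l : str) : regs :=
  fun y => if Nat.eqb y x then l else g y.

Inductive prog : Type :=
| Skip
| Push (x s : nat)
| Seq (p q : prog)
| Iter (again : bool) (x : nat) (br : nat -> prog).

(* On an empty stack, [Iter] takes the branch for 0, which is not a stack symbol. *)
Inductive exec : prog -> regs -> regs -> nat -> Prop :=
| exec_skip g : exec Skip g g 1
| exec_push g x s : exec (Push x s) g (upd g x (s :: g x)) 1
| exec_seq p q g1 g2 g3 t1 t2 :
    exec p g1 g2 t1 -> exec q g2 g3 t2 -> exec (Seq p q) g1 g3 (S (t1 + t2))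
| exec_empty a x br g g' t :
    g x = [] -> exec (br 0) g g' t -> exec (Iter a x br) g g' (S t)
| exec_once x br g v l g' t :
    g x = v :: l -> exec (br v) (upd g x l) g' t ->
    exec (Iter false x br) g g' (S t)
| exec_again x br g v l g1 g2 t1 t2 :
    g x = v :: l -> exec (br v) (upd g x l) g1 t1 ->
    exec (Iter true x br) g1 g2 t2 ->
    exec (Iter true x br) g g2 (S (t1 + t2))
| exec_weak p g g' t t' : exec p g g' t -> t <= t' -> exec p g g' t'.

(** Only [Push] lengthens a stack, by one symbol for one unit of time. This turns the running time
    of a subprogram into a bound on the length of its result. *)
Lemma exec_length p g g' t : exec p g g' t ->
  forall r, length (g' r) <= length (g r) + t.
Proof.
  induction 1; intros r; try (specialize (IHexec r));
    try (specialize (IHexec1 r); specialize (IHexec2 r)); try lia.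
  - unfold upd. destruct (Nat.eqb_spec r x); subst; simpl; lia.
  - unfold upd in *. destruct (Nat.eqb_spec r x); subst; try lia.
    rewrite H. simpl. lia.
  - unfold upd in *. destruct (Nat.eqb_spec r x); subst; try lia.
    rewrite H. simpl. lia.
Qed.

(** * The single-tape machine of a stack program *)

Section Machine.
Variable B : nat.

Definition symbol (s : nat) : Prop := 1 <= s < B.
Definition vregs (g : regs) : Prop := forall r, Forall symbol (g r).

Fixpoint wf (K : nat) (p : prog) : Prop :=
  match p with
  | Skip => True
  | Push x s => x < K /\ symbol s
  | Seq p q => wf K p /\ wf K q
  | Iter _ x br => x < K /\ forall v, v < B -> wf K (br v)
  end.

Lemma wf_mono K K' p : K <= K' -> wf K p -> wf K' p.
Proof. intros HK. induction p; simpl; intuition (auto; lia). Qed.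

Lemma vregs_upd g x l : vregs g -> Forall symbol l -> vregs (upd g x l).
Proof. intros Hg Hl r. unfold upd. destruct (Nat.eqb r x); auto. Qed.

Lemma vregs_pop g x v l : vregs g -> g x = v :: l -> v < B /\ vregs (upd g x l).
Proof.
  intros Hg E. pose proof (Hg x) as H. rewrite E in H. inversion H; subst.
  split; [unfold symbol in *; lia|]. apply vregs_upd; auto.
Qed.

Hypothesis HB : 8 <= B.

Lemma exec_valid K p g g' t : exec p g g' t -> wf K p -> vregs g -> vregs g'.
Proof.
  induction 1; simpl; intros Hw Hg; auto.
  - destruct Hw. apply vregs_upd; auto.
  - destruct Hw. auto.
  - destruct Hw as [_ Hw]. apply IHexec; auto. apply Hw. lia.
  - destruct Hw as [_ Hw]. destruct (vregs_pop _ _ _ _ Hg H). auto.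
  - assert (wf K (Iter true x br)) by exact Hw. destruct Hw as [_ Hw].
    destruct (vregs_pop _ _ _ _ Hg H). auto.
Qed.

Variables (K : nat) (main : prog).
Hypothesis HK : 1 <= K.
Hypothesis Hmain : wf K main.

(** A tape cell carries one symbol for each of the [K] tracks, as the base-[B] digits of a number
    below [B ^ K]. Digit 0 is an empty place, which is why 0 is excluded from stack symbols. *)
Fixpoint digit (i a : nat) : nat :=
  match i with 0 => a mod B | S i' => digit i' (a / B) end.

Fixpoint packd (n : nat) (d : nat -> nat) : nat :=
  match n with 0 => 0 | S n' => d 0 + B * packd n' (fun i => d (S i)) end.

Lemma digit_lt i a : digit i a < B.
Proof. revert a. induction i; simpl; intros; auto. apply Nat.mod_upper_bound. lia. Qed.

Lemma packd_lt n d : (forall i, d i < B) -> packd n d < B ^ n.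
Proof.
  revert d. induction n; simpl; intros d H; [lia|].
  specialize (IHn (fun i => d (S i)) (fun i => H (S i))). specialize (H 0). nia.
Qed.

Lemma digit_packd n d i : (forall i, d i < B) -> i < n -> digit i (packd n d) = d i.
Proof.
  revert n d. induction i; intros [|n] d H Hi; try lia; simpl.
  - rewrite Nat.mul_comm, Nat.Div0.mod_add. apply Nat.mod_small. auto.
  - rewrite Nat.mul_comm, Nat.div_add by lia. rewrite Nat.div_small by auto. simpl.
    apply (IHi n (fun i => d (S i))); auto. lia.
Qed.

Lemma packd_digit n a : a < B ^ n -> packd n (fun i => digit i a) = a.
Proof.
  revert a. induction n; simpl; intros a H; [lia|].
  rewrite (IHn (a / B)). 2: apply Nat.Div0.div_lt_upper_bound; lia.
  pose proof (Nat.div_mod_eq a B). lia.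
Qed.

(** A cell in which only track 0 is occupied equals its symbol as a number, so the final tape can be
    read as output without translation. *)
Lemma packd_first n d a : 1 <= n ->
  (forall j, j < n -> d j = if Nat.eqb j 0 then a else 0) -> packd n d = a.
Proof.
  intros Hn Hd. destruct n as [|n]; [lia|]. simpl. rewrite Hd by lia. simpl.
  assert (E0 : forall m d', (forall j, j < m -> d' j = 0) -> packd m d' = 0).
  { clear. induction m; simpl; intros d' Hd'; auto.
    rewrite Hd', IHm; try lia. intros. apply Hd'. lia. }
  rewrite E0; [lia|]. intros j Hj. rewrite Hd by lia. reflexivity.
Qed.

Definition setd (x s a : nat) : nat :=
  packd K (fun i => if Nat.eqb i x then s else digit i a).

Lemma setd_lt x s a : s < B -> setd x s a < B ^ K.
Proof.
  intros. apply packd_lt. intros i. destruct (Nat.eqb i x); auto. apply digit_lt.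
Qed.

Lemma digit_setd x s a i : s < B -> i < K ->
  digit i (setd x s a) = if Nat.eqb i x then s else digit i a.
Proof.
  intros. unfold setd. rewrite digit_packd; auto.
  intros j. destruct (Nat.eqb j x); auto. apply digit_lt.
Qed.

(** The least number that is not the content of a cell; it is written just left of the input and
    tells the head where the tracks begin. *)
Definition MARK := B ^ K.

(* The phases of [St] are 0: dispatch, with the head on the marker; 1: scan right
   for the first free cell of the track; 2: remove the symbol left of it;
   3: return to the marker. *)
Inductive tmst : Type := Init | Mark | Halt | St (ph : nat) (k : list prog).

(** The state carries the list of programs still to be run. When the list is empty the marker is
    erased and the head steps onto the first cell, where the output is read. *)
Definition trans (q : tmst) (a : nat) : tmst * nat * move :=
  match q with
  | Init => (Mark, a, MLeft)
  | Mark => (St 0 [main], MARK, MStay)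
  | Halt => (Halt, a, MStay)
  | St 0 k =>
      match k with
      | [] => (Halt, 0, MRight)
      | Skip :: k' => (St 0 k', a, MStay)
      | Seq p q :: k' => (St 0 (p :: q :: k'), a, MStay)
      | _ => (St 1 k, a, MRight)
      end
  | St 1 k =>
      match k with
      | Push x s :: k' =>
          if Nat.eqb (digit x a) 0 then (St 3 k', setd x s a, MLeft)
          else (St 1 k, a, MRight)
      | Iter _ x _ :: _ =>
          if Nat.eqb (digit x a) 0 then (St 2 k, a, MLeft) else (St 1 k, a, MRight)
      | _ => (Halt, a, MStay)
      end
  | St 2 k =>
      match k with
      | Iter ag x br :: k' =>
          if Nat.eqb a MARK then (St 0 (br 0 :: k'), a, MStay)
          else (St 3 (br (digit x a) :: if ag then k else k'), setd x 0 a, MLeft)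
      | _ => (Halt, a, MStay)
      end
  | St _ k => if Nat.eqb a MARK then (St 0 k, a, MStay) else (St 3 k, a, MLeft)
  end.

(** The control needs no recursion stack: a pending list of programs corresponds to a position in
    the syntax tree of [p], so finitely many lists suffice. For a loop the branches occur twice,
    with the loop still pending and, for the exit on an empty stack, without it. *)
Fixpoint conts (p : prog) (k : list prog) : list (list prog) :=
  (p :: k) ::
  match p with
  | Skip | Push _ _ => []
  | Seq p q => conts p (q :: k) ++ conts q k
  | Iter ag x br =>
      flat_map (fun v => conts (br v) (if ag then Iter ag x br :: k else k) ++
                         conts (br v) k) (seq 0 B)
  end.

Definition closed_at (P : list prog -> Prop) (k : list prog) : Prop :=
  match k with
  | [] => True
  | p :: k' =>
      wf K p /\
      match p with
      | Skip | Push _ _ => P k'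
      | Seq p q => P (p :: q :: k')
      | Iter ag x br =>
          forall v, v < B -> P (br v :: if ag then k else k') /\ P (br v :: k')
      end
  end.

Lemma conts_head p k : In (p :: k) (conts p k).
Proof. destruct p; simpl; auto. Qed.

Lemma closed_at_mono (P P' : list prog -> Prop) k :
  (forall k, P k -> P' k) -> closed_at P k -> closed_at P' k.
Proof.
  intros H. destruct k as [|p k]; simpl; auto. intros [Hw Hc]. split; auto.
  destruct p; auto. intros v Hv. destruct (Hc v Hv). auto.
Qed.

(** Control that enters a subprogram remains among its continuations until it returns to the tail on
    which the subprogram was started. *)
Lemma conts_closed p : wf K p -> forall k k', In k' (conts p k) ->
  closed_at (fun k'' => k'' = k \/ In k'' (conts p k)) k'.
Proof.
  induction p; intros Hw k k'.
  - simpl. intros [<-|[]]. simpl. auto.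
  - intros [<-|[]]. split; [exact Hw|left; reflexivity].
  - destruct Hw as [H1 H2]. intros [<-|Hin].
    + split; [split; auto|]. simpl. right. right. apply in_or_app. left. apply conts_head.
    + apply in_app_or in Hin. destruct Hin as [Hin|Hin].
      * apply IHp1 in Hin; auto. eapply closed_at_mono; [|exact Hin].
        simpl. intros k'' [->|H'].
        -- right. right. apply in_or_app. right. apply conts_head.
        -- right. right. apply in_or_app. auto.
      * apply IHp2 in Hin; auto. eapply closed_at_mono; [|exact Hin].
        simpl. intros k'' [->|H']; auto.
        right. right. apply in_or_app. auto.
  - assert (Hw' := Hw). destruct Hw as [Hx Hbr]. intros [<-|Hin].
    + split; [exact Hw'|]. intros v Hv. simpl. split; right; right; apply in_flat_map;
        exists v; (split; [apply in_seq; lia|]); apply in_or_app.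
      * left. apply conts_head.
      * right. apply conts_head.
    + apply in_flat_map in Hin. destruct Hin as [v [Hv Hin]]. apply in_seq in Hv.
      apply in_app_or in Hin. destruct Hin as [Hin|Hin].
      * apply H in Hin; [|apply Hbr; lia]. eapply closed_at_mono; [|exact Hin].
        cbv beta. intros k'' [->|H'].
        -- destruct again; auto. right. apply conts_head.
        -- right. right. apply in_flat_map. exists v. split; [apply in_seq; lia|].
           apply in_or_app. auto.
      * apply H in Hin; [|apply Hbr; lia]. eapply closed_at_mono; [|exact Hin].
        cbv beta. intros k'' [->|H']; auto.
        right. right. apply in_flat_map. exists v. split; [apply in_seq; lia|].
           apply in_or_app. auto.
Qed.

Definition allconts := [] :: conts main [].

Lemma allconts_closed k : In k allconts -> closed_at (fun k' => In k' allconts) k.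
Proof.
  intros [<-|H]; [exact I|]. apply conts_closed in H; auto.
  eapply closed_at_mono; [|exact H]. cbv beta. intros k' [->|H']; [left|right]; auto.
Qed.

Definition Qs : list tmst :=
  Init :: Mark :: Halt :: flat_map (fun k => [St 0 k; St 1 k; St 2 k; St 3 k]) allconts.

Lemma Qs_St ph k : ph < 4 -> In k allconts -> In (St ph k) Qs.
Proof.
  intros Hp Hk. do 3 right. apply in_flat_map. exists k. split; auto.
  do 4 (destruct ph; [simpl; auto|]). lia.
Qed.

(** Programs contain functions, so states are compared classically. A state outside the list gets
    the index [length l], hence the one extra state of [machine]. *)
Fixpoint idx (l : list tmst) (q : tmst) : nat :=
  match l with
  | [] => 0
  | x :: l' => if excluded_middle_informative (x = q) then 0 else S (idx l' q)
  end.

Lemma idx_le l q : idx l q <= length l.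
Proof. induction l; simpl; auto. destruct excluded_middle_informative; lia. Qed.

Lemma nth_idx l q : In q l -> nth (idx l q) l Halt = q.
Proof.
  induction l; simpl; [tauto|]. intros H.
  destruct excluded_middle_informative; auto. destruct H; auto. congruence.
Qed.

Arguments idx : simpl never.

Definition delta0 (i a : nat) : nat * nat * move :=
  let '(q', a', m) := trans (nth i Qs Halt) a in
  (idx Qs q', if Nat.ltb a' (S MARK) then a' else 0, m).

Lemma base_le_pow : B <= B ^ K.
Proof. destruct K; [lia|]. simpl. pose proof (Nat.pow_nonzero B n). nia. Qed.

Definition machine : TM.
Proof.
  refine (@Build_TM (S (length Qs)) (S MARK) delta0 (idx Qs Init) (idx Qs Halt) _ _ _ _).
  - pose proof (idx_le Qs Init). lia.
  - pose proof (idx_le Qs Halt). lia.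
  - pose proof base_le_pow. unfold MARK. lia.
  - intros i a _ _. unfold delta0. destruct (trans (nth i Qs Halt) a) as [[q' a'] m].
    cbn [fst snd]. pose proof (idx_le Qs q'). split; [lia|].
    destruct (Nat.ltb_spec a' (S MARK)); lia.
Defined.

Definition moved (q s : nat) (m : move) (l r : list nat) : config :=
  match m with
  | MStay => Build_config q l s r
  | MLeft => Build_config q (tl l) (hd 0 l) (s :: r)
  | MRight => Build_config q (s :: l) (hd 0 r) (tl r)
  end.

Lemma step_trans q l h r q' s m : In q Qs -> q <> Halt -> trans q h = (q', s, m) -> s <= MARK ->
  step machine (Build_config (idx Qs q) l h r) = moved (idx Qs q') s m l r.
Proof.
  intros Hq Hn Hd Hs. unfold step, machine; cbn [cstate chead cleft cright qhalt delta].
  destruct (Nat.eqb_spec (idx Qs q) (idx Qs Halt)) as [E|E].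
  - apply (f_equal (fun i => nth i Qs Halt)) in E.
    rewrite !nth_idx in E; auto; [contradiction|]. simpl. auto.
  - unfold delta0. rewrite nth_idx by auto. rewrite Hd.
    destruct (Nat.ltb_spec s (S MARK)); [|lia].
    destruct m; simpl; auto; [destruct l|destruct r]; auto.
Qed.

Lemma run_add M n m c : run M (n + m) c = run M m (run M n c).
Proof. revert c. induction n; simpl; auto. Qed.

(** Only an upper bound on the number of steps is recorded, so bounds compose by addition and may be
    rounded up. *)
Definition reach (n : nat) (c c' : config) : Prop :=
  exists n', n' <= n /\ run machine n' c = c'.

Lemma reach_refl n c : reach n c c.
Proof. exists 0. split; [lia|auto]. Qed.

Lemma reach_trans n1 n2 n c1 c2 c3 :
  reach n1 c1 c2 -> reach n2 c2 c3 -> n1 + n2 <= n -> reach n c1 c3.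
Proof.
  intros [a [Ha <-]] [b [Hb <-]] H. exists (a + b). split; [lia|]. apply run_add.
Qed.

Lemma reach_step n c c' : reach n (step machine c) c' -> reach (S n) c c'.
Proof. intros [a [Ha E]]. exists (S a). split; [lia|auto]. Qed.

(** The tape left of cell j, nearest cell first as configurations store it. The right part is
    described by [rightof] instead, which is insensitive to trailing blanks. *)
Definition mnth (c : nat -> nat) (j : nat) : list nat := map c (rev (seq 0 j)).

Lemma mnth_S c j : mnth c (S j) = c j :: mnth c j.
Proof. unfold mnth. rewrite seq_S, rev_app_distr. reflexivity. Qed.

Definition rightof (c : nat -> nat) (j : nat) (r : list nat) : Prop :=
  forall i, nth i r 0 = c (j + i).

Lemma rightof_hd c j r : rightof c j r -> hd 0 r = c j.
Proof. intros H. specialize (H 0). rewrite Nat.add_0_r in H. destruct r; auto. Qed.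

Lemma rightof_tl c j r : rightof c j r -> rightof c (S j) (tl r).
Proof.
  intros H i. specialize (H (S i)). rewrite Nat.add_succ_r in H.
  simpl. rewrite <- H. destruct r; simpl; auto. destruct i; auto.
Qed.

Lemma rightof_cons c j r : rightof c (S j) r -> rightof c j (c j :: r).
Proof.
  intros H [|i]; simpl; [f_equal; lia|]. rewrite H. f_equal. lia.
Qed.

Lemma rightof_ext c c' j r : (forall i, j <= i -> c i = c' i) -> rightof c j r -> rightof c' j r.
Proof. intros E H i. rewrite H. apply E. lia. Qed.

Lemma mnth_ext c c' j : (forall i, i < j -> c i = c' i) -> mnth c j = mnth c' j.
Proof.
  intros E. apply map_ext_in. intros a Ha. apply in_rev in Ha. apply in_seq in Ha.
  apply E. lia.
Qed.

Definition cells_ok (c : nat -> nat) : Prop := forall j, c j < MARK.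

(** The terms with [tl] and [hd] describe the head just after a left move out of cell j; for j = 0
    it stands on the marker. *)
Lemma go_home c k j r : In k allconts -> cells_ok c -> rightof c j r ->
  exists r', rightof c 0 r' /\
  reach (S j) (Build_config (idx Qs (St 3 k)) (tl (mnth c j ++ [MARK]))
     (hd 0 (mnth c j ++ [MARK])) r)
    (Build_config (idx Qs (St 0 k)) [] MARK r').
Proof.
  intros Hk Hc. revert r. induction j; intros r Hr.
  - exists r. split; auto. simpl. apply reach_step.
    rewrite step_trans with (q' := St 0 k) (s := MARK) (m := MStay);
      [apply reach_refl| apply Qs_St; [lia|auto]| discriminate| |lia].
    simpl. rewrite Nat.eqb_refl. reflexivity.
  - destruct (IHj (c j :: r)) as [r' [Hr' Hreach]]; [apply rightof_cons; auto|].
    exists r'. split; auto. rewrite mnth_S. simpl tl. simpl hd. apply reach_step.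
    rewrite step_trans with (q' := St 3 k) (s := c j) (m := MLeft);
      [exact Hreach| apply Qs_St; [lia|auto]| discriminate| |].
    + simpl. specialize (Hc j). destruct (Nat.eqb_spec (c j) MARK); [lia|reflexivity].
    + specialize (Hc j). lia.
Qed.

Definition scan_reg (k : list prog) : option nat :=
  match k with Push x _ :: _ => Some x | Iter _ x _ :: _ => Some x | _ => None end.

Lemma go_right c k x n r : In k allconts -> cells_ok c -> scan_reg k = Some x ->
  rightof c 0 r -> (forall i, i < n -> digit x (c i) <> 0) ->
  exists r', rightof c (S n) r' /\
  reach (S n) (Build_config (idx Qs (St 0 k)) [] MARK r)
    (Build_config (idx Qs (St 1 k)) (mnth c n ++ [MARK]) (c n) r').
Proof.
  intros Hk Hc Hx Hr. induction n; intros Hd.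
  - exists (tl r). split; [apply rightof_tl; auto|]. apply reach_step.
    rewrite step_trans with (q' := St 1 k) (s := MARK) (m := MRight);
      [| apply Qs_St; [lia|auto]| discriminate| |lia].
    + simpl. rewrite (rightof_hd c 0 r) by auto. apply reach_refl.
    + destruct k as [|[] k]; simpl in *; congruence.
  - destruct IHn as [r' [Hr' Hre]]; [auto|].
    exists (tl r'). split; [apply rightof_tl; auto|].
    eapply reach_trans; [exact Hre| |]. 2: instantiate (1 := 1); lia.
    apply reach_step.
    rewrite step_trans with (q' := St 1 k) (s := c n) (m := MRight);
      [| apply Qs_St; [lia|auto]| discriminate| |].
    + simpl. rewrite (rightof_hd c (S n) r') by auto. rewrite mnth_S. apply reach_refl.
    + assert (H := Hd n (Nat.lt_succ_diag_r n)).
      destruct k as [|[] k]; simpl in Hx |- *; try congruence; inversion Hx; subst;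
      (destruct (Nat.eqb_spec (digit x (c n)) 0); [contradiction|reflexivity]).
    + specialize (Hc n). lia.
Qed.

(** The bottom of each stack is next to the marker and its top is the last occupied place of the
    track, so pushing and popping change a single cell. *)
Definition rep (c : nat -> nat) (g : regs) : Prop :=
  cells_ok c /\ forall j i, i < K -> digit i (c j) = nth j (rev (g i)) 0.

Definition athome (k : list prog) (g : regs) (cf : config) : Prop :=
  exists c r, rep c g /\ rightof c 0 r /\ cf = Build_config (idx Qs (St 0 k)) [] MARK r.

Lemma rep_nonzero c g x i : rep c g -> vregs g -> x < K -> i < length (g x) ->
  digit x (c i) <> 0.
Proof.
  intros [_ H] Hv Hx Hi. rewrite H by auto.
  assert (In (nth i (rev (g x)) 0) (g x)).
  { apply in_rev. apply nth_In. rewrite length_rev. auto. }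
  pose proof (Hv x) as Hf. rewrite Forall_forall in Hf. apply Hf in H0. unfold symbol in H0. lia.
Qed.

Lemma exec_pushes x s k g cf : In (Push x s :: k) allconts -> vregs g ->
  athome (Push x s :: k) g cf ->
  exists cf', athome k (upd g x (s :: g x)) cf' /\ reach (2 * length (g x) + 4) cf cf'.
Proof.
  intros Hk Hv [c [r [Hrep [Hr ->]]]].
  destruct (allconts_closed _ Hk) as [[Hx Hs] Hk']. unfold symbol in Hs.
  set (n := length (g x)).
  destruct (go_right c _ x n r Hk (proj1 Hrep) eq_refl Hr) as [r1 [Hr1 Hre1]].
  { intros i Hi. eapply rep_nonzero; eauto. }
  set (c' := fun j => if Nat.eqb j n then setd x s (c n) else c j).
  assert (Hrep' : rep c' (upd g x (s :: g x))).
  { destruct Hrep as [Hc Hd]. split.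
    - intros j. unfold c'. destruct (Nat.eqb j n); auto. apply setd_lt. lia.
    - intros j i Hi. unfold c', upd. destruct (Nat.eqb_spec j n) as [->|Hj].
      + rewrite digit_setd by lia. destruct (Nat.eqb i x); auto.
        simpl. rewrite app_nth2; rewrite length_rev; fold n; auto.
        rewrite Nat.sub_diag. reflexivity.
      + rewrite Hd by auto. destruct (Nat.eqb_spec i x) as [->|Hix]; auto.
        simpl. destruct (Nat.lt_ge_cases j n).
        * rewrite app_nth1; auto. rewrite length_rev; auto.
        * rewrite !nth_overflow; auto; rewrite ?length_app, ?length_rev; simpl; fold n; lia. }
  destruct (go_home c' k n (c' n :: r1) Hk' (proj1 Hrep')) as [r2 [Hr2 Hre2]].
  { apply rightof_cons. eapply rightof_ext; [|exact Hr1]. intros i Hi. unfold c'.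
    destruct (Nat.eqb_spec i n); [lia|auto]. }
  eexists. split. { exists c', r2. split; [|split]; eauto. }
  eapply reach_trans; [exact Hre1| |]. 2: instantiate (1 := S (S n)); fold n; lia.
  apply reach_step.
  rewrite step_trans with (q' := St 3 k) (s := setd x s (c n)) (m := MLeft);
      [| apply Qs_St; [lia|auto]| discriminate| |].
  - simpl. rewrite (mnth_ext c' c n) in Hre2.
    2:{ intros i Hi. unfold c'. destruct (Nat.eqb_spec i n); [lia|auto]. }
    replace (c' n) with (setd x s (c n)) in Hre2; [exact Hre2|].
    unfold c'. rewrite Nat.eqb_refl. reflexivity.
  - simpl. destruct Hrep as [_ Hd]. rewrite Hd by auto.
    rewrite nth_overflow; [reflexivity|]. rewrite length_rev. fold n. lia.
  - unfold MARK. pose proof (setd_lt x s (c n)). lia.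
Qed.

(** The head goes to the first free place of track x and one cell back. It then stands on the top
    symbol, or on the marker exactly when the stack is empty. *)
Lemma exec_pops a x br k g cf : In (Iter a x br :: k) allconts -> vregs g ->
  athome (Iter a x br :: k) g cf ->
  exists cf', reach (2 * length (g x) + 4) cf cf' /\
  match g x with
  | [] => athome (br 0 :: k) g cf'
  | v :: l => athome (br v :: if a then Iter a x br :: k else k) (upd g x l) cf'
  end.
Proof.
  intros Hk Hv [c [r [Hrep [Hr ->]]]].
  destruct (allconts_closed _ Hk) as [[Hx Hb] Hk'].
  set (n := length (g x)).
  destruct (go_right c _ x n r Hk (proj1 Hrep) eq_refl Hr) as [r1 [Hr1 Hre1]].
  { intros i Hi. eapply rep_nonzero; eauto. }
  assert (Hst : forall l, step machine (Build_config (idx Qs (St 1 (Iter a x br :: k))) l (c n) r1)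
     = moved (idx Qs (St 2 (Iter a x br :: k))) (c n) MLeft l r1).
  { intros l. apply step_trans; [apply Qs_St; [lia|auto]| discriminate| |].
    - simpl. destruct Hrep as [_ Hd]. rewrite Hd by auto.
      rewrite nth_overflow; [reflexivity|]. rewrite length_rev. fold n. lia.
    - destruct Hrep as [Hc _]. specialize (Hc n). lia. }
  destruct (g x) as [|v l] eqn:E.
  - eexists. split.
    + eapply reach_trans; [exact Hre1| |]. 2: instantiate (1 := 2); fold n; lia.
      apply reach_step. rewrite Hst. simpl. apply reach_step.
      rewrite step_trans with (q' := St 0 (br 0 :: k)) (s := MARK) (m := MStay);
        [apply reach_refl| apply Qs_St; [lia|auto]| discriminate| |lia].
      simpl. rewrite Nat.eqb_refl. reflexivity.
    + exists c. exists (c n :: r1). split; [|split]; auto.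
      apply rightof_cons. exact Hr1.
  - assert (Hn : n = S (length l)) by (unfold n; simpl; reflexivity).
    destruct (vregs_pop _ _ _ _ Hv E) as [HvB Hv'].
    assert (Hdv : digit x (c (length l)) = v).
    { destruct Hrep as [_ Hd]. rewrite Hd by auto. rewrite E. simpl.
      rewrite app_nth2; rewrite length_rev; auto. rewrite Nat.sub_diag. reflexivity. }
    set (m := length l) in *.
    set (c' := fun j => if Nat.eqb j m then setd x 0 (c m) else c j).
    assert (Hrep' : rep c' (upd g x l)).
    { destruct Hrep as [Hc Hd]. split.
      - intros j. unfold c'. destruct (Nat.eqb j m); auto. apply setd_lt. lia.
      - intros j i Hi. unfold c', upd. destruct (Nat.eqb_spec j m) as [->|Hj].
        + rewrite digit_setd by lia. destruct (Nat.eqb i x); auto.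
          rewrite nth_overflow; auto. rewrite length_rev. unfold m; lia.
        + rewrite Hd by auto. destruct (Nat.eqb_spec i x) as [->|Hix]; auto.
          rewrite E. simpl. destruct (Nat.lt_ge_cases j m).
          * rewrite app_nth1; auto. rewrite length_rev; auto.
          * rewrite !nth_overflow; auto; rewrite ?length_app, ?length_rev; simpl; fold m; lia. }
    set (kk := if a then Iter a x br :: k else k).
    destruct (Hk' v HvB) as [Hkk _].
    destruct (go_home c' (br v :: kk) m (c' m :: (c n :: r1)) Hkk (proj1 Hrep')) as [r2 [Hr2 Hre2]].
    { apply rightof_cons. rewrite <- Hn.
      replace (c n) with (c' n). 2:{ unfold c'. destruct (Nat.eqb_spec n m); [lia|auto]. }
      apply rightof_cons. eapply rightof_ext; [|exact Hr1]. intros i Hi. unfold c'.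
      destruct (Nat.eqb_spec i m); [lia|auto]. }
    eexists. split.
    2:{ exists c', r2. split; [|split]; eauto. }
    eapply reach_trans; [exact Hre1| |]. 2: instantiate (1 := 2 + S m); fold n; lia.
    apply reach_step. rewrite Hst. simpl moved. rewrite Hn, mnth_S. simpl.
    apply reach_step.
    rewrite step_trans with (q' := St 3 (br v :: kk)) (s := setd x 0 (c m)) (m := MLeft);
        [| apply Qs_St; [lia|auto]| discriminate| |].
    + simpl. rewrite (mnth_ext c' c m) in Hre2.
      2:{ intros i Hi. unfold c'. destruct (Nat.eqb_spec i m); [lia|auto]. }
      replace (c' m) with (setd x 0 (c m)) in Hre2; [|unfold c'; rewrite Nat.eqb_refl; reflexivity].
      rewrite Hn in Hre2. exact Hre2.
    + simpl. destruct Hrep as [Hc _]. specialize (Hc m).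
      destruct (Nat.eqb_spec (c m) MARK); [lia|]. rewrite Hdv. reflexivity.
    + unfold MARK. pose proof (setd_lt x 0 (c m)). lia.
Qed.

Lemma athome_stay p k k' g cf : In (p :: k) allconts ->
  (forall a, trans (St 0 (p :: k)) a = (St 0 k', a, MStay)) ->
  athome (p :: k) g cf -> exists cf', athome k' g cf' /\ reach 1 cf cf'.
Proof.
  intros Hk Hd [c [r [Hrep [Hr ->]]]]. eexists. split; [exists c, r; eauto|].
  apply reach_step. rewrite step_trans with (q' := St 0 k') (s := MARK) (m := MStay);
    [apply reach_refl|apply Qs_St; [lia|auto]|discriminate|apply Hd|lia].
Qed.

(** The closure property leads from [p :: k] down to [k] through [p] itself; for a loop the way out
    is the branch for 0. *)
Lemma allconts_tail p : forall k, wf K p -> In (p :: k) allconts -> In k allconts.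
Proof.
  induction p; intros k Hw Hin; destruct (allconts_closed _ Hin) as [Hw' Hc]; auto.
  - destruct Hw. apply IHp1 in Hc; auto.
  - destruct Hw as [_ Hw]. destruct (Hc 0) as [_ Hc0]; [lia|].
    apply H in Hc0; auto; apply Hw; lia.
Qed.

(** Each operation costs one scan of a track of length at most [bd] and the way back, within
    [2 * bd + 6] steps. The invariant adds the remaining time to the stack lengths, since by
    [exec_length] the time already spent pays for all growth. *)
Lemma exec_reach bd p g g' t : exec p g g' t ->
  forall k cf, In (p :: k) allconts -> vregs g -> (forall r, length (g r) + t <= bd) ->
  athome (p :: k) g cf ->
  exists cf', athome k g' cf' /\ reach (t * (2 * bd + 6)) cf cf'.
Proof.
  induction 1; intros k cf Hk Hv HH Hcf.
  - destruct (athome_stay Skip k k g cf) as [cf' [C1 C2]]; auto.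
    exists cf'. split; auto. destruct C2 as [n [Hn E]]. exists n. split; [lia|auto].
  - destruct (exec_pushes _ _ _ _ _ Hk Hv Hcf) as [cf' [C1 C2]]. exists cf'. split; auto.
    destruct C2 as [n [Hn E]]. exists n. specialize (HH x). split; [lia|auto].
  - destruct (allconts_closed _ Hk) as [[Hw1 Hw2] Hk'].
    destruct (athome_stay (Seq p q) k (p :: q :: k) g1 cf) as [cf1 [C1 C2]]; auto.
    destruct (IHexec1 _ cf1 Hk' Hv) as [cf2 [H3 H4]]; auto.
    { intros r. specialize (HH r). lia. }
    assert (Hv2 : vregs g2) by (eapply exec_valid; eauto).
    destruct (IHexec2 k cf2) as [cf3 [H5 H6]]; auto.
    { exact (allconts_tail p (q :: k) Hw1 Hk'). }
    { intros r. specialize (HH r). epose proof (exec_length p g1 g2 t1 ltac:(eassumption) r). lia. }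
    exists cf3. split; auto. eapply reach_trans; [exact C2| |].
    + eapply reach_trans; [exact H4|exact H6|]. apply le_n.
    + lia.
  - destruct (exec_pops _ _ _ _ _ _ Hk Hv Hcf) as [cf1 [C1 C2]]. rewrite H in *.
    destruct (allconts_closed _ Hk) as [Hw Hk'].
    destruct (Hk' 0) as [_ Hk0]; [lia|].
    destruct (IHexec _ cf1 Hk0 Hv) as [cf2 [H3 H4]]; auto.
    { intros r. specialize (HH r). lia. }
    exists cf2. split; auto. eapply reach_trans; [exact C1|exact H4|]. simpl. lia.
  - destruct (exec_pops _ _ _ _ _ _ Hk Hv Hcf) as [cf1 [C1 C2]]. pose proof (HH x) as HHx.
    rewrite H in *.
    destruct (allconts_closed _ Hk) as [Hw Hk'].
    destruct (vregs_pop _ _ _ _ Hv H) as [HvB Hv'].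
    destruct (Hk' v HvB) as [_ Hk0].
    destruct (IHexec _ cf1 Hk0 Hv') as [cf2 [H3 H4]]; auto.
    { intros r. specialize (HH r). unfold upd. destruct (Nat.eqb_spec r x); [|lia].
      simpl in HHx. lia. }
    exists cf2. split; auto. eapply reach_trans; [exact C1|exact H4|]. simpl in *. lia.
  - destruct (exec_pops _ _ _ _ _ _ Hk Hv Hcf) as [cf1 [H3 H4]]. pose proof (HH x) as HHx.
    rewrite H in *.
    destruct (allconts_closed _ Hk) as [Hw Hk']. destruct Hw as [Hw1 Hw2].
    destruct (vregs_pop _ _ _ _ Hv H) as [HvB Hv'].
    destruct (Hk' v HvB) as [Hk0 _].
    assert (HH1 : forall r, length (upd g x l r) + (t1 + t2) <= bd).
    { intros r. specialize (HH r). unfold upd. destruct (Nat.eqb_spec r x); [|lia].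
      simpl in HHx. lia. }
    destruct (IHexec1 _ cf1 Hk0 Hv') as [cf2 [H5 H6]]; auto.
    { intros r. specialize (HH1 r). lia. }
    destruct (IHexec2 k cf2 Hk) as [cf3 [H7 H8]]; auto.
    { eapply exec_valid; [eassumption| |auto]. apply Hw2; auto. }
    { intros r. specialize (HH1 r). epose proof (exec_length (br v) _ g1 t1 ltac:(eassumption) r). lia. }
    exists cf3. split; auto. eapply reach_trans; [exact H3| |].
    + eapply reach_trans; [exact H6|exact H8|]. apply le_n.
    + simpl in *. lia.
  - destruct (IHexec k cf Hk Hv) as [cf' [C1 C2]]; auto.
    { intros r. specialize (HH r). lia. }
    exists cf'. split; auto. eapply reach_trans; [exact C2|apply (reach_refl 0)|]. nia.
Qed.

Lemma take_nonblank_spec out r : Forall symbol out ->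
  (forall i, nth i r 0 = nth i out 0) -> take_nonblank (hd 0 r :: tl r) = out.
Proof.
  revert r. induction out as [|s out IH]; intros r Hf Hn.
  - assert (hd 0 r = 0) as ->. { specialize (Hn 0). destruct r; auto. } reflexivity.
  - inversion Hf; subst. pose proof (Hn 0) as H0. simpl in H0.
    assert (hd 0 r = s) as ->. { destruct r; auto. }
    simpl. unfold symbol in H1. destruct (Nat.eqb_spec s 0); [lia|]. f_equal.
    destruct r as [|a [|b r]]; simpl in *; [lia| |].
    + specialize (Hn 1). destruct out; auto. simpl in Hn. inversion H2; subst.
      unfold symbol in *. lia.
    + apply (IH (b :: r)); auto. intros i. exact (Hn (S i)).
Qed.

(** The tape shows a stack from its bottom upwards, so stack 0 holds the reversed words. The summand
    3 counts two steps for setting the marker and one for erasing it. *)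
Theorem machine_correct (inp out : str) t : Forall symbol inp -> Forall (fun s => s < 8) inp ->
  Forall symbol out ->
  exec main (fun r => if Nat.eqb r 0 then rev inp else [])
            (fun r => if Nat.eqb r 0 then rev out else []) t ->
  halts_within machine inp (3 + t * (2 * (length inp + t) + 6)) out.
Proof.
  intros Hi H8 Ho Hex.
  set (g := fun r => if Nat.eqb r 0 then rev inp else []) in *.
  set (g' := fun r => if Nat.eqb r 0 then rev out else []) in *.
  assert (HBK := base_le_pow).
  assert (Hzero : forall i, digit i 0 = 0).
  { induction i; simpl; [apply Nat.Div0.mod_0_l|]. rewrite Nat.Div0.div_0_l. auto. }
  set (c := fun j => nth j inp 0).
  assert (Hcs : forall j, c j < 8).
  { intros j. unfold c. destruct (Nat.lt_ge_cases j (length inp)).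
    - rewrite Forall_forall in H8. apply H8. apply nth_In. auto.
    - rewrite nth_overflow; lia. }
  assert (Hrep : rep c g).
  { split; [intros j; specialize (Hcs j); unfold MARK; lia|].
    intros j i Hil. unfold g. destruct i; simpl.
    - rewrite rev_involutive. apply Nat.mod_small. specialize (Hcs j). fold (c j). lia.
    - rewrite Nat.div_small by (specialize (Hcs j); lia). rewrite Hzero. destruct j; auto. }
  assert (Hv : vregs g).
  { intros r. unfold g. destruct (Nat.eqb r 0); auto. apply Forall_rev. auto. }
  assert (Hmc : In [main] allconts) by (right; apply conts_head).
  set (r0 := hd 0 inp :: tl inp).
  assert (Hr0 : rightof c 0 r0).
  { intros [|i]; unfold c; destruct inp; simpl; auto. destruct i; auto. }
  assert (Hstart : reach 2 (init_config machine inp) (Build_config (idx Qs (St 0 [main])) [] MARK r0)).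
  { assert (E : init_config machine inp = Build_config (idx Qs Init) [] (hd 0 inp) (tl inp))
      by (destruct inp; reflexivity).
    rewrite E. apply reach_step.
    rewrite step_trans with (q' := Mark) (s := hd 0 inp) (m := MLeft);
      [|simpl; auto|discriminate|reflexivity|].
    - simpl moved. apply reach_step.
      rewrite step_trans with (q' := St 0 [main]) (s := MARK) (m := MStay);
      [apply reach_refl|simpl; auto|discriminate|reflexivity|lia].
    - specialize (Hcs 0). unfold c in Hcs. unfold MARK. destruct inp; simpl in *; lia. }
  destruct (exec_reach (length inp + t) _ _ _ _ Hex []
    (Build_config (idx Qs (St 0 [main])) [] MARK r0) Hmc Hv) as [cf' [Hh Hre]].
  { intros r. unfold g. destruct (Nat.eqb r 0); rewrite ?length_rev; simpl; lia. }
  { exists c, r0. auto. }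
  destruct Hh as [c' [r' [[Hc' Hd'] [Hr' ->]]]].
  assert (Hfin : reach 1 (Build_config (idx Qs (St 0 [])) [] MARK r')
                    (Build_config (idx Qs Halt) [0] (hd 0 r') (tl r'))).
  { apply reach_step. rewrite step_trans with (q' := Halt) (s := 0) (m := MRight);
      [apply reach_refl|apply Qs_St; [lia|left; auto]|discriminate|reflexivity|lia]. }
  destruct (reach_trans _ _ _ _ _ _ Hstart (reach_trans _ _ _ _ _ _ Hre Hfin (le_n _)) (le_n _))
    as [n [Hn E]].
  exists n. split; [lia|]. rewrite E. simpl. split; auto.
  apply take_nonblank_spec; auto. intros i. rewrite Hr'. simpl.
  rewrite <- (packd_digit K (c' i)) by apply Hc'.
  assert (Ed : forall j, j < K -> digit j (c' i) = if Nat.eqb j 0 then nth i out 0 else 0).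
  { intros j Hj. rewrite Hd' by auto. unfold g'. destruct (Nat.eqb j 0).
    - rewrite rev_involutive. auto.
    - destruct i; auto. }
  apply packd_first; auto.
Qed.

End Machine.

(** * Polynomial-time string functions *)

(** Monotonicity is part of the notion because bounds are evaluated at upper bounds for lengths, and
    these are composed. *)
Definition mpoly (f : nat -> nat) : Prop :=
  (forall n m, n <= m -> f n <= f m) /\ exists c d, forall n, f n <= c * (S n) ^ d.

Lemma mpoly_const c : mpoly (fun _ => c).
Proof. split; [auto|]. exists c, 0. intros. simpl. lia. Qed.

Lemma mpoly_id : mpoly (fun n => n).
Proof. split; [auto|]. exists 1, 1. intros. simpl. lia. Qed.

Lemma mpoly_add f g : mpoly f -> mpoly g -> mpoly (fun n => f n + g n).
Proof.
  intros [Mf [c [d Hf]]] [Mg [c' [d' Hg]]]. split.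
  - intros n m H. specialize (Mf _ _ H). specialize (Mg _ _ H). lia.
  - exists (c + c'), (d + d'). intros n. specialize (Hf n). specialize (Hg n).
    rewrite Nat.pow_add_r.
    assert (1 <= S n ^ d) by (pose proof (Nat.pow_nonzero (S n) d); lia).
    assert (1 <= S n ^ d') by (pose proof (Nat.pow_nonzero (S n) d'); lia). nia.
Qed.

Lemma mpoly_mul f g : mpoly f -> mpoly g -> mpoly (fun n => f n * g n).
Proof.
  intros [Mf [c [d Hf]]] [Mg [c' [d' Hg]]]. split.
  - intros n m H. specialize (Mf _ _ H). specialize (Mg _ _ H). nia.
  - exists (c * c'), (d + d'). intros n. specialize (Hf n). specialize (Hg n).
    rewrite Nat.pow_add_r. nia.
Qed.

Lemma mpoly_S f : mpoly f -> mpoly (fun n => S (f n)).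
Proof. intros H. exact (mpoly_add _ _ (mpoly_const 1) H). Qed.

Lemma mpoly_comp f g : mpoly f -> mpoly g -> mpoly (fun n => f (g n)).
Proof.
  intros [Mf [c [d Hf]]] [Mg [c' [d' Hg]]]. split.
  - auto.
  - exists (c * (S c') ^ d), (d' * d). intros n. specialize (Hf (g n)). specialize (Hg n).
    rewrite Nat.pow_mul_r.
    assert (S (g n) ^ d <= (S c' * S n ^ d') ^ d).
    { apply Nat.pow_le_mono_l. pose proof (Nat.pow_nonzero (S n) d'). nia. }
    rewrite Nat.pow_mul_l in H. nia.
Qed.

Lemma mpoly_pow f d : mpoly f -> mpoly (fun n => f n ^ d).
Proof.
  intros H. induction d; simpl; [apply mpoly_const|]. apply mpoly_mul; auto.
Qed.

Lemma mpoly_mono f n m : mpoly f -> n <= m -> f n <= f m.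
Proof. intros [H _]. auto. Qed.

Ltac mpoly_tac :=
  repeat first [ assumption | apply mpoly_const | apply mpoly_id | apply mpoly_S
    | apply mpoly_add | apply mpoly_mul | apply mpoly_pow
    | match goal with |- mpoly (fun n => ?f (@?g n)) => apply (mpoly_comp f g) end ].

Fixpoint sumf (T : nat -> nat -> nat) (n N : nat) : nat :=
  match n with 0 => 0 | S n' => T n' N + sumf T n' N end.

Lemma mpoly_sumf T n : (forall i, mpoly (T i)) -> mpoly (sumf T n).
Proof.
  intros H. induction n.
  - exact (mpoly_const 0).
  - exact (mpoly_add _ _ (H n) IHn).
Qed.

Lemma sumf_le T n N i : i < n -> T i N <= sumf T n N.
Proof.
  induction n; simpl; [lia|]. intros. destruct (Nat.eq_dec i n); subst; [lia|].
  specialize (IHn ltac:(lia)). lia.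
Qed.

Lemma pick {A} {P : nat -> A -> Prop} : (forall n, exists a, P n a) -> exists f, forall n, P n (f n).
Proof.
  intros H. exists (fun n => proj1_sig (constructive_indefinite_description _ (H n))).
  intros n. destruct (constructive_indefinite_description _ (H n)). auto.
Qed.

Lemma upd_eq g x l : upd g x l x = l.
Proof. unfold upd. rewrite Nat.eqb_refl. auto. Qed.

Lemma upd_neq g x l y : y <> x -> upd g x l y = g y.
Proof. unfold upd. intros. destruct (Nat.eqb_spec y x); congruence. Qed.

Ltac solve_regs :=
  let r := fresh "r" in
  extensionality r; unfold upd;
  repeat (destruct (Nat.eqb_spec r _); subst);
  repeat match goal with |- context [Nat.eqb ?a ?b] =>
    destruct (Nat.eqb_spec a b) end; subst; try lia; try reflexivity; try congruence.

(** * Calling convention and closure properties of polynomial-time functions *)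

Section FPclass.
Variable B : nat.
Notation vsym := (symbol B).
Notation vregs := (vregs B).
Notation wf := (wf B).

Definition clear x := Iter true x (fun _ => Skip).
Definition transfer x y := Iter true x (fun v => if Nat.eqb v 0 then Skip else Push y v).
Definition transfer2 x y z :=
  Iter true x (fun v => if Nat.eqb v 0 then Skip else Seq (Push y v) (Push z v)).
(** Reading a stack destroys and reverses it; moving it to a scratch stack and back restores the
    source and yields the copy in the right order. *)
Definition copy x y := Seq (transfer x (S y)) (transfer2 (S y) x y).
(** Replaces stack b by stack b + 1, which ends a subcomputation: the auxiliary value at b is
    discarded and the result takes its place. *)
Definition pulldown b :=
  Seq (clear b) (Seq (transfer (S b) (S (S b))) (transfer (S (S b)) b)).

Lemma wf_clear K x : x < K -> wf K (clear x).
Proof. simpl; auto. Qed.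

Lemma wf_transfer K x y : x < K -> y < K -> wf K (transfer x y).
Proof.
  intros. split; auto. intros v Hv. destruct (Nat.eqb_spec v 0); simpl; auto.
  split; auto. unfold symbol. lia.
Qed.

Lemma wf_transfer2 K x y z : x < K -> y < K -> z < K -> wf K (transfer2 x y z).
Proof.
  intros. split; auto. intros v Hv. destruct (Nat.eqb_spec v 0); simpl; auto.
  unfold symbol. repeat split; auto; lia.
Qed.

Lemma wf_copy K x y : x < K -> S y < K -> wf K (copy x y).
Proof. split; [apply wf_transfer|apply wf_transfer2]; lia. Qed.

Lemma wf_pulldown K b : S (S b) < K -> wf K (pulldown b).
Proof.
  intros. split; [apply wf_clear; lia|]. split; apply wf_transfer; lia.
Qed.

Lemma exec_clear g x : exec (clear x) g (upd g x []) (3 * length (g x) + 2).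
Proof.
  remember (g x) as l eqn:E. revert g E. induction l; intros g E.
  - replace (upd g x []) with g by solve_regs.
    eapply exec_weak; [apply exec_empty; [auto|apply exec_skip]|]. simpl. lia.
  - eapply exec_weak.
    + eapply exec_again; [symmetry; exact E|apply exec_skip|].
      replace (upd g x []) with (upd (upd g x l) x []) by solve_regs.
      apply IHl. rewrite upd_eq. auto.
    + simpl. lia.
Qed.

Lemma exec_transfer g x y : x <> y -> Forall vsym (g x) ->
  exec (transfer x y) g (upd (upd g x []) y (rev (g x) ++ g y)) (4 * length (g x) + 2).
Proof.
  intros Hxy Hv. remember (g x) as l eqn:E. revert g E. induction l; intros g E.
  - replace (upd _ _ _) with g by solve_regs.
    eapply exec_weak; [apply exec_empty; [auto|apply exec_skip]|]. simpl. lia.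
  - inversion Hv; subst. unfold symbol in H1. eapply exec_weak.
    + eapply exec_again; [symmetry; exact E| |].
      * destruct (Nat.eqb_spec a 0); [lia|]. apply exec_push.
      * replace (upd _ y (rev (a :: l) ++ g y)) with
          (upd (upd (upd (upd g x l) y (a :: upd g x l y)) x []) y
            (rev l ++ upd (upd g x l) y (a :: upd g x l y) y)).
        -- apply (IHl H2). rewrite upd_neq, upd_eq; auto.
        -- rewrite upd_eq, upd_neq by auto. simpl. rewrite <- app_assoc. simpl. solve_regs.
    + simpl. lia.
Qed.

Lemma exec_transfer2 g x y z : x <> y -> x <> z -> y <> z -> Forall vsym (g x) ->
  exec (transfer2 x y z) g
    (upd (upd (upd g x []) y (rev (g x) ++ g y)) z (rev (g x) ++ g z)) (6 * length (g x) + 2).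
Proof.
  intros Hxy Hxz Hyz Hv. remember (g x) as l eqn:E. revert g E. induction l; intros g E.
  - replace (upd _ _ _) with g by solve_regs.
    eapply exec_weak; [apply exec_empty; [auto|apply exec_skip]|]. simpl. lia.
  - inversion Hv; subst. unfold symbol in H1. eapply exec_weak.
    + eapply exec_again; [symmetry; exact E| |].
      * destruct (Nat.eqb_spec a 0); [lia|]. eapply exec_seq; apply exec_push.
      * set (g1 := upd (upd (upd g x l) y (a :: upd g x l y)) z
          (a :: upd (upd g x l) y (a :: upd g x l y) z)).
        replace (upd (upd (upd g x []) y (rev (a :: l) ++ g y)) z (rev (a :: l) ++ g z)) with
          (upd (upd (upd g1 x []) y (rev l ++ g1 y)) z (rev l ++ g1 z)).
        -- apply (IHl H2). unfold g1. rewrite 2!upd_neq, upd_eq; auto.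
        -- unfold g1. rewrite upd_eq. rewrite (upd_neq _ z _ y) by auto. rewrite upd_eq.
           rewrite (upd_neq _ y _ z) by auto. rewrite !upd_neq by auto.
           simpl. rewrite <- !app_assoc. simpl. solve_regs.
    + simpl. lia.
Qed.

Lemma exec_copy g x y : x < y -> vregs g -> g y = [] -> g (S y) = [] ->
  exec (copy x y) g (upd g y (g x)) (10 * length (g x) + 5).
Proof.
  intros Hxy Hv Hy HSy. eapply exec_weak.
  - eapply exec_seq.
    + apply exec_transfer; [lia|apply Hv].
    + replace (upd g y (g x)) with
        (upd (upd (upd (upd (upd g x []) (S y) (rev (g x))) (S y) []) x (g x)) y (g x)) by solve_regs.
      rewrite HSy, app_nil_r.
      set (g1 := upd (upd g x []) (S y) (rev (g x))).
      assert (E1 : g1 (S y) = rev (g x)) by (unfold g1; apply upd_eq).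
      assert (E2 : g x = rev (g1 (S y)) ++ g1 x).
      { rewrite E1, rev_involutive. unfold g1. rewrite upd_neq, upd_eq, app_nil_r by lia. auto. }
      assert (E3 : g x = rev (g1 (S y)) ++ g1 y).
      { rewrite E1, rev_involutive. unfold g1. rewrite !upd_neq, Hy, app_nil_r by lia. auto. }
      replace (upd (upd (upd g1 (S y) []) x (g x)) y (g x)) with
       (upd (upd (upd g1 (S y) []) x (rev (g1 (S y)) ++ g1 x)) y (rev (g1 (S y)) ++ g1 y))
       by (rewrite <- E2, <- E3; reflexivity).
      apply exec_transfer2; try lia. rewrite E1. apply Forall_rev. apply Hv.
  - rewrite upd_eq, length_rev. lia.
Qed.

Lemma exec_pulldown g b l N : vregs g -> g (S b) = l -> g (S (S b)) = [] ->
  length (g b) <= N -> length l <= N ->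
  exec (pulldown b) g (upd (upd g (S b) []) b l) (11 * N + 8).
Proof.
  intros Hv E1 E2 HN1 HN2. eapply exec_weak.
  - eapply exec_seq; [apply exec_clear|]. eapply exec_seq.
    + apply exec_transfer; [lia|]. rewrite upd_neq by lia. apply Hv.
    + rewrite (upd_neq _ _ _ (S b)), (upd_neq _ _ _ (S (S b))) by lia. rewrite E1, E2, app_nil_r.
      set (g1 := upd (upd (upd g b []) (S b) []) (S (S b)) (rev l)).
      replace (upd (upd g (S b) []) b l) with
        (upd (upd g1 (S (S b)) []) b (rev (g1 (S (S b))) ++ g1 b)).
      * apply exec_transfer; [lia|]. unfold g1. rewrite upd_eq. apply Forall_rev.
        rewrite <- E1. apply Hv.
      * unfold g1. rewrite upd_eq, rev_involutive. rewrite !(upd_neq _ _ _ b), upd_eq by lia.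
        rewrite app_nil_r. solve_regs.
  - rewrite upd_eq, upd_neq by lia. rewrite E1, length_rev. lia.
Qed.

(** The calling convention: arguments lie on the stacks [rho], below b in all uses; stacks from b on
    are empty at entry; at exit only stack b has changed and holds the result. Arguments survive and
    scratch space is cleaned, so programs compose without interference. *)
Definition computes {X} (D : X -> Prop) (es : list (X -> str)) (f : X -> str)
  (T : nat -> nat) (rho : list nat) (b K : nat) (p : prog) : Prop :=
  wf K p /\ forall x g N, D x -> vregs g ->
    Forall2 (fun r e => g r = e x) rho es -> (forall r, b <= r -> g r = []) ->
    Forall (fun e => length (e x) <= N) es ->
    exec p g (upd g b (f x)) (T N).

(* On the domain [D], the string [f x] is computable in polynomial time from the
   strings [e x] with [e] in [es]. *)
Definition FP {X} (D : X -> Prop) (es : list (X -> str)) (f : X -> str) : Prop :=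
  exists T, mpoly T /\ forall rho b, length rho = length es -> Forall (fun r => r < b) rho ->
    exists K p, computes D es f T rho b K p.

Lemma FP_ext {X} (D D' : X -> Prop) es (f f' : X -> str) :
  FP D es f -> (forall x, D' x -> D x) -> (forall x, D' x -> f x = f' x) -> FP D' es f'.
Proof.
  intros [T [HT H]] HD Hf. exists T. split; auto. intros rho b Hl Hr.
  destruct (H rho b Hl Hr) as [K [p [Hw Hp]]]. exists K, p. split; auto.
  intros x g N Hx Hv H2 He HN. rewrite <- Hf by auto. apply Hp; auto.
Qed.

Lemma FP_subst {X Y} (D : X -> Prop) (D' : Y -> Prop) es (f : X -> str) (phi : Y -> X) :
  FP D es f -> (forall y, D' y -> D (phi y)) ->
  FP D' (map (fun e y => e (phi y)) es) (fun y => f (phi y)).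
Proof.
  intros [T [HT H]] HD. exists T. split; auto. intros rho b Hl Hr. rewrite length_map in Hl.
  destruct (H rho b Hl Hr) as [K [p [Hw Hp]]]. exists K, p. split; auto.
  intros x g N Hx Hv H2 He HN. apply Hp; auto.
  - clear - H2. remember (map (fun e y => e (phi y)) es) as es' eqn:E. revert es E.
    induction H2; intros [|e es] E; simpl in E; inversion E; subst; constructor; auto.
  - rewrite Forall_map in HN. auto.
Qed.

Lemma FP_weaken {X} (D : X -> Prop) es es' (f : X -> str) :
  FP D es f -> incl es es' -> FP D es' f.
Proof.
  intros [T [HT H]] Hi. exists T. split; auto. intros rho b Hl Hr.
  assert (Hsel : exists rho', length rho' = length es /\ Forall (fun r => r < b) rho' /\
     forall x g, Forall2 (fun r (e : X -> str) => g r = e x) rho es' ->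
        Forall2 (fun r (e : X -> str) => g r = e x) rho' es).
  { clear H. induction es as [|e es IH].
    - exists []. repeat split; auto.
    - destruct IH as [rho' [H1 [H2 H3]]]; [intros a Ha; apply Hi; simpl; auto|].
      assert (He : In e es') by (apply Hi; simpl; auto).
      destruct (In_nth _ _ e He) as [n [Hn En]].
      exists (nth n rho 0 :: rho'). repeat split; simpl; auto.
      + constructor; auto. rewrite Forall_forall in Hr. apply Hr. apply nth_In. lia.
      + intros x g H4. constructor; auto. rewrite <- En. clear - H4 Hn.
        revert n Hn. induction H4; simpl; intros; [lia|]. destruct n; auto.
        apply IHForall2. lia. }
  destruct Hsel as [rho' [H1 [H2 H3]]].
  destruct (H rho' b H1 H2) as [K [p [Hw Hp]]]. exists K, p. split; auto.
  intros x g N Hx Hv H4 He HN. apply Hp; auto.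
  rewrite Forall_forall in *. auto.
Qed.

Lemma FP_var0 {X} (D : X -> Prop) (e : X -> str) : FP D [e] e.
Proof.
  exists (fun N => 10 * N + 5). split; [mpoly_tac|]. intros [|r [|]] b Hl Hr; try discriminate.
  inversion Hr; subst. exists (S (S b)), (copy r b). split; [apply wf_copy; lia|].
  intros x g N Hx Hv H2' He HN.
  assert (E : g r = e x) by (inversion H2'; auto).
  assert (L : length (e x) <= N) by (inversion HN; auto).
  eapply exec_weak; [rewrite <- E; apply exec_copy; auto|]. rewrite E. lia.
Qed.

Lemma FP_var {X} (D : X -> Prop) es (e : X -> str) : In e es -> FP D es e.
Proof.
  intros H. apply (FP_weaken _ [e]); [apply FP_var0|]. intros a [<-|[]]; auto.
Qed.

Lemma FP_nil {X} (D : X -> Prop) es : FP D es (fun _ => []).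
Proof.
  exists (fun _ => 1). split; [mpoly_tac|]. intros rho b Hl Hr. exists 0, Skip. split; [exact I|].
  intros x g N Hx Hv H2 He HN. replace (upd g b []) with g; [apply exec_skip|].
  extensionality r. unfold upd. destruct (Nat.eqb_spec r b); auto. subst. apply He. lia.
Qed.

Lemma FP_cons {X} (D : X -> Prop) es s f : vsym s -> FP D es f -> FP D es (fun x => s :: f x).
Proof.
  intros Hs [T [HT H]]. exists (fun N => S (T N + 1)). split; [mpoly_tac|]. intros rho b Hl Hr.
  destruct (H rho b Hl Hr) as [K [p [Hw Hp]]].
  exists (K + S b), (Seq p (Push b s)). split.
  - split; [eapply wf_mono; [|exact Hw]; lia|]. split; [lia|auto].
  - intros x g N Hx Hv H2 He HN. eapply exec_seq; [exact (Hp x g N Hx Hv H2 He HN)|].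
    replace (upd g b (s :: f x)) with (upd (upd g b (f x)) b (s :: upd g b (f x) b)).
    + apply exec_push.
    + rewrite upd_eq. solve_regs.
Qed.

Lemma Forall2_upd {X} (x : X) g rho es b l : Forall (fun r => r < b) rho ->
  Forall2 (fun r (e : X -> str) => g r = e x) rho es ->
  Forall2 (fun r (e : X -> str) => upd g b l r = e x) rho es.
Proof.
  intros Hr H. induction H; constructor.
  - inversion Hr; subst. rewrite upd_neq; auto. lia.
  - inversion Hr; subst. auto.
Qed.

Lemma Forall_lt_weaken b b' (rho : list nat) : b <= b' ->
  Forall (fun r => r < b) rho -> Forall (fun r => r < b') rho.
Proof. intros H. apply Forall_impl. intros. lia. Qed.

Lemma Forall_le_weaken {X} (x : X) N N' (es : list (X -> str)) : N <= N' ->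
  Forall (fun e => length (e x) <= N) es -> Forall (fun e => length (e x) <= N') es.
Proof. intros H. apply Forall_impl. intros. lia. Qed.

Hypothesis HB : 8 <= B.

(** Composition in the form of a cut: h is left on stack b and serves as one more argument for f,
    whose result goes to b + 1 and is pulled down. The length of h is bounded by its own running
    time. *)
Lemma FP_cut {X} (D : X -> Prop) es f h : FP D es h -> FP D (h :: es) f -> FP D es f.
Proof.
  intros [T1 [HT1 H1]] [T2 [HT2 H2]].
  set (M := fun N => N + T1 N).
  set (L := fun N => T1 N + T2 (M N)).
  assert (HM : mpoly M) by (unfold M; mpoly_tac).
  assert (HL : mpoly L) by (unfold L; mpoly_tac).
  exists (fun N => S (T1 N + S (T2 (M N) + (11 * L N + 8)))). split; [mpoly_tac|].
  intros rho b Hl Hr.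
  destruct (H1 rho b Hl Hr) as [K1 [p1 [Hw1 Hp1]]].
  destruct (H2 (b :: rho) (S b)) as [K2 [p2 [Hw2 Hp2]]]; [simpl; lia| |].
  { constructor; [lia|]. eapply Forall_lt_weaken; [|exact Hr]. lia. }
  exists (K1 + K2 + S (S (S b))), (Seq p1 (Seq p2 (pulldown b))). split.
  - split; [eapply wf_mono; [|exact Hw1]; lia|]. split; [eapply wf_mono; [|exact Hw2]; lia|].
    apply wf_pulldown. lia.
  - intros x g N Hx Hv Hf He HN.
    assert (E1 := Hp1 x g N Hx Hv Hf He HN).
    assert (Hlen1 : length (h x) <= T1 N).
    { pose proof (exec_length _ _ _ _ E1 b) as E. rewrite upd_eq, He in E by lia. exact E. }
    assert (Hv1 : vregs (upd g b (h x))) by (eapply exec_valid; eauto).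
    assert (E2 : exec p2 (upd g b (h x)) (upd (upd g b (h x)) (S b) (f x)) (T2 (M N))).
    { apply Hp2; auto.
      - constructor; [apply upd_eq|]. apply Forall2_upd; auto.
      - intros r Hle. rewrite upd_neq by lia. apply He. lia.
      - constructor; [unfold M; lia|]. eapply Forall_le_weaken; [|exact HN]. unfold M; lia. }
    assert (Hlen2 : length (f x) <= T2 (M N)).
    { pose proof (exec_length _ _ _ _ E2 (S b)) as E.
      rewrite upd_eq, upd_neq, He in E by lia. exact E. }
    assert (Hv2 := exec_valid B HB _ _ _ _ _ E2 Hw2 Hv1).
    eapply exec_seq; [exact E1|]. eapply exec_seq; [exact E2|].
    replace (upd g b (f x)) with
      (upd (upd (upd (upd g b (h x)) (S b) (f x)) (S b) []) b (f x)).
    + apply exec_pulldown; auto.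
      * apply upd_eq.
      * rewrite !upd_neq by lia. apply He. lia.
      * rewrite upd_neq, upd_eq by lia. unfold L. lia.
      * unfold L. lia.
    + extensionality r. unfold upd. destruct (Nat.eqb_spec r b); auto.
      destruct (Nat.eqb_spec r (S b)); auto. subst. symmetry. apply He. lia.
Qed.

Lemma FP_cuts {X} (D : X -> Prop) es hs f : Forall (FP D es) hs -> FP D (hs ++ es) f -> FP D es f.
Proof.
  induction 1; simpl; auto. intros Hf. apply IHForall. apply (FP_cut _ _ _ x); auto.
  apply (FP_weaken _ es); auto. intros a Ha. apply in_or_app. auto.
Qed.

(** The inner map [phi] may take values in any type, such as configurations or assertions; only the
    strings through which f reads its argument have to be computed. *)
Lemma FP_comp {X Y} (D : X -> Prop) (D' : Y -> Prop) es es' (f : X -> str) (phi : Y -> X) :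
  FP D es f -> (forall y, D' y -> D (phi y)) ->
  Forall (fun e => FP D' es' (fun y => e (phi y))) es ->
  FP D' es' (fun y => f (phi y)).
Proof.
  intros Hf HD He. apply (FP_cuts _ _ (map (fun e y => e (phi y)) es)).
  - rewrite Forall_map. exact He.
  - apply (FP_weaken _ (map (fun e y => e (phi y)) es)).
    + eapply FP_subst; eauto.
    + intros a Ha. apply in_or_app. auto.
Qed.

Definition lift {X} (e : X -> str) : X * str -> str := fun y => e (fst y).

Lemma Forall2_lift {X} (x : X) l (g : regs) rho es :
  Forall2 (fun r (e : X -> str) => g r = e x) rho es ->
  Forall2 (fun r (e : X * str -> str) => g r = e (x, l)) rho (map lift es).
Proof. induction 1; simpl; constructor; auto. Qed.

(** The alphabet is finite, so the bounds of the separate branches can be summed into one; symbols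
    outside it get [Skip]. *)
Lemma branches {X} (DD : nat -> X -> Prop) es (f : nat -> X -> str) :
  (forall s, vsym s -> FP (DD s) es (f s)) ->
  exists T, mpoly T /\ forall rho b, length rho = length es -> Forall (fun r => r < b) rho ->
    exists K p, (forall s, wf K (p s)) /\ forall s, vsym s -> computes (DD s) es (f s) T rho b K (p s).
Proof.
  intros H.
  assert (H0 : forall s, exists T, mpoly T /\ (vsym s -> forall rho b, length rho = length es ->
       Forall (fun r => r < b) rho -> exists K p, computes (DD s) es (f s) T rho b K p)).
  { intros s. destruct (excluded_middle_informative (vsym s)) as [Hs|Hs].
    - destruct (H s Hs) as [T [HT H1]]. exists T. split; auto.
    - exists (fun _ => 0). split; [mpoly_tac|]. tauto. }
  destruct (pick H0) as [T HT].
  exists (sumf T B). split; [apply mpoly_sumf; apply HT|]. intros rho b Hl Hr.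
  assert (H1 : forall s, exists Kp : nat * prog, (vsym s \/ snd Kp = Skip) /\
     (vsym s -> computes (DD s) es (f s) (T s) rho b (fst Kp) (snd Kp))).
  { intros s. destruct (excluded_middle_informative (vsym s)) as [Hs|Hs].
    - destruct (HT s) as [_ H1]. destruct (H1 Hs rho b Hl Hr) as [K [p Hp]]. exists (K, p). auto.
    - exists (0, Skip). simpl. tauto. }
  destruct (pick H1) as [Kp HKp].
  exists (sumf (fun s _ => fst (Kp s)) B 0), (fun s => snd (Kp s)).
  assert (Hws : forall s, vsym s -> wf (sumf (fun s _ => fst (Kp s)) B 0) (snd (Kp s))).
  { intros s Hs. destruct (HKp s) as [_ Hc]. destruct (Hc Hs) as [Hw _].
    eapply wf_mono; [|exact Hw]. apply (sumf_le (fun s _ => fst (Kp s))). apply Hs. }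
  split.
  - intros s. destruct (HKp s) as [[Hs|Hs] Hc]; auto. rewrite Hs. exact I.
  - intros s Hs. split; auto. destruct (HKp s) as [_ Hc]. destruct (Hc Hs) as [_ Hp].
    intros x g N Hx Hv Hf He HN. eapply exec_weak; [eapply Hp; eauto|].
    apply sumf_le. apply Hs.
Qed.

(** Popping the first symbol of l leaves its tail on the stack, so the branch receives the tail as a
    new argument, modelled by the second component of the pair. *)
Lemma FP_case {X} (D : X -> Prop) es (l f : X -> str) :
  FP D es l ->
  FP (fun x => D x /\ l x = []) es f ->
  (forall s, vsym s -> FP (fun y => D (fst y) /\ l (fst y) = s :: snd y)
     (snd :: map lift es) (fun y => f (fst y))) ->
  FP D es f.
Proof.
  intros [T0 [HT0 Hl0]] [T1 [HT1 H1]] Hb.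
  destruct (branches (fun s y => D (fst y) /\ l (fst y) = s :: snd y) _ (fun _ y => f (fst y)) Hb) as [T2 [HT2 H2]]. clear Hb.
  set (M := fun N => N + T0 N).
  set (L := fun N => T0 N + (T1 N + T2 (M N))).
  assert (HM : mpoly M) by (unfold M; mpoly_tac).
  assert (HL : mpoly L) by (unfold L; mpoly_tac).
  exists (fun N => S (T0 N + S (S (T1 N + T2 (M N)) + (11 * L N + 8)))). split; [mpoly_tac|].
  intros rho b Hl Hr.
  assert (HrS : Forall (fun r => r < S b) rho) by (eapply Forall_lt_weaken; [|exact Hr]; lia).
  destruct (Hl0 rho b Hl Hr) as [K0 [p0 [Hw0 Hp0]]].
  destruct (H1 rho (S b)) as [K1 [p1 [Hw1 Hp1]]]; auto.
  destruct (H2 (b :: rho) (S b)) as [K2 [p2 [Hw2 Hp2]]]; [simpl; rewrite length_map; lia|auto|].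
  set (br := fun v => if Nat.eqb v 0 then p1 else p2 v).
  exists (K0 + K1 + K2 + S (S (S b))), (Seq p0 (Seq (Iter false b br) (pulldown b))). split.
  - split; [eapply wf_mono; [|exact Hw0]; lia|]. split; [split; [lia|]|apply wf_pulldown; lia].
    intros v Hvb. unfold br. destruct (Nat.eqb v 0).
    + eapply wf_mono; [|exact Hw1]; lia.
    + eapply wf_mono; [|apply Hw2]; lia.
  - intros x g N Hx Hv Hf He HN.
    assert (E1 := Hp0 x g N Hx Hv Hf He HN).
    assert (Hlen1 : length (l x) <= T0 N).
    { pose proof (exec_length _ _ _ _ E1 b) as E. rewrite upd_eq, He in E by lia. exact E. }
    assert (Hv1 : vregs (upd g b (l x))) by (eapply exec_valid; eauto).
    (* Both branches end in the same shape: an arbitrary remainder l' on stack b, to be erased by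
       [pulldown], and the result above it. *)
    assert (E2 : exists l', length l' <= T0 N /\ Forall vsym l' /\ exec (Iter false b br) (upd g b (l x))
        (upd (upd g b l') (S b) (f x)) (S (T1 N + T2 (M N))) /\ length (f x) <= T1 N + T2 (M N) /\ Forall vsym (f x)).
    { destruct (l x) as [|s l'] eqn:E.
      - exists []. split; [simpl; lia|]. split; [constructor|].
        assert (Ex : exec p1 (upd g b []) (upd (upd g b []) (S b) (f x)) (T1 N)).
        { apply Hp1; auto.
          - apply Forall2_upd; auto.
          - intros r Hle. rewrite upd_neq by lia. apply He. lia. }
        split; [|split].
        + apply exec_empty; [apply upd_eq|]. eapply exec_weak; [exact Ex|]. lia.
        + pose proof (exec_length _ _ _ _ Ex (S b)) as E'.
          rewrite upd_eq, upd_neq, He in E' by lia. simpl in E'. lia.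
        + pose proof (exec_valid B HB _ _ _ _ _ Ex Hw1 Hv1 (S b)) as E'. rewrite upd_eq in E'. exact E'.
      - exists l'. simpl in Hlen1. split; [lia|].
        pose proof (Hv1 b) as Hvb. rewrite upd_eq in Hvb. inversion Hvb as [|? ? Hs Hl']; subst.
        split; [auto|].
        assert (Hv1' : vregs (upd g b l')) by (apply vregs_upd; auto).
        destruct (Hp2 s Hs) as [Hws Hps].
        assert (Ex : exec (p2 s) (upd g b l') (upd (upd g b l') (S b) (f x)) (T2 (M N))).
        { apply (Hps (x, l')); auto.
          - constructor; [apply upd_eq|]. apply Forall2_lift. apply Forall2_upd; auto.
          - intros r Hle. rewrite upd_neq by lia. apply He. lia.
          - constructor; [simpl; unfold M; lia|]. rewrite Forall_map. unfold lift. simpl.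
            eapply Forall_le_weaken; [|exact HN]. unfold M; lia. }
        split; [|split].
        + eapply exec_once; [apply upd_eq|].
          replace (upd (upd g b (s :: l')) b l') with (upd g b l') by solve_regs.
          unfold br. destruct (Nat.eqb_spec s 0); [unfold symbol in Hs; lia|].
          eapply exec_weak; [exact Ex|]. lia.
        + pose proof (exec_length _ _ _ _ Ex (S b)) as E'.
          rewrite upd_eq, upd_neq, He in E' by lia. simpl in E'. lia.
        + pose proof (exec_valid B HB _ _ _ _ _ Ex Hws Hv1' (S b)) as E'. rewrite upd_eq in E'. exact E'. }
    destruct E2 as [l' [Hl' [Hvl' [E2 [Hlf Hvf]]]]].
    eapply exec_seq; [exact E1|]. eapply exec_seq; [exact E2|].
    replace (upd g b (f x)) with
      (upd (upd (upd (upd g b l') (S b) (f x)) (S b) []) b (f x)).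
    + apply exec_pulldown; auto.
      * apply vregs_upd; auto. apply vregs_upd; auto.
      * apply upd_eq.
      * rewrite !upd_neq by lia. apply He. lia.
      * rewrite upd_neq, upd_eq by lia. unfold L. lia.
      * unfold L. lia.
    + extensionality r. unfold upd. destruct (Nat.eqb_spec r b); auto.
      destruct (Nat.eqb_spec r (S b)); auto. subst. symmetry. apply He. lia.
Qed.

(* Bounded recursion on notation; without the last premise the lengths could double
   at each step. *)
Lemma FP_rec {X} (D : X -> Prop) es (l : X -> str) (R : X -> str -> str) :
  In l es ->
  FP D es (fun x => R x []) ->
  (forall s, vsym s ->
     FP (fun y => D (fst y) /\ exists pre, l (fst y) = pre ++ s :: snd y)
       (snd :: (fun y => R (fst y) (snd y)) :: map lift es)
       (fun y => R (fst y) (s :: snd y))) ->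
  (exists T, mpoly T /\ forall x N pre l', D x -> Forall (fun e => length (e x) <= N) es ->
     l x = pre ++ l' -> length (R x l') <= T N) ->
  FP D es (fun x => R x (l x)).
Proof.
  intros Hin [T1 [HT1 H1]] Hb [TR [HTR HR]].
  destruct (branches (fun s y => D (fst y) /\ exists pre, l (fst y) = pre ++ s :: snd y) _ (fun s y => R (fst y) (s :: snd y)) Hb) as [T2 [HT2 H2]]. clear Hb.
  set (M := fun N => N + TR N).
  assert (HM : mpoly M) by (unfold M; mpoly_tac).
  set (C := fun N => S (S (T2 (M N) + S ((11 * M N + 8) + 1)))).
  assert (HC : mpoly C) by (unfold C; mpoly_tac).
  (* [C N] bounds one pass of the loop, with one pass for each symbol of l; the constants 100
     generously cover the copying before and after. *)
  exists (fun N => 100 * M N + 100 + T1 N + (N + 1) * C N). split; [mpoly_tac|].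
  intros rho b Hl Hr.
  assert (Hl0 : exists r0, r0 < b /\ forall x g, Forall2 (fun r e => g r = e x) rho es -> g r0 = l x).
  { destruct (In_nth _ _ l Hin) as [n [Hn En]]. exists (nth n rho 0). split.
    - rewrite Forall_forall in Hr. apply Hr. apply nth_In. lia.
    - intros x g Hf. rewrite <- En. clear - Hf Hn.
      revert n Hn. induction Hf; simpl; intros; [lia|]. destruct n; auto. apply IHHf. lia. }
  destruct Hl0 as [r0 [Hr0 Hl0]].
  destruct (H1 rho (S (S b))) as [K1 [p1 [Hw1 Hp1]]]; auto.
  { eapply Forall_lt_weaken; [|exact Hr]; lia. }
  destruct (H2 (b :: S (S b) :: rho) (S (S (S b)))) as [K2 [p2 [Hw2 Hp2]]].
  { simpl. rewrite length_map; lia. }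
  { constructor; [lia|]. constructor; [lia|]. eapply Forall_lt_weaken; [|exact Hr]; lia. }
  set (br := fun s => if Nat.eqb s 0 then Skip else Seq (p2 s) (Seq (pulldown (S (S b))) (Push b s))).
  set (K := K1 + K2 + S (S (S (S (S b))))).
  exists K, (Seq (copy r0 b) (Seq (transfer b (S b)) (Seq p1 (Seq (Iter true (S b) br)
     (Seq (clear b) (Seq (transfer (S (S b)) (S b)) (transfer (S b) b))))))). split.
  - unfold K. split; [apply wf_copy; lia|]. split; [apply wf_transfer; lia|].
    split; [eapply wf_mono; [|exact Hw1]; lia|]. split; [split; [lia|]|].
    + intros v Hvb. unfold br. destruct (Nat.eqb_spec v 0); [exact I|].
      split; [eapply wf_mono; [|apply Hw2]; lia|]. split; [apply wf_pulldown; lia|].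
      split; [lia|unfold symbol; lia].
    + split; [apply wf_clear; lia|]. split; apply wf_transfer; lia.
  - intros x g N Hx Hv Hf He HN.
    assert (HlN : length (l x) <= N) by (rewrite Forall_forall in HN; auto).
    assert (Hvl : Forall vsym (l x)) by (rewrite <- (Hl0 x g Hf); apply Hv).
    (* The loop state: the suffix already treated, the remaining prefix in reverse order, and the
       value of R at the suffix. Each pass takes the next symbol from the right end of the
       prefix. *)
    set (st := fun suf rem => upd (upd (upd g b suf) (S b) rem) (S (S b)) (R x suf)).
    assert (Ec : exec (copy r0 b) g (upd g b (l x)) (10 * N + 5)).
    { rewrite <- (Hl0 x g Hf). eapply exec_weak; [apply exec_copy; auto|].
      rewrite (Hl0 x g Hf). lia. }
    assert (Et : exec (transfer b (S b)) (upd g b (l x)) (upd g (S b) (rev (l x))) (4 * N + 2)).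
    { replace (upd g (S b) (rev (l x))) with
        (upd (upd (upd g b (l x)) b []) (S b) (rev (upd g b (l x) b) ++ upd g b (l x) (S b))).
      - eapply exec_weak; [apply exec_transfer; [lia|]|]; rewrite upd_eq; auto. lia.
      - rewrite upd_eq, upd_neq, He, app_nil_r by lia. extensionality r. unfold upd.
        destruct (Nat.eqb_spec r (S b)); auto. destruct (Nat.eqb_spec r b); auto.
        subst. symmetry. apply He. lia. }
    assert (Hv1 : vregs (upd g (S b) (rev (l x)))).
    { apply vregs_upd; auto. apply Forall_rev. auto. }
    assert (Eb : exec p1 (upd g (S b) (rev (l x))) (st [] (rev (l x))) (T1 N)).
    { replace (st [] (rev (l x))) with (upd (upd g (S b) (rev (l x))) (S (S b)) (R x [])).
      - apply Hp1; auto.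
        + apply Forall2_upd; auto. eapply Forall_lt_weaken; [|exact Hr]; lia.
        + intros r Hle. rewrite upd_neq by lia. apply He. lia.
      - unfold st. extensionality r. unfold upd. destruct (Nat.eqb_spec r (S (S b))); auto.
        destruct (Nat.eqb_spec r (S b)); auto. destruct (Nat.eqb_spec r b); auto.
        subst. apply He. lia. }
    assert (HvR0 : Forall vsym (R x [])).
    { pose proof (exec_valid B HB _ _ _ _ _ Eb Hw1 Hv1 (S (S b))) as E'.
      unfold st in E'. rewrite upd_eq in E'. exact E'. }
    assert (Hloop : forall rem suf, l x = rev rem ++ suf -> Forall vsym (R x suf) ->
       exec (Iter true (S b) br) (st suf rem) (st (l x) []) ((length rem) * C N + 2) /\ Forall vsym (R x (l x))).
    { induction rem as [|s rem IH]; intros suf E HvR.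
      - simpl in E. subst suf. split; auto. eapply exec_weak; [apply exec_empty; [|apply exec_skip]|].
        + unfold st. rewrite upd_neq, upd_eq by lia. auto.
        + lia.
      - simpl in E. rewrite <- app_assoc in E. simpl in E.
        assert (Hvls := Hvl). rewrite E in Hvls. apply Forall_app in Hvls.
        destruct Hvls as [Hvrem Hvls]. inversion Hvls as [|? ? Hs Hvsuf]; subst.
        apply Forall_rev in Hvrem. rewrite rev_involutive in Hvrem.
        assert (Hlensuf : length suf <= N).
        { rewrite E in HlN. rewrite length_app in HlN. simpl in HlN. lia. }
        assert (HlenR : length (R x suf) <= TR N).
        { apply (HR x N (rev rem ++ [s])); auto. rewrite <- app_assoc. exact E. }
        assert (HlenR' : length (R x (s :: suf)) <= TR N) by (apply (HR x N (rev rem)); auto).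
        destruct (Hp2 s Hs) as [Hws Hps].
        assert (Hv2 : vregs (st suf rem)).
        { unfold st. repeat apply vregs_upd; auto. }
        assert (Es : exec (p2 s) (st suf rem) (upd (st suf rem) (S (S (S b))) (R x (s :: suf))) (T2 (M N))).
        { apply (Hps (x, suf)); auto.
          - simpl. split; auto. exists (rev rem). auto.
          - constructor; [unfold st; rewrite !upd_neq, upd_eq by lia; reflexivity|].
            constructor; [unfold st; rewrite upd_eq by lia; reflexivity|].
            apply Forall2_lift. unfold st. repeat apply Forall2_upd; auto;
              (eapply Forall_lt_weaken; [|exact Hr]; lia).
          - intros r Hle. unfold st. rewrite !upd_neq by lia. apply He. lia.
          - constructor; [simpl; unfold M; lia|]. constructor; [simpl; unfold M; lia|].
            rewrite Forall_map. unfold lift. simpl.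
            eapply Forall_le_weaken; [|exact HN]. unfold M; lia. }
        assert (Hv3 := exec_valid B HB _ _ _ _ _ Es Hws Hv2).
        assert (HvR' : Forall vsym (R x (s :: suf))).
        { specialize (Hv3 (S (S (S b)))). rewrite upd_eq in Hv3. exact Hv3. }
        destruct (IH (s :: suf) E HvR') as [IH1 IH2]. split; auto.
        eapply exec_weak.
        + eapply exec_again with (g1 := st (s :: suf) rem) (t1 := S (T2 (M N) + S ((11 * M N + 8) + 1))).
          * unfold st. rewrite upd_neq, upd_eq by lia. reflexivity.
          * unfold br. destruct (Nat.eqb_spec s 0); [unfold symbol in Hs; lia|].
            replace (upd (st suf (s :: rem)) (S b) rem) with (st suf rem) by (unfold st; solve_regs).
            eapply exec_seq; [exact Es|].
            set (g3 := upd (st suf rem) (S (S (S b))) (R x (s :: suf))) in *.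
            set (g4 := upd (upd g3 (S (S (S b))) []) (S (S b)) (R x (s :: suf))).
            eapply exec_seq with (g2 := g4).
            -- apply exec_pulldown; auto.
               ++ unfold g3. apply upd_eq.
               ++ unfold g3, st. rewrite !upd_neq by lia. apply He. lia.
               ++ unfold g3, st. rewrite upd_neq, upd_eq by lia. unfold M. lia.
               ++ unfold M. lia.
            -- replace (st (s :: suf) rem) with (upd g4 b (s :: g4 b)); [apply exec_push|].
               unfold g4, g3, st. rewrite !upd_neq, upd_eq by lia.
               extensionality r. unfold upd.
               destruct (Nat.eqb_spec r b); [destruct (Nat.eqb_spec r (S (S b))); [lia|];
                 destruct (Nat.eqb_spec r (S b)); [lia|auto]|].
               destruct (Nat.eqb_spec r (S (S b))); auto.
               destruct (Nat.eqb_spec r (S (S (S b)))); auto.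
               destruct (Nat.eqb_spec r (S b)); [lia|]. subst. symmetry. apply He. lia.
          * exact IH1.
        + unfold C. simpl length. lia. }
    destruct (Hloop (rev (l x)) []) as [El HvRl]; auto.
    { rewrite rev_involutive, app_nil_r. reflexivity. }
    rewrite length_rev in El.
    assert (HlenRl : length (R x (l x)) <= TR N) by (apply (HR x N []); auto).
    assert (Hve : vregs (st (l x) [])).
    { unfold st. repeat apply vregs_upd; auto. }
    set (g5 := upd (st (l x) []) b []).
    assert (Hv5 : vregs g5) by (apply vregs_upd; auto).
    assert (E5 : g5 (S (S b)) = R x (l x)) by (unfold g5, st; rewrite upd_neq, upd_eq by lia; auto).
    set (g6 := upd (upd g5 (S (S b)) []) (S b) (rev (R x (l x)))).
    assert (E6 : exec (transfer (S (S b)) (S b)) g5 g6 (4 * TR N + 2)).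
    { unfold g6. replace (rev (R x (l x))) with (rev (g5 (S (S b))) ++ g5 (S b)).
      - eapply exec_weak; [apply exec_transfer; [lia|apply Hv5]|]. rewrite E5. lia.
      - rewrite E5. unfold g5, st. rewrite !upd_neq, upd_eq, app_nil_r by lia. auto. }
    assert (E7 : exec (transfer (S b) b) g6 (upd g b (R x (l x))) (4 * TR N + 2)).
    { assert (G1 : g6 (S b) = rev (R x (l x))) by (unfold g6; apply upd_eq).
      assert (G2 : g6 b = []) by (unfold g6, g5; rewrite !upd_neq, upd_eq by lia; auto).
      replace (upd g b (R x (l x))) with (upd (upd g6 (S b) []) b (rev (g6 (S b)) ++ g6 b)).
      - eapply exec_weak; [apply exec_transfer; [lia|]|]; rewrite G1; [apply Forall_rev; auto|].
        rewrite length_rev. lia.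
      - rewrite G1, G2, rev_involutive, app_nil_r. unfold g6, g5, st.
        extensionality r. unfold upd. destruct (Nat.eqb_spec r b); auto.
        destruct (Nat.eqb_spec r (S b)); [subst; symmetry; apply He; lia|].
        destruct (Nat.eqb_spec r (S (S b))); auto. subst. symmetry; apply He; lia. }
    eapply exec_weak.
    { eapply exec_seq; [exact Ec|]. eapply exec_seq; [exact Et|]. eapply exec_seq; [exact Eb|].
      eapply exec_seq; [exact El|]. eapply exec_seq; [apply exec_clear|].
      eapply exec_seq; [exact E6|exact E7]. }
    assert (length (st (l x) [] b) <= N).
    { unfold st. rewrite !upd_neq, upd_eq by lia. auto. }
    assert (length (l x) * C N <= N * C N) by (apply Nat.mul_le_mono_r; auto).
    unfold M in *. lia.
Qed.


(** A transfer reverses its stack, which undoes the reversed layout of the input and produces that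
    of the output. All other stacks are emptied, so that the final cells contain track 0 only. *)
Lemma FP_TM {X} (D : X -> Prop) inp (F : X -> str) :
  FP D [inp] F -> (forall x, D x -> Forall vsym (inp x) /\ Forall (fun s => s < 8) (inp x)) ->
  exists (M : TM) c d, forall x, D x -> exists t, t <= c * (S (length (inp x))) ^ d /\
    halts_within M (inp x) t (F x).
Proof.
  intros [T [HT H]] Hinp.
  destruct (H [1] 2) as [K [p [Hw Hp]]]; [reflexivity|constructor; [lia|constructor]|]. clear H.
  set (main := Seq (transfer 0 1) (Seq p (Seq (clear 1) (transfer 2 0)))).
  assert (Hmain : wf (K + 3) main).
  { split; [apply wf_transfer; lia|]. split; [eapply wf_mono; [|exact Hw]; lia|].
    split; [apply wf_clear; lia|apply wf_transfer; lia]. }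
  set (tt := fun N => 100 * N + 100 + 100 * T N).
  assert (Htt : mpoly tt) by (unfold tt; mpoly_tac).
  assert (Hfin : mpoly (fun N => 3 + tt N * (2 * (N + tt N) + 6))) by mpoly_tac.
  destruct Hfin as [_ [c [d Hcd]]].
  assert (HK1 : 1 <= K + 3) by lia.
  exists (machine B HB (K + 3) main HK1 Hmain), c, d. intros x Hx.
  destruct (Hinp x Hx) as [Hv H8].
  exists (3 + tt (length (inp x)) * (2 * (length (inp x) + tt (length (inp x))) + 6)).
  split; [apply Hcd|].
  set (g0 := fun r => if Nat.eqb r 0 then rev (inp x) else []).
  set (g1 := fun r => if Nat.eqb r 1 then inp x else []).
  assert (Hv0 : vregs g0).
  { intros r. unfold g0. destruct (Nat.eqb r 0); auto. apply Forall_rev; auto. }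
  assert (Hv1 : vregs g1).
  { intros r. unfold g1. destruct (Nat.eqb r 1); auto. }
  assert (E1 : exec (transfer 0 1) g0 g1 (4 * length (inp x) + 2)).
  { replace g1 with (upd (upd g0 0 []) 1 (rev (g0 0) ++ g0 1)).
    - eapply exec_weak; [apply exec_transfer; [lia|apply Hv0]|]. unfold g0. simpl.
      rewrite length_rev. lia.
    - unfold g0. simpl. rewrite rev_involutive, app_nil_r. extensionality r. unfold upd, g1.
      destruct (Nat.eqb_spec r 1); auto. destruct (Nat.eqb_spec r 0); auto. }
  assert (E2 : exec p g1 (upd g1 2 (F x)) (T (length (inp x)))).
  { apply Hp; auto. intros r Hr. unfold g1. destruct (Nat.eqb_spec r 1); [lia|auto]. }
  assert (Hv2 := exec_valid B HB _ _ _ _ _ E2 Hw Hv1).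
  assert (HvF : Forall vsym (F x)).
  { specialize (Hv2 2). rewrite upd_eq in Hv2. exact Hv2. }
  assert (HlF : length (F x) <= T (length (inp x))).
  { pose proof (exec_length _ _ _ _ E2 2) as E. rewrite upd_eq in E. unfold g1 in E. simpl in E. exact E. }
  set (g3 := upd (upd g1 2 (F x)) 1 []).
  set (gf := (fun r => if Nat.eqb r 0 then rev (F x) else []) : regs).
  assert (E4 : exec (transfer 2 0) g3 gf (4 * length (F x) + 2)).
  { assert (E : gf = upd (upd g3 2 []) 0 (rev (g3 2) ++ g3 0)).
    { assert (G2 : g3 2 = F x) by reflexivity. assert (G0 : g3 0 = []) by reflexivity.
      rewrite G2, G0, app_nil_r. extensionality r. unfold gf, upd, g3, upd, g1.
      destruct (Nat.eqb_spec r 0); auto. destruct (Nat.eqb_spec r 2); auto.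
      destruct (Nat.eqb_spec r 1); auto. }
    rewrite E. apply exec_transfer; [lia|]. exact HvF. }
  apply machine_correct; auto. fold g0. eapply exec_weak.
  - eapply exec_seq; [exact E1|]. eapply exec_seq; [exact E2|].
    eapply exec_seq; [apply exec_clear|].
    exact E4.
  - rewrite upd_neq by lia. unfold g1 at 1. rewrite Nat.eqb_refl. unfold tt. lia.
Qed.

End FPclass.

(** * Strings and integer arithmetic *)

Ltac find_in := simpl; first [left; reflexivity | right; find_in].
Ltac fpvar := apply FP_var; find_in.

Lemma skipn_tl {A} n (l : list A) : skipn (S n) l = tl (skipn n l).
Proof. revert l. induction n; intros [|a l]; simpl; auto. rewrite <- IHn. destruct l; auto. Qed.

Lemma length_concat_repeat {A} (l : list A) n : length (concat (repeat l n)) = n * length l.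
Proof. induction n; simpl; auto. rewrite length_app. lia. Qed.

Lemma encP_nonnil p : encP p <> [].
Proof. destruct p; discriminate. Qed.

Lemma encP_bits p : Forall (fun s => s = 1 \/ s = 2) (encP p).
Proof. induction p; simpl; auto. Qed.

(** Every symbol other than 2 counts as bit 0, so [bval] is total on strings and padding is
    harmless. *)
Definition bit (s : nat) : Z := if Nat.eqb s 2 then 1 else 0.
Fixpoint bval (l : str) : Z := match l with [] => 0 | s :: l' => bit s + 2 * bval l' end.

Lemma bit_range s : (0 <= bit s <= 1)%Z.
Proof. unfold bit. destruct (Nat.eqb s 2); lia. Qed.

Lemma bval_range l : (0 <= bval l < 2 ^ Z.of_nat (length l))%Z.
Proof.
  induction l; cbn [bval length]; [lia|]. rewrite Nat2Z.inj_succ, Z.pow_succ_r by lia.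
  pose proof (bit_range a). lia.
Qed.

Lemma bval_encP p : bval (encP p) = Zpos p.
Proof. induction p; cbn [bval encP bit]; rewrite ?IHp; try reflexivity; unfold bit; simpl Nat.eqb; lia. Qed.

Lemma encP_length p n : (Zpos p < 2 ^ Z.of_nat n)%Z -> length (encP p) <= n.
Proof.
  revert n. induction p; intros [|n] H; cbn [encP length]; try (simpl in H; lia);
  rewrite Nat2Z.inj_succ, Z.pow_succ_r in H by lia; apply le_n_S; try apply IHp; lia.
Qed.

Lemma encZ_length z n : (Z.abs z < 2 ^ Z.of_nat n)%Z -> length (encZ z) <= S n.
Proof.
  destruct z; simpl; [lia| |]; intros H; apply encP_length in H; lia.
Qed.

Lemma encZ_bound z : (Z.abs z < 2 ^ Z.of_nat (length (encZ z)))%Z.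
Proof.
  assert (E : forall p, (Zpos p < 2 ^ Z.of_nat (length (encP p)))%Z).
  { induction p; cbn [encP length]; rewrite ?Nat2Z.inj_succ, ?Z.pow_succ_r by lia; lia. }
  destruct z; cbn [encZ length]; [simpl; lia|apply E|].
  specialize (E p). rewrite Nat2Z.inj_succ, Z.pow_succ_r by lia. lia.
Qed.

Lemma bval_encZ z : (0 <= z)%Z -> bval (encZ z) = z.
Proof. destruct z; simpl; intros; [reflexivity|apply bval_encP|lia]. Qed.

Lemma encZ_sign z s l : encZ z = s :: l ->
  (s = 4 /\ z = (- bval l)%Z) \/ (s <> 4 /\ z = bval (encZ z)).
Proof.
  intros E. destruct z.
  - right. inversion E. subst. split; [lia|reflexivity].
  - right. split; [|symmetry; apply bval_encP].
    pose proof (encP_bits p) as H. simpl in E. rewrite E in H. inversion H; lia.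
  - left. simpl in E. inversion E; subst. rewrite bval_encP. auto.
Qed.

Lemma encZ_nonnil z : encZ z <> [].
Proof. destruct z; try discriminate. apply encP_nonnil. Qed.

(** * String operations and signed binary arithmetic *)

Section Strings.
Variable B : nat.
Hypothesis HB : 8 <= B.
Notation vsym := (symbol B).
Notation FP := (FP B).

Lemma FP_const {X} (D : X -> Prop) es c : Forall vsym c -> FP D es (fun _ => c).
Proof.
  induction 1; [apply FP_nil|]. apply (FP_cons _ _ _ x (fun _ => l)); auto.
Qed.

Lemma FP_lift {X} (D : X -> Prop) (D' : X * str -> Prop) es es' f :
  FP D es f -> (forall y, D' y -> D (fst y)) -> incl (map lift es) es' ->
  FP D' es' (fun y => f (fst y)).
Proof.
  intros Hf HD Hi. eapply FP_weaken; [|exact Hi]. exact (FP_subst _ _ D' _ _ fst Hf HD).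
Qed.

Definition FP1 (F : str -> str) : Prop := FP (fun _ => True) [fun l => l] F.
Definition FP2 (F : str -> str -> str) : Prop :=
  FP (fun _ => True) [fst; snd] (fun p : str * str => F (fst p) (snd p)).

Lemma FP_fun1 {X} (D : X -> Prop) es F f : FP1 F -> FP D es f -> FP D es (fun x => F (f x)).
Proof.
  intros HF Hf. apply (FP_comp B HB (fun _ => True) D [fun l => l] es F f); auto.
Qed.

Lemma FP_fun2 {X} (D : X -> Prop) es F f g : FP2 F -> FP D es f -> FP D es g ->
  FP D es (fun x => F (f x) (g x)).
Proof.
  intros HF Hf Hg.
  apply (FP_comp B HB (fun _ => True) D [fst; snd] es
           (fun p : str * str => F (fst p) (snd p)) (fun x => (f x, g x))); auto.
Qed.

Lemma FP1_id : FP1 (fun l => l).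
Proof. apply FP_var0. Qed.

Lemma FP1_match (F : str -> str) : Forall vsym (F []) ->
  (forall s, vsym s -> FP1 (fun l => F (s :: l))) -> FP1 F.
Proof.
  intros H0 Hs. apply (FP_case B HB _ _ (fun l => l)).
  - apply FP1_id.
  - apply (FP_ext _ (fun _ => True) _ _ (fun _ => F [])); auto.
    + apply FP_const; auto.
    + intros x [_ ->]. auto.
  - intros s Hv. apply (FP_ext _ (fun _ => True) _ _ (fun y => F (s :: snd y))); auto.
    + apply (FP_fun1 _ _ (fun l => F (s :: l)) snd); auto. fpvar.
    + intros y [_ E]. congruence.
Qed.

Lemma FP1_rec (R : str -> str) (h : nat -> str -> str -> str) : Forall vsym (R []) ->
  (forall s l, R (s :: l) = h s l (R l)) ->
  (forall s, vsym s -> FP2 (h s)) ->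
  (exists T, mpoly T /\ forall l, length (R l) <= T (length l)) ->
  FP1 R.
Proof.
  intros H0 HR Hs [T [HT Hb]].
  apply (FP_rec B HB (fun _ => True) [fun l => l] (fun l => l) (fun _ => R)).
  - simpl; auto.
  - apply FP_const; auto.
  - intros s Hv. apply (FP_ext _ (fun _ => True) _ _ (fun y => h s (snd y) (R (snd y)))); auto.
    apply (FP_fun2 _ _ (h s) snd (fun y => R (snd y))); auto; fpvar.
  - exists T. split; auto. intros x N pre l' _ HN E. pose proof (Forall_inv HN) as H1. cbv beta in H1.
    eapply Nat.le_trans; [apply Hb|]. apply mpoly_mono; auto.
    rewrite E, length_app in H1. lia.
Qed.

Lemma FP2_rec (R : str -> str -> str) (h : nat -> str -> str -> str -> str) :
  FP1 (fun p => R p []) ->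
  (forall s p l, R p (s :: l) = h s p l (R p l)) ->
  (forall s, vsym s -> FP (fun _ => True) [fun q => fst (fst q); fun q => snd (fst q); snd]
     (fun q : str * str * str => h s (fst (fst q)) (snd (fst q)) (snd q))) ->
  (exists T, mpoly T /\ forall p l, length (R p l) <= T (length p + length l)) ->
  FP2 R.
Proof.
  intros H0 HR Hs [T [HT Hb]].
  apply (FP_rec B HB (fun _ => True) [fst; snd] snd (fun x => R (fst x))).
  - simpl; auto.
  - apply (FP_fun1 _ _ (fun p => R p []) fst); auto. fpvar.
  - intros s Hv.
    apply (FP_ext _ (fun _ => True) _ _
       (fun y => h s (fst (fst y)) (snd y) (R (fst (fst y)) (snd y)))); auto.
    apply (FP_comp B HB (fun _ => True) _ _ _
       (fun q : str * str * str => h s (fst (fst q)) (snd (fst q)) (snd q))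
       (fun y : str * str * str => (fst (fst y), snd y, R (fst (fst y)) (snd y))) (Hs s Hv)); auto.
    repeat constructor; fpvar.
  - exists (fun N => T (N + N)). split; [mpoly_tac|]. intros x N pre l' _ HN E.
    pose proof (Forall_inv HN) as H1. pose proof (Forall_inv (Forall_inv_tail HN)) as H4.
    cbv beta in *.
    eapply Nat.le_trans; [apply Hb|]. apply mpoly_mono; auto.
    rewrite E, length_app in H4. lia.
Qed.

Lemma FP1_cons s F : vsym s -> FP1 F -> FP1 (fun l => s :: F l).
Proof. intros. apply FP_cons; auto. Qed.

Lemma FP1_tl : FP1 (fun l => tl l).
Proof.
  apply FP1_match; simpl; auto. intros. apply FP1_id.
Qed.

Lemma FP_tl {X} (D : X -> Prop) es f : FP D es f -> FP D es (fun x => tl (f x)).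
Proof. intros. apply (FP_fun1 _ _ (fun l => tl l)); auto. apply FP1_tl. Qed.

Lemma FP_app {X} (D : X -> Prop) es f g : FP D es f -> FP D es g -> FP D es (fun x => f x ++ g x).
Proof.
  (* The arguments are exchanged because [FP2_rec] recurses on the second one. *)
  intros Hf Hg. apply (FP_fun2 _ _ (fun b a => a ++ b) g f); auto.
  apply FP2_rec with (h := fun s _ _ r => s :: r); auto.
  - apply FP1_id.
  - intros s Hs. apply FP_cons; auto. fpvar.
  - exists (fun N => N). split; [mpoly_tac|]. intros. rewrite length_app. lia.
Qed.

Lemma FP_skipn {X} (D : X -> Prop) es f g : FP D es f -> FP D es g ->
  FP D es (fun x => skipn (length (f x)) (g x)).
Proof.
  intros Hf Hg. apply (FP_fun2 _ _ (fun b a => skipn (length a) b) g f); auto.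
  apply FP2_rec with (h := fun _ _ _ r => tl r).
  - apply FP1_id.
  - intros. simpl length. apply skipn_tl.
  - intros s Hs. apply FP_tl. fpvar.
  - exists (fun N => N). split; [mpoly_tac|]. intros. rewrite length_skipn. lia.
Qed.

Lemma FP_map {X} (D : X -> Prop) es k f : (forall s, vsym s -> vsym (k s)) ->
  FP D es f -> FP D es (fun x => map k (f x)).
Proof.
  intros Hk Hf. apply FP_fun1; auto.
  apply FP1_rec with (h := fun s _ r => k s :: r); simpl; auto.
  - intros s Hs. apply FP_cons; auto. fpvar.
  - exists (fun N => N). split; [mpoly_tac|]. intros. rewrite length_map. lia.
Qed.

Fixpoint upto (c : nat) (l : str) : str :=
  match l with [] => [] | s :: l' => if Nat.eqb s c then [] else s :: upto c l' end.

Fixpoint after (c : nat) (l : str) : str :=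
  match l with [] => [] | s :: l' => if Nat.eqb s c then l' else after c l' end.

Lemma FP_upto {X} (D : X -> Prop) es c f : FP D es f -> FP D es (fun x => upto c (f x)).
Proof.
  intros Hf. apply FP_fun1; auto.
  apply FP1_rec with (h := fun s _ r => if Nat.eqb s c then [] else s :: r); simpl; auto.
  - intros s Hs. destruct (Nat.eqb s c); [apply FP_nil|]. apply FP_cons; auto. fpvar.
  - exists (fun N => N). split; [mpoly_tac|].
    induction l; simpl; auto. destruct (Nat.eqb a c); simpl; lia.
Qed.

Lemma FP_after {X} (D : X -> Prop) es c f : FP D es f -> FP D es (fun x => after c (f x)).
Proof.
  intros Hf. apply FP_fun1; auto.
  apply FP1_rec with (h := fun s l r => if Nat.eqb s c then l else r); simpl; auto.
  - intros s Hs. destruct (Nat.eqb s c); fpvar.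
  - exists (fun N => N). split; [mpoly_tac|].
    induction l; simpl; auto. destruct (Nat.eqb a c); simpl; lia.
Qed.

Lemma upto_app c l r : ~ In c l -> upto c (l ++ c :: r) = l.
Proof.
  induction l; simpl; intros H.
  - rewrite Nat.eqb_refl. auto.
  - destruct (Nat.eqb_spec a c); [tauto|]. rewrite IHl; auto.
Qed.

Lemma after_app c l r : ~ In c l -> after c (l ++ c :: r) = r.
Proof.
  induction l; simpl; intros H.
  - rewrite Nat.eqb_refl. auto.
  - destruct (Nat.eqb_spec a c); [tauto|]. rewrite IHl; auto.
Qed.

Definition unary (n : nat) : str := repeat 2 n.
Definition enc_bool (b : bool) : str := if b then [2] else [].

Lemma FP_if {X} (D : X -> Prop) es (t : X -> bool) f : FP D es (fun x => enc_bool (t x)) ->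
  FP (fun x => D x /\ t x = true) es f -> FP (fun x => D x /\ t x = false) es f -> FP D es f.
Proof.
  intros Ht H1 H2. apply (FP_case B HB _ _ _ _ Ht).
  - apply (FP_ext _ _ _ _ _ _ H2); auto. intros x [Hx E]. split; auto.
    revert E. destruct (t x); [discriminate|auto].
  - intros s Hs. apply (FP_lift _ _ _ _ _ H1).
    + intros y [Hy E]. split; auto. destruct (t (fst y)); [auto|discriminate E].
    + intros a Ha. simpl; auto.
Qed.

Lemma FP_repeat {X} (D : X -> Prop) es f g : FP D es f -> FP D es g ->
  FP D es (fun x => concat (repeat (g x) (length (f x)))).
Proof.
  intros Hf Hg. apply (FP_fun2 _ _ (fun b a => concat (repeat b (length a))) g f); auto.
  apply FP2_rec with (h := fun _ p _ r => p ++ r).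
  - apply FP_nil.
  - reflexivity.
  - intros s Hs. apply FP_app; fpvar.
  - exists (fun N => N * N). split; [mpoly_tac|]. intros.
    assert (E : length (concat (repeat p (length l))) = length l * length p).
    { induction l; simpl; auto. rewrite length_app. lia. }
    rewrite E. nia.
Qed.

(** Produces a clock: a string whose length is the prescribed polynomial, along which a machine can
    be simulated by bounded recursion. *)
Lemma FP_long {X} (D : X -> Prop) es f c d : FP D es f ->
  exists g, FP D es g /\ forall x, length (g x) = c * (S (length (f x))) ^ d.
Proof.
  intros Hf.
  assert (H : exists g, FP D es g /\ forall x, length (g x) = (S (length (f x))) ^ d).
  { induction d as [|d [g [Hg E]]].
    - exists (fun _ => [2]). split; [apply FP_const; repeat constructor; lia|auto].
    - exists (fun x => concat (repeat (g x) (length (2 :: f x)))). split.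
      + apply FP_repeat; auto. apply FP_cons; auto. unfold symbol; lia.
      + intros x. rewrite length_concat_repeat, E. simpl. auto. }
  destruct H as [g [Hg E]].
  exists (fun x => concat (repeat (g x) (length (unary c)))). split.
  - apply FP_repeat; auto. apply FP_const. apply Forall_forall. intros s Hs.
    apply repeat_spec in Hs. subst. unfold symbol; lia.
  - intros x. rewrite length_concat_repeat, E. unfold unary. rewrite repeat_length. auto.
Qed.

Fixpoint succS (l : str) : str :=
  match l with [] => [2] | s :: l' => if Nat.eqb s 1 then 2 :: l' else 1 :: succS l' end.

(** Twice the number minus one, needed where doubling crosses zero in the sign-magnitude code. The
    inner match avoids a leading zero bit. *)
Fixpoint pdS (l : str) : str :=
  match l with
  | [] => []
  | s :: l' => if Nat.eqb s 1 then 2 :: pdS l' else match l' with [] => [2] | _ => 2 :: 1 :: l' end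
  end.

Lemma vs1 : vsym 1. Proof. unfold symbol; lia. Qed.
Lemma vs2 : vsym 2. Proof. unfold symbol; lia. Qed.
Lemma vs3 : vsym 3. Proof. unfold symbol; lia. Qed.
Lemma vs4 : vsym 4. Proof. unfold symbol; lia. Qed.
Hint Resolve vs1 vs2 vs3 vs4 : core.

Lemma FP1_const c : Forall vsym c -> FP1 (fun _ => c).
Proof. apply FP_const. Qed.
Hint Resolve FP1_const FP1_cons FP1_id : core.

Lemma FP1_ifnil (c : str) F : Forall vsym c -> FP1 F -> FP1 (fun l => match l with [] => c | _ => F l end).
Proof.
  intros Hc HF. apply (FP_case B HB _ _ (fun l => l)); [apply FP1_id| |].
  - apply (FP_ext _ (fun _ => True) _ _ (fun _ => c)); [apply FP_const; auto|auto|].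
    intros x [_ ->]. auto.
  - intros s Hv. apply (FP_ext _ (fun _ => True) _ _ (fun y => F (fst y))); auto.
    + apply (FP_lift _ _ _ _ _ HF); auto. intros a Ha. simpl; auto.
    + intros y [_ E]. rewrite E. auto.
Qed.

Lemma FP1_comp F G : FP1 F -> FP1 G -> FP1 (fun l => F (G l)).
Proof. intros. apply FP_fun1; auto. Qed.

Lemma FP2_fst F : FP1 F -> FP2 (fun l _ => F l).
Proof. intros. apply FP_fun1; auto. fpvar. Qed.
Lemma FP2_snd F : FP1 F -> FP2 (fun _ l => F l).
Proof. intros. apply FP_fun1; auto. fpvar. Qed.

Lemma FP1_succS : FP1 succS.
Proof.
  apply FP1_rec with (h := fun s l r => if Nat.eqb s 1 then 2 :: l else 1 :: r); simpl; auto.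
  - intros s Hs. destruct (Nat.eqb s 1).
    + apply (FP2_fst (fun l => 2 :: l)); auto.
    + apply (FP2_snd (fun l => 1 :: l)); auto.
  - exists (fun N => S N). split; [mpoly_tac|].
    induction l; simpl; auto. destruct (Nat.eqb a 1); simpl; lia.
Qed.

Lemma FP1_pdS : FP1 pdS.
Proof.
  apply FP1_rec with (h := fun s l r => if Nat.eqb s 1 then 2 :: r
      else match l with [] => [2] | _ => 2 :: 1 :: l end); simpl; auto.
  - intros s Hs. destruct (Nat.eqb s 1).
    + apply (FP2_snd (fun l => 2 :: l)); auto.
    + apply (FP2_fst (fun l => match l with [] => [2] | _ => 2 :: 1 :: l end)); auto.
      apply (FP1_ifnil [2] (fun l => 2 :: 1 :: l)); auto.
  - exists (fun N => S N). split; [mpoly_tac|].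
    induction l; simpl; auto. destruct (Nat.eqb a 1); simpl; [lia|]. destruct l; simpl in *; lia.
Qed.

Lemma succS_encP p : succS (encP p) = encP (Pos.succ p).
Proof. induction p; simpl; auto. rewrite IHp. auto. Qed.

Lemma pdS_encP p : pdS (encP p) = encP (Pos.pred_double p).
Proof.
  induction p; simpl; auto; [|rewrite IHp; auto].
  destruct (encP p) eqn:E; auto. apply encP_nonnil in E. tauto.
Qed.

(* Branches on the sign of an [encZ] code: [1] alone is zero and 4 is the minus sign. *)
Definition caseZ (c : str) (neg pos : str -> str) (l : str) : str :=
  match l with
  | [] => pos l
  | s :: m => if Nat.eqb s 4 then neg m
              else if Nat.eqb s 1 then match m with [] => c | _ => pos l end else pos l
  end.

Lemma FP1_caseZ c neg pos : Forall vsym c -> FP1 neg -> FP1 pos -> Forall vsym (pos []) ->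
  FP1 (caseZ c neg pos).
Proof.
  intros Hc Hn Hp Hp0. apply FP1_match; auto. intros s Hs. simpl. destruct (Nat.eqb s 4); auto.
  assert (H : FP1 (fun l => pos (s :: l))) by (apply FP1_comp; auto).
  destruct (Nat.eqb s 1); auto.
  apply (FP1_ifnil c (fun l => pos (s :: l))); auto.
Qed.

Lemma caseZ_neg c neg pos p : caseZ c neg pos (encZ (Zneg p)) = neg (encP p).
Proof. reflexivity. Qed.
Lemma caseZ_pos c neg pos p : caseZ c neg pos (encZ (Zpos p)) = pos (encP p).
Proof.
  destruct p; simpl; auto. destruct (encP p) eqn:E; auto. apply encP_nonnil in E. tauto.
Qed.

(** On codes of integers these act as -z, 2z, 2z + 1, 2z - 1 and z + 1, always returning the
    canonical code. *)
Definition oppS := caseZ [1] (fun m => m) (fun l => 4 :: l).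
Definition dblS := caseZ [1] (fun m => 4 :: 1 :: m) (fun l => 1 :: l).
Definition sdS := caseZ [2] (fun m => 4 :: pdS m) (fun l => 2 :: l).
Definition pdZS := caseZ [4; 2] (fun m => 4 :: 2 :: m) pdS.
Definition succZS := caseZ [2]
  (fun l => match l with
     | [] => []
     | s :: m => if Nat.eqb s 1 then 4 :: pdS m else match m with [] => [1] | _ => 4 :: 1 :: m end
     end) succS.

Lemma FP1_oppS : FP1 oppS.
Proof. apply FP1_caseZ; auto. Qed.
Lemma FP1_dblS : FP1 dblS.
Proof. apply FP1_caseZ; auto. Qed.
Lemma FP1_sdS : FP1 sdS.
Proof. apply FP1_caseZ; auto. apply FP1_cons; auto. apply FP1_pdS. Qed.
Lemma FP1_pdZS : FP1 pdZS.
Proof. apply FP1_caseZ; auto. apply FP1_pdS. Qed.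
Lemma FP1_succZS : FP1 succZS.
Proof.
  apply FP1_caseZ; auto; [|apply FP1_succS|simpl; auto].
  apply FP1_match; auto. intros s Hs. destruct (Nat.eqb s 1).
  - apply FP1_cons; auto. apply FP1_pdS.
  - apply (FP1_ifnil [1] (fun l => 4 :: 1 :: l)); auto.
Qed.

Lemma oppS_encZ z : oppS (encZ z) = encZ (- z).
Proof. unfold oppS. destruct z; [reflexivity|rewrite caseZ_pos; reflexivity|reflexivity]. Qed.
Lemma dblS_encZ z : dblS (encZ z) = encZ (2 * z).
Proof. unfold dblS. destruct z; [reflexivity|rewrite caseZ_pos; reflexivity|reflexivity]. Qed.
Lemma sdS_encZ z : sdS (encZ z) = encZ (2 * z + 1).
Proof.
  unfold sdS. destruct z; [reflexivity|rewrite caseZ_pos; reflexivity|].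
  rewrite caseZ_neg, pdS_encP. reflexivity.
Qed.
Lemma pdZS_encZ z : pdZS (encZ z) = encZ (2 * z - 1).
Proof.
  unfold pdZS. destruct z; [reflexivity|rewrite caseZ_pos, pdS_encP; reflexivity|].
  reflexivity.
Qed.
Lemma succZS_encZ z : succZS (encZ z) = encZ (z + 1).
Proof.
  unfold succZS. destruct z; [reflexivity|rewrite caseZ_pos, succS_encP, <- Pos.add_1_r; reflexivity|].
  rewrite caseZ_neg. destruct p; simpl; auto.
  - destruct (encP p) eqn:E; auto. apply encP_nonnil in E. tauto.
  - rewrite pdS_encP. auto.
Qed.

(** The step from z to d + 2z for the digits -2, ..., 2 that arise when two signed bits are added;
    the predecessor needed for -2 is -(-z + 1). *)
Definition digS (d : Z) (l : str) : str :=
  match d with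
  | 0%Z => dblS l
  | 1%Z => sdS l
  | 2%Z => succZS (sdS l)
  | (-1)%Z => pdZS l
  | (-2)%Z => oppS (succZS (oppS (pdZS l)))
  | _ => []
  end.

Lemma FP1_digS d : FP1 (digS d).
Proof.
  pose proof FP1_dblS. pose proof FP1_sdS. pose proof FP1_pdZS. pose proof FP1_oppS.
  pose proof FP1_succZS.
  destruct d as [|[p|[p|p|]|]|[p|[p|p|]|]]; try (apply FP1_const; constructor); auto.
  - exact (FP1_comp _ _ H3 H0).
  - exact (FP1_comp _ _ H2 (FP1_comp _ _ H3 (FP1_comp _ _ H2 H1))).
Qed.

Lemma digS_encZ d z : (-2 <= d <= 2)%Z -> digS d (encZ z) = encZ (d + 2 * z).
Proof.
  intros Hd. assert (d = -2 \/ d = -1 \/ d = 0 \/ d = 1 \/ d = 2)%Z as [->|[->|[->|[->| ->]]]] by lia;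
  unfold digS; rewrite ?pdZS_encZ, ?oppS_encZ, ?sdS_encZ, ?succZS_encZ, ?oppS_encZ, ?dblS_encZ; f_equal; lia.
Qed.

Definition sg (e : bool) (z : Z) : Z := if e then z else (- z)%Z.

(** Recursion on notation starts at the end of the string, that is, at the most significant bits. If
    z is the signed sum of the two suffixes, the next bits turn it into d + 2z; there is no carry,
    and subtraction needs neither comparison nor normalization. *)
Lemma FP2_addbits e1 e2 : FP2 (fun x y => encZ (sg e1 (bval x) + sg e2 (bval y))).
Proof.
  (* The recursion follows a single string, so x is extended by zero bits to be at least as long as
     y; the matching suffix of y is found by its distance from the start. *)
  set (pad := fun p : str * str => fst p ++ map (fun _ => 1) (snd p)).
  assert (Hpad : FP (fun _ => True) [fst; snd] pad).
  { apply FP_app; [fpvar|]. apply FP_map; auto. fpvar. }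
  apply (FP_cut B HB _ _ _ _ Hpad).
  assert (Hbpad : forall p, bval (pad p) = bval (fst p)).
  { intros [x y]. unfold pad. simpl. induction x; cbn [bval app]; [|rewrite IHx; auto].
    induction y; cbn [map bval]; [auto|]. rewrite IHy. reflexivity. }
  set (R := fun p l => encZ (sg e1 (bval l) +
      sg e2 (bval (skipn (length (pad p) - length l) (snd p))))).
  apply (FP_ext _ (fun _ => True) _ _ (fun p => R p (pad p))); auto.
  2:{ intros p _. unfold R. rewrite Hbpad, Nat.sub_diag. reflexivity. }
  apply FP_rec; auto; [simpl; auto| | |].
  - apply (FP_ext _ (fun _ => True) _ _ (fun _ => [1])); auto; [apply FP_const; auto|].
    intros p _. unfold R. simpl length. rewrite Nat.sub_0_r, skipn_all2.
    + destruct e1, e2; reflexivity.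
    + unfold pad. rewrite length_app, length_map. lia.
  - intros s Hs.
    set (es := snd :: (fun y => R (fst y) (snd y)) :: map lift [pad; fst; snd]).
    set (D := fun y => True /\ exists pre, pad (fst y) = pre ++ s :: snd y).
    (* The part of the second operand that starts at the current position; the number of skipped
       positions is itself obtained as the length of a string. *)
    set (u := fun y : str * str * str => skipn (length (skipn (length (s :: snd y)) (pad (fst y)))) (snd (fst y))).
    assert (Hu : FP D es u).
    { apply FP_skipn; [apply FP_skipn|].
      - apply FP_cons; auto. fpvar.
      - fpvar.
      - fpvar. }
    assert (Hu1 : forall y, u y = skipn (length (pad (fst y)) - length (s :: snd y)) (snd (fst y))).
    { intros y. unfold u. rewrite length_skipn. auto. }
    assert (Hu2 : forall y, D y -> skipn (length (pad (fst y)) - length (snd y)) (snd (fst y)) = tl (u y)).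
    { intros y [_ [pre E]]. rewrite Hu1, <- skipn_tl. f_equal. rewrite E, length_app. simpl. lia. }
    assert (HR : forall y, D y -> R (fst y) (s :: snd y) =
       encZ ((sg e1 (bit s) + sg e2 (match u y with [] => 0 | v :: _ => bit v end)) +
             2 * (sg e1 (bval (snd y)) + sg e2 (bval (skipn (length (pad (fst y)) - length (snd y)) (snd (fst y))))))).
    { intros y Hy. unfold R. rewrite Hu2 by auto. rewrite <- Hu1. f_equal. cbn [bval].
      destruct (u y); cbn [bval tl]; destruct e1, e2; unfold sg; lia. }
    assert (Hbr : forall v : nat, (-2 <= sg e1 (bit s) + sg e2 (bit v) <= 2)%Z).
    { intros v. pose proof (bit_range s). pose proof (bit_range v). destruct e1, e2; unfold sg; lia. }
    apply (FP_case B HB _ _ _ _ Hu).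
    + apply (FP_ext _ (fun _ => True) _ _ (fun y => digS (sg e1 (bit s)) (R (fst y) (snd y)))); auto.
      * apply (FP_fun1 _ _ (digS (sg e1 (bit s)))); [apply FP1_digS|]. fpvar.
      * intros y [Hy E]. rewrite HR by auto. rewrite E. unfold R. rewrite digS_encZ.
        -- f_equal. destruct e2; unfold sg; lia.
        -- specialize (Hbr 1). unfold sg, bit in *. destruct e1, e2, (Nat.eqb s 2); simpl in *; lia.
    + intros v Hvs.
      apply (FP_ext _ (fun _ => True) _ _ (fun y => digS (sg e1 (bit s) + sg e2 (bit v)) (R (fst (fst y)) (snd (fst y))))); auto.
      * apply (FP_fun1 _ _ (digS (sg e1 (bit s) + sg e2 (bit v)))); [apply FP1_digS|].
        fpvar.
      * intros y [Hy E]. rewrite HR by auto. rewrite E. unfold R. rewrite digS_encZ; auto.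
  - exists (fun N => S (N + N)). split; [mpoly_tac|]. intros x N pre l' _ HN E.
    pose proof (Forall_inv HN) as H1. pose proof (Forall_inv (Forall_inv_tail HN)) as H3.
    pose proof (Forall_inv (Forall_inv_tail (Forall_inv_tail HN))) as H5. cbv beta in *.
    unfold R. set (k := skipn _ _). apply encZ_length.
    assert (length k <= N) by (unfold k; rewrite length_skipn; lia).
    assert (length l' <= N) by (rewrite E, length_app in H1; lia).
    pose proof (bval_range l') as R1. pose proof (bval_range k) as R2.
    assert (2 ^ Z.of_nat (length l') <= 2 ^ Z.of_nat N)%Z by (apply Z.pow_le_mono_r; lia).
    assert (2 ^ Z.of_nat (length k) <= 2 ^ Z.of_nat N)%Z by (apply Z.pow_le_mono_r; lia).
    destruct N as [|N].
    + simpl in *. assert (bval l' = 0%Z) by lia. assert (bval k = 0%Z) by lia.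
      destruct e1, e2; unfold sg; lia.
    + assert (2 ^ Z.of_nat (S N + S N) = 2 ^ Z.of_nat (S N) * 2 ^ Z.of_nat (S N))%Z
        by (rewrite Nat2Z.inj_add, Z.pow_add_r; lia).
      assert (2 <= 2 ^ Z.of_nat (S N))%Z.
      { change 2%Z with (2 ^ 1)%Z at 1. apply Z.pow_le_mono_r; lia. }
      destruct e1, e2; unfold sg; nia.
Qed.

(** The first symbol of each code reveals its sign, and the four sign combinations are instances of
    [FP2_addbits]. *)
Lemma FP_addZ {X} (D : X -> Prop) es a b : FP D es (fun x => encZ (a x)) ->
  FP D es (fun x => encZ (b x)) -> FP D es (fun x => encZ (a x + b x)).
Proof.
  intros Ha Hb.
  apply (FP_comp B HB (fun _ => True) D [fun p => encZ (fst p); fun p => encZ (snd p)] es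
    (fun p : Z * Z => encZ (fst p + snd p)) (fun x => (a x, b x))); auto.
  clear - HB. apply (FP_case B HB _ _ (fun p => encZ (fst p))); [fpvar| |].
  { apply (FP_ext _ (fun _ => False) _ _ (fun y => [])); [apply FP_nil| |];
      intros y [_ E]; apply encZ_nonnil in E; tauto. }
  intros s Hs. apply (FP_case B HB _ _ (fun p => encZ (snd (fst p)))); [fpvar| |].
  { apply (FP_ext _ (fun _ => False) _ _ (fun y => [])); [apply FP_nil| |];
      intros y [_ E]; apply encZ_nonnil in E; tauto. }
  intros t Ht.
  apply (FP_ext _ (fun _ => True) _ _ (fun y =>
    encZ (sg (negb (Nat.eqb s 4)) (bval (if Nat.eqb s 4 then snd (fst y) else encZ (fst (fst (fst y))))) +
          sg (negb (Nat.eqb t 4)) (bval (if Nat.eqb t 4 then snd y else encZ (snd (fst (fst y)))))))); auto.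
  - apply (FP_fun2 _ _ _ (fun y : Z * Z * str * str => if Nat.eqb s 4 then snd (fst y) else encZ (fst (fst (fst y))))
      (fun y => if Nat.eqb t 4 then snd y else encZ (snd (fst (fst y)))) (FP2_addbits (negb (Nat.eqb s 4)) (negb (Nat.eqb t 4)))).
    + destruct (Nat.eqb s 4); fpvar.
    + destruct (Nat.eqb t 4); fpvar.
  - intros y [[_ E1] E2]. apply encZ_sign in E1. apply encZ_sign in E2. f_equal. f_equal.
    + destruct (Nat.eqb_spec s 4); unfold sg; simpl; destruct E1 as [[? E1]|[? E1]]; congruence.
    + destruct (Nat.eqb_spec t 4); unfold sg; simpl; destruct E2 as [[? E2]|[? E2]]; congruence.
Qed.

Lemma FP_oppZ {X} (D : X -> Prop) es a : FP D es (fun x => encZ (a x)) ->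
  FP D es (fun x => encZ (- a x)).
Proof.
  intros Ha. apply (FP_ext _ D _ _ (fun x => oppS (encZ (a x)))); auto.
  - apply (FP_fun1 _ _ oppS); auto. apply FP1_oppS.
  - intros. apply oppS_encZ.
Qed.

Definition isz (l : str) : str := caseZ [2] (fun _ => []) (fun _ => []) l.

Lemma FP_eqZ {X} (D : X -> Prop) es a b : FP D es (fun x => encZ (a x)) ->
  FP D es (fun x => encZ (b x)) -> FP D es (fun x => enc_bool (Z.eqb (a x) (b x))).
Proof.
  intros Ha Hb. apply (FP_ext _ D _ _ (fun x => isz (encZ (a x + - b x)))); auto.
  - apply (FP_fun1 _ _ isz).
    + apply FP1_caseZ; auto; apply FP1_const; constructor.
    + apply FP_addZ; auto. apply FP_oppZ; auto.
  - intros x _. unfold isz. destruct (Z.eqb_spec (a x) (b x)) as [E|E].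
    + rewrite E, Z.add_opp_diag_r. reflexivity.
    + destruct (a x + - b x)%Z eqn:E'; [lia|rewrite caseZ_pos; auto|reflexivity].
Qed.

(** Horner's scheme from the most significant bit: double the partial product and add z if the bit
    is set. *)
Lemma FP_mulbits {X} (D : X -> Prop) es z p : FP D es (fun x => encZ (z x)) -> FP D es p ->
  FP D es (fun x => encZ (z x * bval (p x))).
Proof.
  intros Hz Hp.
  apply (FP_comp B HB (fun _ => True) D [fun p => encZ (fst p); snd] es
    (fun p : Z * str => encZ (fst p * bval (snd p))) (fun x => (z x, p x))); auto.
  clear - HB. apply (FP_rec B HB _ _ snd (fun x l => encZ (fst x * bval l))).
  - simpl; auto.
  - apply (FP_ext _ (fun _ => True) _ _ (fun _ => [1])); auto; [apply FP_const; auto|].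
    intros x _. cbn [bval]. rewrite Z.mul_0_r. reflexivity.
  - intros s Hs.
    set (es := snd :: _).
    assert (H1 : FP (fun _ : Z * str * str => True) es (fun y => encZ (2 * (fst (fst y) * bval (snd y))))).
    { apply (FP_ext _ (fun _ => True) _ _ (fun y => dblS (encZ (fst (fst y) * bval (snd y))))); auto.
      - apply (FP_fun1 _ _ dblS); [apply FP1_dblS|]. fpvar.
      - intros. apply dblS_encZ. }
    assert (H2 : FP (fun _ : Z * str * str => True) es (fun y => encZ (fst (fst y) + 2 * (fst (fst y) * bval (snd y))))).
    { apply FP_addZ; auto. fpvar. }
    destruct (Nat.eq_dec s 2) as [->|Hn].
    + apply (FP_ext _ _ _ _ _ _ H2); auto. intros y _. cbn [bval]. f_equal. change (bit 2) with 1%Z. ring.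
    + apply (FP_ext _ _ _ _ _ _ H1); auto. intros y _. cbn [bval]. f_equal. unfold bit.
      destruct (Nat.eqb_spec s 2); [tauto|]. ring.
  - exists (fun N => S (N + N)). split; [mpoly_tac|]. intros x N pre l' _ HN E.
    pose proof (Forall_inv HN) as H1. pose proof (Forall_inv (Forall_inv_tail HN)) as H3.
    cbv beta in *.
    apply encZ_length. pose proof (encZ_bound (fst x)) as R1. pose proof (bval_range l') as R2.
    assert (length l' <= N) by (rewrite E, length_app in H3; lia).
    assert (2 ^ Z.of_nat (length l') <= 2 ^ Z.of_nat N)%Z by (apply Z.pow_le_mono_r; lia).
    assert (2 ^ Z.of_nat (length (encZ (fst x))) <= 2 ^ Z.of_nat N)%Z by (apply Z.pow_le_mono_r; lia).
    rewrite Nat2Z.inj_add, Z.pow_add_r by lia. rewrite Z.abs_mul, (Z.abs_eq (bval l')) by lia. nia.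
Qed.

Lemma FP_mulP {X} (D : X -> Prop) es z p : FP D es (fun x => encZ (z x)) ->
  FP D es (fun x => encP (p x)) -> FP D es (fun x => encZ (z x * Zpos (p x))).
Proof.
  intros Hz Hp. apply (FP_ext _ _ _ _ _ _ (FP_mulbits _ _ _ _ Hz Hp)); auto.
  intros. rewrite bval_encP. auto.
Qed.

(** The counts of minimal supports are produced in unary; repeated addition multiplies by them
    without a conversion to binary. *)
Lemma FP_mulunary {X} (D : X -> Prop) es z u : FP D es (fun x => encZ (z x)) -> FP D es u ->
  FP D es (fun x => encZ (Z.of_nat (length (u x)) * z x)).
Proof.
  intros Hz Hp.
  apply (FP_comp B HB (fun _ => True) D [fun p => encZ (fst p); snd] es
    (fun p : Z * str => encZ (Z.of_nat (length (snd p)) * fst p)) (fun x => (z x, u x))); auto.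
  clear - HB. apply (FP_rec B HB _ _ snd (fun x l => encZ (Z.of_nat (length l) * fst x))).
  - simpl; auto.
  - apply (FP_ext _ (fun _ => True) _ _ (fun _ => [1])); auto; apply FP_const; auto.
  - intros s Hs.
    apply (FP_ext _ (fun _ => True) _ _ (fun y => encZ (fst (fst y) + Z.of_nat (length (snd y)) * fst (fst y)))); auto.
    + apply FP_addZ; fpvar.
    + intros. f_equal. simpl length. lia.
  - exists (fun N => S (N + N)). split; [mpoly_tac|]. intros x N pre l' _ HN E.
    pose proof (Forall_inv HN) as H1. pose proof (Forall_inv (Forall_inv_tail HN)) as H3.
    cbv beta in *.
    apply encZ_length. pose proof (encZ_bound (fst x)) as R1.
    assert (length l' <= N) by (rewrite E, length_app in H3; lia).
    assert (Z.of_nat (length l') < 2 ^ Z.of_nat N)%Z by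
      (pose proof (Z.pow_gt_lin_r 2 (Z.of_nat N)); lia).
    assert (2 ^ Z.of_nat (length (encZ (fst x))) <= 2 ^ Z.of_nat N)%Z by (apply Z.pow_le_mono_r; lia).
    rewrite Nat2Z.inj_add, Z.pow_add_r by lia. rewrite Z.abs_mul, (Z.abs_eq (Z.of_nat _)) by lia. nia.
Qed.

End Strings.

(** * Simulation of Turing machines *)

Section Simulation.
Variables (B : nat) (M : TM).
Hypothesis HB : 8 <= B.
Hypothesis HM : nsyms M + nstates M + 1 < B.
Notation vsym := (symbol B).
Notation FP := (FP B).

(** Larger than every shifted state and tape symbol, so the left part of the tape can be cut off at
    its first occurrence. *)
Definition sep := B - 1.

Lemma vsep : vsym sep.
Proof. unfold vsym, sep. lia. Qed.

(* Tape symbols and states are shifted by one, as stacks cannot hold the symbol 0. *)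
Definition encC (c : config) : str :=
  S (cstate c) :: map S (cleft c) ++ sep :: S (chead c) :: map S (cright c).

Definition okC (c : config) : Prop :=
  cstate c < nstates M /\ chead c < nsyms M /\
  Forall (fun s => s < nsyms M) (cleft c) /\ Forall (fun s => s < nsyms M) (cright c).

Lemma sep_notin l : Forall (fun s => s < nsyms M) l -> ~ In sep (map S l).
Proof.
  intros H Hin. apply in_map_iff in Hin. destruct Hin as [s [E Hs]].
  rewrite Forall_forall in H. apply H in Hs. unfold sep in E. lia.
Qed.

Lemma step_ok c : okC c -> okC (step M c).
Proof.
  intros [Hq [Hh [Hl Hr]]]. unfold step.
  destruct (Nat.eqb (cstate c) (qhalt M)); [repeat split; auto|].
  destruct (tm_delta_ok M _ _ Hq Hh) as [H1 H2]. pose proof (tm_syms_ok M).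
  destruct (delta M (cstate c) (chead c)) as [[q' s'] m]. simpl in H1, H2.
  destruct m.
  - destruct (cleft c) eqn:E; repeat split; simpl; auto; try lia; inversion Hl; auto.
  - destruct (cright c) eqn:E; repeat split; simpl; auto; try lia; inversion Hr; auto.
  - repeat split; simpl; auto.
Qed.

Lemma run_S n c : run M (S n) c = step M (run M n c).
Proof. revert c. induction n; intros c; [reflexivity|]. exact (IHn (step M c)). Qed.

Lemma run_ok n c : okC c -> okC (run M n c).
Proof. intros H. induction n; [exact H|]. rewrite run_S. apply step_ok; auto. Qed.

Lemma step_length c : length (encC (step M c)) <= S (length (encC c)).
Proof.
  unfold encC, step. destruct (Nat.eqb (cstate c) (qhalt M)); [lia|].
  destruct (delta M (cstate c) (chead c)) as [[q' s'] m].
  destruct m; [destruct (cleft c)|destruct (cright c)|]; simpl;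
    repeat (rewrite ?length_app, ?length_map; simpl); lia.
Qed.

Lemma run_length n c : length (encC (run M n c)) <= n + length (encC c).
Proof. induction n; [auto|]. rewrite run_S. pose proof (step_length (run M n c)). lia. Qed.

Lemma FP_false {X} (D : X -> Prop) es f : (forall x, ~ D x) -> FP D es f.
Proof.
  intros H. apply (FP_ext _ (fun _ => False) _ _ (fun _ => [])); [apply FP_nil|exact H|].
  intros x Hx. destruct (H x Hx).
Qed.

(** State and scanned symbol range over finite sets, so [delta] is tabulated by two case
    distinctions; branches that no valid configuration reaches have an empty domain. *)
Lemma FP_step : FP okC [encC] (fun c => encC (step M c)).
Proof.
  apply (FP_case B HB _ _ encC); [fpvar|apply FP_false; intros x [_ E]; discriminate E|].
  intros s1 Hs1.
  destruct (Nat.lt_ge_cases (s1 - 1) (nstates M)) as [Hq|Hq].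
  2:{ apply FP_false. intros y [[Hq' _] E]. inversion E. lia. }
  set (D1 := fun y : config * str => okC (fst y) /\ encC (fst y) = s1 :: snd y).
  apply (FP_cut B HB _ _ _ (fun y => upto sep (snd y))); [apply FP_upto; auto; fpvar|].
  apply (FP_cut B HB _ _ _ (fun y => after sep (snd y))); [apply FP_after; auto; fpvar|].
  apply (FP_case B HB _ _ (fun y => after sep (snd y))); [fpvar| |].
  { apply FP_false. intros y [[[_ [_ [Hl _]]] E] E']. unfold encC in E. inversion E as [[H1 H2]].
    rewrite <- H2, after_app in E' by (apply sep_notin; auto). discriminate. }
  intros s2 Hs2.
  destruct (Nat.lt_ge_cases (s2 - 1) (nsyms M)) as [Hh|Hh].
  2:{ apply FP_false. intros y [[[_ [Hh' [Hl _]]] E] E']. unfold encC in E. inversion E as [[H1 H2]].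
    rewrite <- H2, after_app in E' by (apply sep_notin; auto). inversion E'. lia. }
  set (D2 := fun y : config * str * str => D1 (fst y) /\ after sep (snd (fst y)) = s2 :: snd y).
  assert (HD2 : forall y, D2 y -> cstate (fst (fst y)) = s1 - 1 /\ chead (fst (fst y)) = s2 - 1 /\
     upto sep (snd (fst y)) = map S (cleft (fst (fst y))) /\ snd y = map S (cright (fst (fst y)))).
  { intros y [[[_ [_ [Hl _]]] E] E']. unfold encC in E. inversion E as [[H1 H2]].
    rewrite <- H2 in E'. rewrite after_app in E' by (apply sep_notin; auto).
    rewrite upto_app by (apply sep_notin; auto). inversion E'.
    repeat split; auto; lia. }
  match goal with |- FP _ ?e _ => set (es := e) end.
  assert (HL : FP D2 es (fun y => upto sep (snd (fst y)))) by (unfold es; fpvar).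
  assert (HR : FP D2 es snd) by (unfold es; fpvar).
  assert (HE : FP D2 es (fun y => encC (fst (fst y)))) by (unfold es; fpvar).
  destruct (Nat.eqb_spec (s1 - 1) (qhalt M)) as [Ehalt|Ehalt].
  { apply (FP_ext _ _ D2 _ _ _ HE); auto. intros y Hy. destruct (HD2 y Hy) as [E1 _].
    unfold step. rewrite E1. rewrite <- Ehalt, Nat.eqb_refl. reflexivity. }
  destruct (tm_delta_ok M _ _ Hq Hh) as [H1 H2]. pose proof (tm_syms_ok M) as H8.
  assert (Hstep : forall y, D2 y -> step M (fst (fst y)) =
    match delta M (s1 - 1) (s2 - 1) with
    | (q', s', m) => match m with
       | MStay => Build_config q' (cleft (fst (fst y))) s' (cright (fst (fst y)))
       | MLeft => Build_config q' (tl (cleft (fst (fst y)))) (hd 0 (cleft (fst (fst y)))) (s' :: cright (fst (fst y)))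
       | MRight => Build_config q' (s' :: cleft (fst (fst y))) (hd 0 (cright (fst (fst y)))) (tl (cright (fst (fst y))))
       end end).
  { intros y Hy. destruct (HD2 y Hy) as [E1 [E2 _]]. unfold step. rewrite E1, E2.
    destruct (Nat.eqb_spec (s1 - 1) (qhalt M)); [tauto|].
    destruct (delta M (s1 - 1) (s2 - 1)) as [[q' s'] []]; auto;
      [destruct (cleft (fst (fst y)))|destruct (cright (fst (fst y)))]; auto. }
  destruct (delta M (s1 - 1) (s2 - 1)) as [[q' s'] m]. cbn [fst snd] in H1, H2.
  assert (Vq : vsym (S q')) by (unfold symbol; lia).
  assert (Vs : vsym (S s')) by (unfold symbol; lia).
  assert (V1 : vsym 1) by (unfold symbol; lia).
  destruct m.
  - apply (FP_ext _ D2 D2 _ (fun y => S q' :: tl (upto sep (snd (fst y))) ++ sep ::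
       match upto sep (snd (fst y)) with [] => [1] | x :: _ => [x] end ++ S s' :: snd y)); auto.
    + apply FP_cons; auto. apply FP_app; auto; [apply FP_tl; auto|]. apply FP_cons; [apply vsep|].
      apply FP_app; auto; [|apply FP_cons; auto].
      apply (FP_fun1 B HB _ _ (fun l => match l with [] => [1] | x :: _ => [x] end)); auto.
      apply FP1_match; auto. intros s Hs. apply FP_const. auto.
    + intros y Hy. rewrite Hstep by auto. destruct (HD2 y Hy) as [_ [_ [E3 E4]]].
      rewrite E3, E4. unfold encC. simpl. destruct (cleft (fst (fst y))); reflexivity.
  - apply (FP_ext _ D2 D2 _ (fun y => S q' :: S s' :: upto sep (snd (fst y)) ++ sep ::
       match snd y with [] => [1] | _ => snd y end)); auto.
    + apply FP_cons; auto. apply FP_cons; auto. apply FP_app; auto. apply FP_cons; [apply vsep|].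
      apply (FP_fun1 B HB _ _ (fun l => match l with [] => [1] | _ => l end)); auto.
      apply (FP1_ifnil B HB [1] (fun l => l)); auto. apply FP1_id.
    + intros y Hy. rewrite Hstep by auto. destruct (HD2 y Hy) as [_ [_ [E3 E4]]].
      rewrite E3, E4. unfold encC. simpl. destruct (cright (fst (fst y))); reflexivity.
  - apply (FP_ext _ D2 D2 _ (fun y => S q' :: upto sep (snd (fst y)) ++ sep :: S s' :: snd y)); auto.
    + apply FP_cons; auto. apply FP_app; auto. apply FP_cons; [apply vsep|]. apply FP_cons; auto.
    + intros y Hy. rewrite Hstep by auto. destruct (HD2 y Hy) as [_ [_ [E3 E4]]].
      rewrite E3, E4. reflexivity.
Qed.

(** Bounded recursion along the clock u; the length premise holds because a step lengthens the
    configuration by at most one symbol. *)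
Lemma FP_run {X} (D : X -> Prop) es (c : X -> config) u :
  (forall x, D x -> okC (c x)) -> FP D es (fun x => encC (c x)) -> FP D es u ->
  FP D es (fun x => encC (run M (length (u x)) (c x))).
Proof.
  intros Hok Hc Hu.
  apply (FP_comp B HB (fun p => okC (fst p)) D [fun p => encC (fst p); snd] es
    (fun p : config * str => encC (run M (length (snd p)) (fst p))) (fun x => (c x, u x))); auto.
  clear - HB HM. apply (FP_rec B HB _ _ snd (fun x l => encC (run M (length l) (fst x)))).
  - find_in.
  - fpvar.
  - intros s Hs.
    apply (FP_ext _ (fun y => okC (fst (fst y))) _ _
       (fun y => encC (step M (run M (length (snd y)) (fst (fst y)))))).
    + apply (FP_comp B HB okC _ [encC] _ (fun c => encC (step M c))
         (fun y : config * str * str => run M (length (snd y)) (fst (fst y))) FP_step).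
      * intros y Hy. apply run_ok; auto.
      * repeat constructor. fpvar.
    + intros y [Hy _]. exact Hy.
    + intros y _. simpl length. rewrite run_S. reflexivity.
  - exists (fun N => N + N). split; [mpoly_tac|]. intros x N pre l' _ HN E.
    pose proof (Forall_inv HN) as H1. pose proof (Forall_inv (Forall_inv_tail HN)) as H3.
    cbv beta in *. rewrite E, length_app in H3.
    pose proof (run_length (length l') (fst x)). lia.
Qed.

Fixpoint unshift (l : str) : str :=
  match l with [] => [] | s :: l' => if Nat.eqb s 1 then [] else (s - 1) :: unshift l' end.

Lemma unshift_S l : unshift (map S l) = take_nonblank l.
Proof. induction l; simpl; auto. rewrite Nat.sub_0_r, IHl. destruct a; auto. Qed.

Lemma FP_unshift {X} (D : X -> Prop) es f : FP D es f -> FP D es (fun x => unshift (f x)).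
Proof.
  intros Hf. apply FP_fun1; auto.
  apply (FP1_rec B HB unshift (fun s _ r => if Nat.eqb s 1 then [] else (s - 1) :: r)); simpl; auto.
  - intros s Hs. destruct (Nat.eqb_spec s 1); [apply FP_nil|].
    apply FP_cons; [unfold symbol in *; lia|]. fpvar.
  - exists (fun N => N). split; [mpoly_tac|].
    induction l; simpl; auto. destruct (Nat.eqb a 1); simpl; lia.
Qed.

(** A halted configuration is a fixed point of [step], so the simulation may run for the full
    polynomial bound without detecting when M halts. *)
Lemma run_halt n m c : n <= m -> cstate (run M n c) = qhalt M -> run M m c = run M n c.
Proof.
  intros H E. induction H; auto. rewrite run_S, IHle. unfold step. rewrite E, Nat.eqb_refl. auto.
Qed.

Lemma FP_simulate {X} (D : X -> Prop) es inp out c d :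
  FP D es inp ->
  (forall x, D x -> Forall (fun s => 1 <= s < 8) (inp x) /\
     exists t, t <= c * (S (length (inp x))) ^ d /\ halts_within M (inp x) t (out x)) ->
  FP D es out.
Proof.
  intros Hinp Hout. pose proof (tm_syms_ok M) as H8.
  destruct (FP_long B HB D es inp c d Hinp) as [u [Hu Eu]].
  set (c0 := fun x => init_config M (inp x)).
  assert (Hok : forall x, D x -> okC (c0 x)).
  { intros x Hx. destruct (Hout x Hx) as [Hv _]. unfold c0. pose proof (tm_start_ok M).
    destruct (inp x) as [|s l]; repeat split; simpl; auto; try lia; inversion Hv; subst.
    - lia.
    - eapply Forall_impl; [|eassumption]. simpl. lia. }
  assert (Hc0 : FP D es (fun x => encC (c0 x))).
  { apply (FP_ext _ D D _ (fun x => S (qstart M) :: sep ::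
        match map S (inp x) with [] => [1] | _ => map S (inp x) end)); auto.
    2:{ intros x _. unfold c0. destruct (inp x); reflexivity. }
    apply FP_cons; [pose proof (tm_start_ok M); unfold symbol; lia|].
    apply FP_cons; [apply vsep|].
    (* The shift could leave the stack alphabet; it is cut off beyond the input alphabet, where its
       value is irrelevant. *)
    apply (FP_ext _ D D _ (fun x => match map (fun s => if Nat.ltb s 8 then S s else 1) (inp x) with
       [] => [1] | _ => map (fun s => if Nat.ltb s 8 then S s else 1) (inp x) end)); auto.
    - apply (FP_fun1 B HB _ _ (fun l => match l with [] => [1] | _ => l end)).
      + apply (FP1_ifnil B HB [1] (fun l => l)); [|apply FP1_id].
        constructor; auto. unfold symbol; lia.
      + apply FP_map; auto. intros s Hs. unfold symbol in *.
        destruct (Nat.ltb_spec s 8); lia.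
    - intros x Hx. destruct (Hout x Hx) as [Hv _].
      replace (map (fun s => if Nat.ltb s 8 then S s else 1) (inp x)) with (map S (inp x)); auto.
      apply map_ext_in. intros s Hs. rewrite Forall_forall in Hv. apply Hv in Hs.
      destruct (Nat.ltb_spec s 8); lia. }
  apply (FP_ext _ D D _ (fun x => unshift (after sep (encC (run M (length (u x)) (c0 x)))))); auto.
  - apply FP_unshift. apply FP_after; auto. apply FP_run; auto.
  - intros x Hx. destruct (Hout x Hx) as [_ [t [Ht [k [Hk [E1 E2]]]]]].
    assert (E : run M (length (u x)) (c0 x) = run M k (c0 x)).
    { apply run_halt; auto. rewrite Eu. lia. }
    rewrite E. destruct (run_ok k _ (Hok x Hx)) as [Hq [_ [Hl _]]].
    set (C := run M k (c0 x)) in *.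
    change (encC C) with ((S (cstate C) :: map S (cleft C)) ++ sep :: map S (chead C :: cright C)).
    rewrite after_app, unshift_S; [exact E2|].
    intros [E0|E0]; [unfold sep in E0; lia|]. revert E0. apply sep_notin. exact Hl.
Qed.

End Simulation.

(** * Counting sublists of an encoded ABox *)

(** Three integers for either kind of assertion; the impossible name -1 distinguishes concept
    assertions, so that equality of assertions is equality of fields. *)
Definition fields (a : assertion) : list Z :=
  match a with
  | CA A c => [Z.of_nat A; Z.of_nat c; (-1)%Z]
  | RA r b c => [Z.of_nat r; Z.of_nat b; Z.of_nat c]
  end.

Definition fld (i : nat) (a : assertion) : Z := nth i (fields a) 0%Z.

Definition enc (l : list assertion) : str := concat (map encAssertion l).

Definition nval (l : str) : nat := Z.to_nat (bval l).

Definition dec (s : nat) (l : str) : assertion :=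
  if Nat.eqb s 5 then CA (nval (upto 3 l)) (nval (upto 3 (after 3 l)))
  else RA (nval (upto 3 l)) (nval (upto 3 (after 3 l))) (nval (upto 3 (after 3 (after 3 l)))).

Definition istag (s : nat) : bool := Nat.eqb s 5 || Nat.eqb s 6.

(* Total decoding: a suffix of [enc l] decodes to the assertions that lie
   completely in it. *)
Fixpoint parse (l : str) : list assertion :=
  match l with
  | [] => []
  | s :: l' => if istag s then dec s l' :: parse l' else parse l'
  end.

Lemma encN_encZ n : encN n = encZ (Z.of_nat n).
Proof. destruct n; reflexivity. Qed.

Lemma nval_encN n : nval (encN n) = n.
Proof. unfold nval. rewrite encN_encZ, bval_encZ by lia. apply Nat2Z.id. Qed.

Lemma encN_bits n : Forall (fun s => s = 1 \/ s = 2) (encN n).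
Proof. unfold encN. destruct (N.of_nat n); auto. apply encP_bits. Qed.

Lemma encN_sep n : ~ In 3 (encN n).
Proof. intros H. pose proof (encN_bits n) as F. rewrite Forall_forall in F. apply F in H. lia. Qed.

Lemma parse_skip l r : Forall (fun s => istag s = false) l -> parse (l ++ r) = parse r.
Proof. induction 1; simpl; auto. rewrite H. auto. Qed.

Lemma encN_notag n : Forall (fun s => istag s = false) (encN n).
Proof. eapply Forall_impl; [|apply encN_bits]. intros s [-> | ->]; reflexivity. Qed.

Definition body (a : assertion) : str := tl (encAssertion a).
Definition tag (a : assertion) : nat := match a with CA _ _ => 5 | RA _ _ _ => 6 end.

Lemma encAssertion_eq a : encAssertion a = tag a :: body a.
Proof. destruct a; reflexivity. Qed.

Lemma body_notag a : Forall (fun s => istag s = false) (body a).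
Proof.
  destruct a; unfold body; simpl; repeat first [apply Forall_app; split | constructor];
    try apply encN_notag; reflexivity.
Qed.

Lemma body_CA A c r : body (CA A c) ++ r = encN A ++ 3 :: encN c ++ 3 :: r.
Proof. unfold body. simpl. rewrite <- app_assoc. simpl. rewrite <- app_assoc. reflexivity. Qed.

Lemma body_RA r b c t : body (RA r b c) ++ t = encN r ++ 3 :: encN b ++ 3 :: encN c ++ 3 :: t.
Proof.
  unfold body. simpl. rewrite <- app_assoc. simpl. rewrite <- app_assoc. simpl.
  rewrite <- app_assoc. reflexivity.
Qed.

Lemma dec_enc a r : dec (tag a) (body a ++ r) = a.
Proof.
  pose proof encN_sep. destruct a; unfold dec; simpl Nat.eqb; cbv iota.
  - rewrite body_CA, after_app, !upto_app, !nval_encN; auto.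
  - rewrite body_RA, !after_app, !upto_app, !nval_encN; auto.
Qed.

Lemma parse_enc_cons a r : parse (encAssertion a ++ r) = a :: parse r.
Proof.
  rewrite encAssertion_eq. simpl app. cbn [parse]. assert (E : istag (tag a) = true) by (destruct a; auto).
  rewrite E, dec_enc, parse_skip; auto. apply body_notag.
Qed.

Lemma parse_enc l : parse (enc l) = l.
Proof. induction l; simpl; auto. unfold enc. simpl. rewrite parse_enc_cons. f_equal. exact IHl. Qed.

Lemma app_split {A} (x y p q : list A) s : ~ In s x -> x ++ y = p ++ s :: q ->
  exists p', p = x ++ p' /\ y = p' ++ s :: q.
Proof.
  revert p. induction x as [|a x IH]; simpl; intros p H E; eauto.
  destruct p as [|b p]; simpl in E; inversion E; subst; [tauto|].
  destruct (IH p) as [p' [-> E']]; [tauto|auto|]. exists p'. auto.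
Qed.

(** Tags do not occur in the body of an assertion, so a tag always marks an assertion boundary. *)
Lemma enc_suffix l pre s r : istag s = true -> enc l = pre ++ s :: r ->
  exists p a rest, l = p ++ a :: rest /\ s = tag a /\ r = body a ++ enc rest.
Proof.
  intros Hs. revert pre. induction l as [|b l IH]; intros pre E.
  - destruct pre; discriminate.
  - unfold enc in E. simpl in E. fold (enc l) in E. rewrite encAssertion_eq in E. simpl in E.
    destruct pre as [|t pre]; simpl in E; inversion E; subst.
    + exists [], b, l. auto.
    + apply app_split in H1.
      * destruct H1 as [p' [-> E']]. destruct (IH _ E') as [p [a [rest [-> H]]]].
        exists (b :: p), a, rest. auto.
      * intros H. pose proof (body_notag b) as F. rewrite Forall_forall in F.
        apply F in H. congruence.
Qed.

(** The n nested loops: S collects the elements chosen so far, and later ones come from further down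
    the list, so each choice of n positions is counted once. *)
Fixpoint cnt (P : list assertion -> bool) (n : nat) (S : list assertion) (l : list assertion) : nat :=
  match n with
  | 0 => if P S then 1 else 0
  | Datatypes.S n' => (fix go l := match l with
      | [] => 0
      | a :: l' => cnt P n' (S ++ [a]) l' + go l'
      end) l
  end.

Lemma cnt_cons P n S a l : cnt P (Datatypes.S n) S (a :: l) = cnt P n (S ++ [a]) l + cnt P (Datatypes.S n) S l.
Proof. reflexivity. Qed.

Lemma cnt_bound P n : forall S l, cnt P n S l <= (Datatypes.S (length l)) ^ n.
Proof.
  induction n; intros S l.
  - simpl. destruct (P S); lia.
  - induction l as [|a l IH]; [simpl; lia|]. rewrite cnt_cons.
    specialize (IHn (S ++ [a]) l).
    assert (Datatypes.S (length l) ^ n <= Datatypes.S (length (a :: l)) ^ n)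
      by (apply Nat.pow_le_mono_l; simpl; lia).
    cbn [Nat.pow] in *. assert (length (a :: l) = Datatypes.S (length l)) by reflexivity. nia.
Qed.

Definition dummy := CA 0 0.
Notation X0 := (assertion * list assertion)%type.

Definition zvars (j : nat) : list (X0 -> Z) :=
  flat_map (fun i => (fun x => fld i (fst x)) :: map (fun t x => fld i (nth t (snd x) dummy)) (seq 0 j)) [0; 1; 2].

(** The quantities compared in the equality pattern. Including -1 makes the pattern record the kind
    of each assertion, including [C] the occurrences of fixed names. *)
Definition zall (C : list nat) (j : nat) : list (X0 -> Z) :=
  zvars j ++ (fun _ => (-1)%Z) :: map (fun c _ => Z.of_nat c) C.

Lemma zvars_in j z : In z (zvars j) <-> exists i, i < 3 /\
  (z = (fun x => fld i (fst x)) \/ exists t, t < j /\ z = (fun x => fld i (nth t (snd x) dummy))).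
Proof.
  unfold zvars. rewrite in_flat_map. split.
  - intros [i [Hi H]]. exists i. split; [simpl in Hi; lia|].
    destruct H as [H|H]; [auto|]. apply in_map_iff in H. destruct H as [t [H Ht]].
    apply in_seq in Ht. right. exists t. split; [lia|auto].
  - intros [i [Hi H]]. exists i. split; [simpl; lia|].
    destruct H as [H|[t [Ht H]]]; [left; auto|right]. apply in_map_iff. exists t.
    split; auto. apply in_seq. lia.
Qed.

Lemma length_enc l : length l <= length (enc l).
Proof.
  induction l as [|a l IH]; simpl; auto. unfold enc. simpl. fold (enc l).
  rewrite encAssertion_eq, length_app. simpl. lia.
Qed.

(** * Recursion over assertions and decision by equality patterns *)

Section Enumeration.
Variable B : nat.
Hypothesis HB : 8 <= B.
Notation vsym := (symbol B).
Notation FP := (FP B).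

Definition lift2 {X Y} (e : X -> str) : X * Y -> str := fun y => e (fst y).

(** Recursion on notation along the encoding, with the value taken at the parsed suffix: it changes
    only at a tag, and there the fields of the new head are read off between the separators. *)
Lemma FP_recA {X} (D : X -> Prop) es (l : X -> list assertion) (R : X -> list assertion -> str) :
  In (fun x => enc (l x)) es ->
  FP D es (fun x => R x []) ->
  FP (fun y => D (fst y) /\ exists pre, l (fst y) = pre ++ fst (snd y) :: snd (snd y))
    ((fun y => encZ (fld 0 (fst (snd y)))) :: (fun y => encZ (fld 1 (fst (snd y)))) ::
     (fun y => encZ (fld 2 (fst (snd y)))) :: (fun y => enc (snd (snd y))) ::
     (fun y => R (fst y) (snd (snd y))) :: map lift2 es)
    (fun y : X * (assertion * list assertion) => R (fst y) (fst (snd y) :: snd (snd y))) ->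
  (exists T, mpoly T /\ forall x N pre l', D x -> Forall (fun e => length (e x) <= N) es ->
     l x = pre ++ l' -> length (R x l') <= T N) ->
  FP D es (fun x => R x (l x)).
Proof.
  intros Hin H0 Hs [T [HT Hb]].
  apply (FP_ext _ D D _ (fun x => R x (parse (enc (l x))))); auto.
  2:{ intros. rewrite parse_enc. auto. }
  apply (FP_rec B HB D es (fun x => enc (l x)) (fun x s => R x (parse s))); auto.
  - intros s Hvs. destruct (istag s) eqn:Es.
    2:{ match goal with |- FP ?D0 _ _ => apply (FP_ext _ D0 D0 _ (fun y => R (fst y) (parse (snd y)))) end;
        auto; [fpvar|]. intros y _. simpl. rewrite Es. auto. }
    set (es1 := snd :: _).
    set (D1 := fun y : X * str => D (fst y) /\ _).
    set (phi := fun y : X * str => (fst y, (dec s (snd y), parse (snd y)))).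
    apply (FP_ext _ D1 D1 _ (fun y => R (fst (phi y)) (fst (snd (phi y)) :: snd (snd (phi y))))); auto.
    2:{ intros y _. simpl. rewrite Es. auto. }
    assert (HD : forall y, D1 y -> exists p a rest, l (fst y) = p ++ a :: rest /\ s = tag a /\
       snd y = body a ++ enc rest /\ dec s (snd y) = a /\ parse (snd y) = rest).
    { intros y [_ [pre E]]. destruct (enc_suffix _ _ _ _ Es E) as [p [a [rest [E1 [E2 E3]]]]].
      exists p, a, rest. repeat split; auto.
      - rewrite E3, E2. apply dec_enc.
      - rewrite E3, parse_skip by apply body_notag. apply parse_enc. }
    apply (FP_comp B HB _ D1 _ _ (fun y : X * (assertion * list assertion) =>
        R (fst y) (fst (snd y) :: snd (snd y))) phi Hs).
    + intros y Hy. destruct (HD y Hy) as [p [a [rest [E1 [E2 [E3 [E4 E5]]]]]]].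
      split; [apply Hy|]. exists p. unfold phi; cbn [fst snd]; rewrite E4, E5. auto.
    + assert (Hl : FP D1 es1 snd) by fpvar.
      assert (Ha1 : FP D1 es1 (fun y => after 3 (snd y))) by (apply FP_after; auto).
      assert (Ha2 : FP D1 es1 (fun y => after 3 (after 3 (snd y)))) by (apply FP_after; auto).
      assert (Ha3 : FP D1 es1 (fun y => after 3 (after 3 (after 3 (snd y))))) by (apply FP_after; auto).
      assert (Hs56 : s = 5 \/ s = 6).
      { unfold istag in Es. apply orb_prop in Es. destruct Es as [E|E]; apply Nat.eqb_eq in E; auto. }
      pose proof encN_sep as Hsep.
      constructor; [|constructor; [|constructor; [|constructor; [|constructor]]]].
      * apply (FP_ext _ D1 D1 _ (fun y => upto 3 (snd y))); [apply FP_upto; auto|auto|].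
        intros y Hy. destruct (HD y Hy) as [p [a [rest [E1 [E2 [E3 [E4 E5]]]]]]].
        unfold phi; cbn [fst snd]; rewrite E4, E3. destruct a; rewrite ?body_CA, ?body_RA, upto_app by auto; apply encN_encZ.
      * apply (FP_ext _ D1 D1 _ (fun y => upto 3 (after 3 (snd y)))); [apply FP_upto; auto|auto|].
        intros y Hy. destruct (HD y Hy) as [p [a [rest [E1 [E2 [E3 [E4 E5]]]]]]].
        unfold phi; cbn [fst snd]; rewrite E4, E3. destruct a; rewrite ?body_CA, ?body_RA, after_app, upto_app by auto; apply encN_encZ.
      * destruct Hs56 as [-> | ->].
        (* [[4; 2]] is the code of -1, the third field of a concept assertion. *)
        -- apply (FP_ext _ D1 D1 _ (fun y => [4; 2])); [apply FP_const; repeat constructor; lia|auto|].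
           intros y Hy. destruct (HD y Hy) as [p [a [rest [E1 [E2 [E3 [E4 E5]]]]]]].
           unfold phi; cbn [fst snd]; rewrite E4. destruct a; [reflexivity|discriminate].
        -- apply (FP_ext _ D1 D1 _ (fun y => upto 3 (after 3 (after 3 (snd y))))); [apply FP_upto; auto|auto|].
           intros y Hy. destruct (HD y Hy) as [p [a [rest [E1 [E2 [E3 [E4 E5]]]]]]].
           unfold phi; cbn [fst snd]; rewrite E4, E3. destruct a; [discriminate|].
           rewrite body_RA, !after_app, upto_app by auto. apply encN_encZ.
      * destruct Hs56 as [-> | ->].
        -- apply (FP_ext _ D1 D1 _ (fun y => after 3 (after 3 (snd y)))); [auto|auto|].
           intros y Hy. destruct (HD y Hy) as [p [a [rest [E1 [E2 [E3 [E4 E5]]]]]]].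
           unfold phi; cbn [fst snd]; rewrite E5, E3. destruct a; [|discriminate].
           rewrite body_CA, !after_app by auto. auto.
        -- apply (FP_ext _ D1 D1 _ (fun y => after 3 (after 3 (after 3 (snd y))))); [auto|auto|].
           intros y Hy. destruct (HD y Hy) as [p [a [rest [E1 [E2 [E3 [E4 E5]]]]]]].
           unfold phi; cbn [fst snd]; rewrite E5, E3. destruct a; [discriminate|].
           rewrite body_RA, !after_app by auto. auto.
      * fpvar.
      * rewrite Forall_map. apply Forall_forall. intros e He. apply FP_var.
        right. right. apply in_map_iff. exists e. auto.
  - exists T. split; auto. intros x N pre l' Hx HN E.
    (* A suffix that begins inside an assertion parses to the assertions after it, so the length
       bound on R at list suffixes covers all string suffixes. *)
    assert (G : forall L, enc L = pre ++ l' -> exists p, L = p ++ parse l').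
    { clear. intros L. revert pre. induction L as [|a L IH]; intros pre E.
      - exists []. destruct pre, l'; try discriminate. reflexivity.
      - destruct pre as [|t pre].
        + exists []. simpl in *. rewrite <- E. symmetry. apply parse_enc.
        + unfold enc in E. simpl in E. fold (enc L) in E. rewrite encAssertion_eq in E.
          simpl in E. inversion E as [[E1 E2]]. clear E E1.
          pose proof (body_notag a) as F. revert pre E2. induction F; intros pre E2.
          * destruct (IH pre E2) as [p ->]. exists (a :: p). auto.
          * destruct pre as [|u pre]; simpl in E2.
            -- rewrite <- E2. simpl. rewrite H, parse_skip, parse_enc by auto.
               exists [a]. reflexivity.
            -- inversion E2. apply (IHF pre). auto. }
    destruct (G _ E) as [p Ep]. apply (Hb x N p); auto.
Qed.

(** A decision tree over the tests. At a leaf the domain is empty or f is constant on it, and the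
    constant is chosen classically; f itself need not come with an algorithm. *)
Lemma FP_tests {X} es (f : X -> str) ts : (forall x, Forall vsym (f x)) -> forall D : X -> Prop,
  Forall (fun t => FP D es (fun x => enc_bool (t x))) ts ->
  (forall x y, D x -> D y -> Forall (fun t : X -> bool => t x = t y) ts -> f x = f y) ->
  FP D es f.
Proof.
  intros Hv. induction ts as [|t ts IH]; intros D Ht Hf.
  - destruct (excluded_middle_informative (exists x, D x)) as [Hx|Hx].
    + destruct Hx as [x0 Hx0]. apply (FP_ext _ (fun _ => True) D _ (fun _ => f x0)); auto.
      apply FP_const; auto.
    + apply (FP_ext _ (fun _ => False) D _ (fun _ => [])); [apply FP_nil| |];
        intros x Hx'; exfalso; eauto.
  - inversion Ht as [|? ? H1 H2]; subst.
    apply (FP_if B HB _ _ t); auto; apply IH; try (eapply Forall_impl; [|exact H2];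
      intros t' H'; apply (FP_ext _ _ _ _ _ _ H'); tauto);
    intros x y [Hx Ex] [Hy Ey] Hxy; apply Hf; auto; constructor; congruence.
Qed.

Lemma FP_pattern {X} (D : X -> Prop) es zs (f : X -> str) :
  (forall x, Forall vsym (f x)) ->
  Forall (fun z => FP D es (fun x => encZ (z x))) zs ->
  (forall x y, D x -> D y ->
     (forall z z', In z zs -> In z' zs -> (z x = z' x <-> z y = z' y)) -> f x = f y) ->
  FP D es f.
Proof.
  intros Hv Hz Hf. rewrite Forall_forall in Hz.
  apply (FP_tests es f (map (fun p x => Z.eqb (fst p x) (snd p x)) (list_prod zs zs)) Hv).
  - rewrite Forall_map. apply Forall_forall. intros [z z'] Hp. apply in_prod_iff in Hp.
    apply FP_eqZ; auto; apply Hz; tauto.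
  - intros x y Hx Hy H. apply Hf; auto. intros z z' H1 H2.
    rewrite Forall_map, Forall_forall in H. specialize (H (z, z')).
    cbn [fst snd] in H. rewrite <- !Z.eqb_eq, H; [tauto|]. apply in_prod; auto.
Qed.

Lemma unary_valid n : Forall vsym (unary n).
Proof. apply Forall_forall. intros s Hs. apply repeat_spec in Hs. subst. unfold symbol. lia. Qed.

(** Since the number j of chosen assertions is fixed in each loop, they are passed as a fixed number
    of integer arguments, their fields, and the innermost test is a decision tree on these. *)
Lemma FP_cnt C (P : assertion -> list assertion -> bool) :
  (forall j (x y : X0), length (snd x) = j -> length (snd y) = j ->
     (forall z z', In z (zall C j) -> In z' (zall C j) -> (z x = z' x <-> z y = z' y)) ->
     P (fst x) (snd x) = P (fst y) (snd y)) ->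
  forall n j, FP (fun x : X0 * list assertion => length (snd (fst x)) = j)
    ((fun x => enc (snd x)) :: map (fun z x => encZ (z (fst x))) (zvars j))
    (fun x => unary (cnt (P (fst (fst x))) n (snd (fst x)) (snd x))).
Proof.
  intros HP. induction n as [|n IH]; intros j.
  - apply (FP_pattern _ _ (map (fun z x => z (fst x)) (zall C j))).
    + intros x. apply unary_valid.
    + rewrite Forall_map. apply Forall_forall. intros z Hz. unfold zall in Hz.
      apply in_app_or in Hz. destruct Hz as [Hz|[<-|Hz]].
      * apply FP_var. right. apply in_map_iff. exists z. auto.
      * apply FP_const. repeat constructor; lia.
      * apply in_map_iff in Hz. destruct Hz as [c [<- Hc]]. apply FP_const.
        rewrite <- encN_encZ. eapply Forall_impl; [|apply encN_bits]. unfold symbol. lia.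
    + intros x y Hx Hy H. simpl. rewrite (HP j (fst x) (fst y)); auto.
      intros z z' Hz Hz'. apply (H (fun x => z (fst x)) (fun x => z' (fst x)));
        apply in_map_iff; eauto.
  - apply (FP_recA _ _ snd (fun x l => unary (cnt (P (fst (fst x))) (S n) (snd (fst x)) l))).
    + left. reflexivity.
    + simpl. apply FP_nil.
    + match goal with |- FP ?D ?es _ => set (D1 := D); set (es1 := es) end.
      apply (FP_ext _ D1 D1 _ (fun y => unary (cnt (P (fst (fst (fst y)))) n (snd (fst (fst y)) ++ [fst (snd y)]) (snd (snd y)))
         ++ unary (cnt (P (fst (fst (fst y)))) (S n) (snd (fst (fst y))) (snd (snd y))))); auto.
      2:{ intros y _. rewrite cnt_cons. unfold unary. rewrite repeat_app. reflexivity. }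
      apply FP_app; auto; [|fpvar].
      apply (FP_comp B HB _ D1 _ es1 (fun x : X0 * list assertion => unary (cnt (P (fst (fst x))) n (snd (fst x)) (snd x)))
        (fun y => ((fst (fst (fst y)), snd (fst (fst y)) ++ [fst (snd y)]), snd (snd y))) (IH (S j))).
      * intros y [Hy _]. cbn [fst snd]. rewrite length_app, Hy. simpl. lia.
      * constructor; [fpvar|]. rewrite Forall_map. apply Forall_forall. intros z Hz.
        apply zvars_in in Hz. destruct Hz as [i [Hi [->|[t [Ht ->]]]]]; simpl.
        -- apply (FP_var _ D1 es1 (lift2 (fun x : X0 * list assertion => encZ (fld i (fst (fst x)))))).
           (* The fields follow six arguments: five supplied by [FP_recA], and the lifted encoding
              of the list. *)
           do 6 right. apply (in_map lift2).
           apply in_map_iff. exists (fun x => fld i (fst x)). split; auto. apply zvars_in. exists i. auto.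
        -- destruct (Nat.eq_dec t j) as [->|Hn].
           ++ apply (FP_ext _ D1 D1 _ (fun y => encZ (fld i (fst (snd y))))); auto.
              ** destruct i as [|[|[|]]]; [fpvar|fpvar|fpvar|lia].
              ** intros y [Hy _]. rewrite app_nth2 by lia. rewrite Hy, Nat.sub_diag. reflexivity.
           ++ apply (FP_ext _ D1 D1 _ (lift2 (fun x : X0 * list assertion => encZ (fld i (nth t (snd (fst x)) dummy))))); auto.
              ** apply FP_var. do 6 right. apply (in_map lift2). apply in_map_iff.
                 exists (fun x => fld i (nth t (snd x) dummy)). split; auto. apply zvars_in. exists i.
                 split; auto. right. exists t. split; [lia|auto].
              ** intros y [Hy _]. unfold lift2. rewrite app_nth1 by lia. reflexivity.
    + exists (fun N => (S N) ^ (S n)). split; [mpoly_tac|]. intros x N pre l' _ HN E.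
      pose proof (Forall_inv HN) as H1. cbv beta in H1. unfold unary. rewrite repeat_length.
      eapply Nat.le_trans; [apply cnt_bound|]. apply Nat.pow_le_mono_l.
      pose proof (length_enc (snd x)) as H2. rewrite E in H1, H2. rewrite length_app in H2. lia.
Qed.

End Enumeration.

(** * WSMS scores of queries with bounded supports *)

Definition ren (pi : nat -> nat) (a : assertion) : assertion :=
  match a with
  | CA A c => CA (pi A) (pi c)
  | RA r b c => RA (pi r) (pi b) (pi c)
  end.

Definition monotone (ent : abox -> Prop) : Prop :=
  forall Ab Ab', incl Ab Ab' -> ent Ab -> ent Ab'.

(* Renamings act on names and individuals alike. *)
Definition invariant (C : list nat) (ent : abox -> Prop) : Prop :=
  forall pi, (forall x y, pi x = pi y -> x = y) -> (forall c, In c C -> pi c = c) ->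
  forall Ab, ent Ab -> ent (map (ren pi) Ab).

Definition bounded (m : nat) (ent : abox -> Prop) : Prop :=
  forall Ab, ent Ab -> exists S, incl S Ab /\ length S <= m /\ ent S.

Lemma bdec_iff P : bdec P = true <-> P.
Proof. unfold bdec. destruct excluded_middle_informative; split; auto; discriminate. Qed.

Lemma bool_iff (a b : bool) : (a = true <-> b = true) -> a = b.
Proof. destruct a, b; intuition congruence. Qed.

(** Inclusion in the ABox is automatic for its sublists; leaving it out makes the test depend on
    [al] and [S] alone. *)
Definition minsup (ent : abox -> Prop) (al : assertion) (S : list assertion) : bool :=
  bdec (ent S /\ (forall S', incl S' S -> ent S' -> incl S S') /\ In al S).

Lemma fld_ge i a : i < 3 -> (-1 <= fld i a)%Z.
Proof. intros H. destruct a; unfold fld; destruct i as [|[|[|]]]; simpl; lia. Qed.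

Lemma zall_ge C j z x : In z (zall C j) -> (-1 <= z x)%Z.
Proof.
  intros H. apply in_app_or in H. destruct H as [H|[<-|H]]; [|lia|].
  - apply zvars_in in H. destruct H as [i [Hi [->|[t [_ ->]]]]]; apply fld_ge; auto.
  - apply in_map_iff in H. destruct H as [c [<- _]]. lia.
Qed.

Lemma ren_fields pi a b :
  (forall i, i < 3 -> (fld i a = -1 <-> fld i b = -1)%Z) ->
  (forall i n, i < 3 -> fld i a = Z.of_nat n -> fld i b = Z.of_nat (pi n)) ->
  ren pi a = b.
Proof.
  intros H1 H2.
  destruct a as [A c|r d c], b as [A' c'|r' d' c']; simpl.
  - pose proof (H2 0 A ltac:(lia) eq_refl) as E0. pose proof (H2 1 c ltac:(lia) eq_refl) as E1.
    unfold fld in *. simpl in *. f_equal; lia.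
  - pose proof (H1 2 ltac:(lia)) as E. unfold fld in E. simpl in E. lia.
  - pose proof (H1 2 ltac:(lia)) as E. unfold fld in E. simpl in E. lia.
  - pose proof (H2 0 r ltac:(lia) eq_refl) as E0. pose proof (H2 1 d ltac:(lia) eq_refl) as E1.
    pose proof (H2 2 c ltac:(lia) eq_refl) as E2. unfold fld in *. simpl in *. f_equal; lia.
Qed.

(** A common equality pattern makes the correspondence between the names of x and those of y a
    well-defined injection, which is then extended to all names. *)
Lemma pattern_ren C j (x y : X0) : length (snd x) = j -> length (snd y) = j ->
  (forall z z', In z (zall C j) -> In z' (zall C j) -> (z x = z' x <-> z y = z' y)) ->
  exists pi, (forall a b, pi a = pi b -> a = b) /\ (forall c, In c C -> pi c = c) /\
    ren pi (fst x) = fst y /\ map (ren pi) (snd x) = snd y.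
Proof.
  intros Hx Hy H. set (zs := zall C j) in *.
  (* Names that do not occur are moved beyond all values of y, which keeps the extension
     injective. *)
  set (big := S (list_max (map (fun z : X0 -> Z => Z.to_nat (z y)) zs))).
  set (pi := fun n =>
    match excluded_middle_informative (exists z, In z zs /\ z x = Z.of_nat n) with
    | left E => Z.to_nat (proj1_sig (constructive_indefinite_description _ E) y)
    | right _ => big + n
    end).
  assert (Hm1 : In (fun _ : X0 => (-1)%Z) zs).
  { unfold zs, zall. apply in_or_app. right. left. auto. }
  assert (Hpi : forall z n, In z zs -> z x = Z.of_nat n -> z y = Z.of_nat (pi n)).
  { intros z n Hz E. unfold pi. destruct excluded_middle_informative as [E'|E'].
    - destruct (constructive_indefinite_description _ E') as [z' [Hz' Ez']]. simpl.
      assert (z y = z' y) by (apply H; auto; congruence).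
      (* The comparison with -1 belongs to the pattern, so the value at y is a natural number and
         [Z.to_nat] loses nothing. *)
      pose proof (zall_ge C j z y Hz). pose proof (H z _ Hz Hm1) as Hn. simpl in Hn. lia.
    - exfalso. eauto. }
  assert (Hbig : forall z, In z zs -> Z.to_nat (z y) < big).
  { intros z Hz. unfold big. apply Nat.lt_succ_r.
    pose proof (proj1 (list_max_le (map (fun z : X0 -> Z => Z.to_nat (z y)) zs) _) (le_n _)) as F.
    rewrite Forall_forall in F. apply F. apply in_map_iff. eauto. }
  exists pi. split; [|split; [|split]].
  - intros a b E.
    destruct (excluded_middle_informative (exists z, In z zs /\ z x = Z.of_nat a)) as [Ea|Ea];
    destruct (excluded_middle_informative (exists z, In z zs /\ z x = Z.of_nat b)) as [Eb|Eb].
    + destruct Ea as [z [Hz Ez]], Eb as [z' [Hz' Ez']].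
      pose proof (Hpi _ _ Hz Ez). pose proof (Hpi _ _ Hz' Ez').
      assert (z x = z' x) by (apply H; auto; congruence). lia.
    + destruct Ea as [z [Hz Ez]]. pose proof (Hpi _ _ Hz Ez). pose proof (Hbig z Hz).
      assert (pi b = big + b) by (unfold pi; destruct excluded_middle_informative; tauto). lia.
    + destruct Eb as [z [Hz Ez]]. pose proof (Hpi _ _ Hz Ez). pose proof (Hbig z Hz).
      assert (pi a = big + a) by (unfold pi; destruct excluded_middle_informative; tauto). lia.
    + assert (pi a = big + a) by (unfold pi; destruct excluded_middle_informative; tauto).
      assert (pi b = big + b) by (unfold pi; destruct excluded_middle_informative; tauto). lia.
  - intros c Hc. assert (Hz : In (fun _ : X0 => Z.of_nat c) zs).
    { unfold zs, zall. apply in_or_app. right. right. apply in_map_iff. eauto. }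
    pose proof (Hpi _ c Hz eq_refl) as E. simpl in E. lia.
  - apply ren_fields.
    + intros i Hi. apply (H (fun x => fld i (fst x)) _); auto.
      unfold zs, zall. apply in_or_app. left. apply zvars_in. eauto.
    + intros i n Hi E. apply (Hpi (fun x => fld i (fst x)) n); auto.
      unfold zs, zall. apply in_or_app. left. apply zvars_in. eauto.
  - apply (nth_ext _ _ (ren pi dummy) dummy); [rewrite length_map; congruence|].
    intros t Ht. rewrite length_map in Ht. rewrite map_nth.
    apply ren_fields.
    + intros i Hi. apply (H (fun x => fld i (nth t (snd x) dummy)) _); auto.
      unfold zs, zall. apply in_or_app. left. apply zvars_in. exists i. split; auto.
      right. exists t. split; [lia|auto].
    + intros i n Hi E. apply (Hpi (fun x => fld i (nth t (snd x) dummy)) n); auto.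
      unfold zs, zall. apply in_or_app. left. apply zvars_in. exists i. split; auto.
      right. exists t. split; [lia|auto].
Qed.

Lemma map_map_id {A} (f g : A -> A) l : map g (map f l) = l -> forall a, In a l -> g (f a) = a.
Proof.
  induction l as [|b l IH]; simpl; intros E a Ha; [tauto|].
  inversion E as [[E1 E2]]. destruct Ha as [<-|Ha]; [congruence|]. apply IH; auto; congruence.
Qed.

(** Minimality travels backwards: a support inside the second tuple is renamed into the first,
    compared there, and the inclusion is renamed forward again. *)
Lemma minsup_pattern C ent : invariant C ent ->
  forall j (x y : X0), length (snd x) = j -> length (snd y) = j ->
  (forall z z', In z (zall C j) -> In z' (zall C j) -> (z x = z' x <-> z y = z' y)) ->
  minsup ent (fst x) (snd x) = minsup ent (fst y) (snd y).
Proof.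
  intros Hinv.
  assert (K : forall j (x y : X0), length (snd x) = j -> length (snd y) = j ->
    (forall z z', In z (zall C j) -> In z' (zall C j) -> (z x = z' x <-> z y = z' y)) ->
    minsup ent (fst x) (snd x) = true -> minsup ent (fst y) (snd y) = true).
  { intros j x y Hx Hy H Hm.
    destruct (pattern_ren C j x y Hx Hy H) as [pi [Hi [Hc [Ea ES]]]].
    destruct (pattern_ren C j y x Hy Hx) as [pi' [Hi' [Hc' [Ea' ES']]]].
    { intros z z' Hz Hz'. symmetry. auto. }
    unfold minsup in *. rewrite bdec_iff in *. destruct Hm as [H1 [H2 H3]]. split; [|split].
    - rewrite <- ES. apply Hinv; auto.
    - intros S' HS' He.
      (* The renamings are injective but not surjective in general; they are inverse to each other
         on the assertions of the tuple, which is enough. *)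
      assert (Hid : forall a, In a (snd y) -> ren pi (ren pi' a) = a).
      { apply map_map_id. rewrite ES'. exact ES. }
      assert (Hincl : incl (snd x) (map (ren pi') S')).
      { apply H2; [|apply Hinv; auto]. rewrite <- ES'. apply incl_map. auto. }
      intros a Ha. rewrite <- ES in Ha. apply in_map_iff in Ha. destruct Ha as [b [<- Hb]].
      apply Hincl in Hb. apply in_map_iff in Hb. destruct Hb as [c [<- Hb]].
      rewrite Hid; auto.
    - rewrite <- ES, <- Ea. apply in_map. auto. }
  intros j x y Hx Hy H. apply bool_iff. split; [apply (K j); auto|].
  apply (K j); auto. intros z z' Hz Hz'. symmetry. auto.
Qed.

Lemma sublists_incl {A} (l S : list A) : In S (sublists l) -> incl S l.
Proof.
  revert S. induction l as [|a l IH]; simpl; intros S.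
  - intros [<-|[]]. apply incl_refl.
  - intros H. apply in_app_or in H. destruct H as [H|H].
    + apply in_map_iff in H. destruct H as [T [<- H]]. apply IH in H.
      intros b [<-|Hb]; simpl; auto.
    + apply IH in H. intros b Hb. right. auto.
Qed.

Lemma sublists_NoDup {A} (l S : list A) : NoDup l -> In S (sublists l) -> NoDup S.
Proof.
  intros Hn. revert S. induction Hn as [|a l Ha Hn IH]; simpl; intros S.
  - intros [<-|[]]. constructor.
  - intros H. apply in_app_or in H. destruct H as [H|H]; auto.
    apply in_map_iff in H. destruct H as [T [<- H]]. constructor; auto.
    intros Hin. apply Ha. apply (sublists_incl _ _ H); auto.
Qed.

Lemma sublists_length {A} (l S : list A) : In S (sublists l) -> length S <= length l.
Proof.
  revert S. induction l as [|a l IH]; simpl; intros S.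
  - intros [<-|[]]. auto.
  - intros H. apply in_app_or in H. destruct H as [H|H].
    + apply in_map_iff in H. destruct H as [T [<- H]]. apply IH in H. simpl. lia.
    + apply IH in H. lia.
Qed.

Lemma filter_map {A B} (f : A -> B) p l : filter p (map f l) = map f (filter (fun a => p (f a)) l).
Proof. induction l; simpl; auto. destruct (p (f a)); simpl; rewrite IHl; auto. Qed.

Lemma cnt_sublists P l : forall n S,
  cnt P n S l = length (filter (fun T => Nat.eqb (length T) n && P (S ++ T)) (sublists l)).
Proof.
  induction l as [|a l IH]; intros n S.
  - destruct n; simpl; auto. rewrite app_nil_r. destruct (P S); auto.
  - cbn [sublists]. rewrite filter_app, length_app, filter_map, length_map.
    destruct n as [|n].
    + rewrite <- IH.
      assert (E : forall L, filter (fun T => Nat.eqb (length (a :: T)) 0 && P (S ++ a :: T)) L = [])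
        by (induction L; auto).
      rewrite E. reflexivity.
    + rewrite cnt_cons, !IH. f_equal. f_equal. apply filter_ext. intros T. simpl.
      rewrite <- app_assoc. reflexivity.
Qed.

(** * Rational sums grouped by cardinality *)

Section QSum.
Local Open Scope Q_scope.

Fixpoint qsum (f : nat -> Q) (n : nat) : Q :=
  match n with O => 0 | S n' => qsum f n' + f n' end.

Lemma qsum_ext f g n : (forall i, (i < n)%nat -> f i == g i) -> qsum f n == qsum g n.
Proof. induction n; simpl; intros H; [reflexivity|]. rewrite IHn, H; auto. reflexivity. Qed.

Definition qn (n : nat) : Q := inject_Z (Z.of_nat n).

Lemma qsum_add (c : nat -> nat) s w n : (s < n)%nat ->
  qsum (fun i => qn (if Nat.eqb s i then S (c i) else c i) * w i) n ==
  w s + qsum (fun i => qn (c i) * w i) n.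
Proof.
  induction n; intros H; [lia|]. simpl. destruct (Nat.eq_dec s n) as [->|Hn].
  - rewrite Nat.eqb_refl.
    rewrite (qsum_ext _ (fun i => qn (c i) * w i) n).
    + unfold qn. rewrite Nat2Z.inj_succ. unfold Z.succ. rewrite inject_Z_plus. ring.
    + intros i Hi. destruct (Nat.eqb_spec n i); [lia|reflexivity].
  - rewrite IHn by lia. destruct (Nat.eqb_spec s n); [lia|]. ring.
Qed.

Lemma qsum_zero (w : nat -> Q) n : qsum (fun i => qn 0 * w i) n == 0.
Proof. induction n; simpl; [reflexivity|]. rewrite IHn. unfold qn. simpl. ring. Qed.

Lemma sum_by_length {A} (w : nat -> Q) (L : list (list A)) m :
  (forall S, In S L -> (length S < m)%nat) ->
  fold_right Qplus 0 (map (fun S => w (length S)) L) ==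
  qsum (fun i => qn (length (filter (fun S => Nat.eqb (length S) i) L)) * w i) m.
Proof.
  induction L as [|S L IH]; intros H.
  - simpl. rewrite qsum_zero. reflexivity.
  - simpl fold_right. rewrite IH by (intros; apply H; simpl; auto).
    rewrite <- qsum_add by (apply H; simpl; auto).
    apply qsum_ext. intros i _. simpl filter. destruct (Nat.eqb (length S) i); reflexivity.
Qed.
End QSum.

Lemma filter_filter {A} (p q : A -> bool) l : filter p (filter q l) = filter (fun a => p a && q a) l.
Proof. induction l; simpl; auto. destruct (q a) eqn:E; simpl; rewrite IHl, ?E; destruct (p a); auto. Qed.

(** A minimal support contains a support of size at most m and hence equals it as a set, so sizes 0
    to m suffice. The minimum with [length Ab] keeps w within the range where it is tractable;
    beyond it the count is zero. *)
Lemma wsms_count w ent m Ab al : monotone ent -> bounded m ent -> NoDup Ab ->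
  (wsms w ent Ab al ==
   qsum (fun n => qn (cnt (minsup ent al) n [] Ab) * w (Nat.min n (length Ab)) (length Ab)) (S m))%Q.
Proof.
  intros Hmon Hb Hnd. unfold wsms.
  assert (E : filter (fun S => bdec (min_support ent Ab S /\ In al S)) (sublists Ab) =
              filter (minsup ent al) (sublists Ab)).
  { apply filter_ext_in. intros S HS. apply bool_iff. unfold minsup, min_support.
    rewrite !bdec_iff. pose proof (sublists_incl _ _ HS). tauto. }
  rewrite E. rewrite (sum_by_length (fun n => w n (length Ab)) _ (S m)).
  - apply qsum_ext. intros n _. rewrite filter_filter, cnt_sublists. simpl app.
    destruct (Nat.le_gt_cases n (length Ab)) as [Hn|Hn].
    + rewrite Nat.min_l by auto. reflexivity.
    + assert (E0 : filter (fun T => (length T =? n) && minsup ent al T) (sublists Ab) = []).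
      { destruct (filter (fun T => (length T =? n) && minsup ent al T) (sublists Ab)) as [|l L] eqn:Ef; auto.
        assert (Hin : In l (filter (fun T => (length T =? n) && minsup ent al T) (sublists Ab)))
          by (rewrite Ef; left; auto).
        apply filter_In in Hin. destruct Hin as [H1 H2]. apply sublists_length in H1.
        apply andb_prop in H2. destruct H2 as [H2 _]. apply Nat.eqb_eq in H2. lia. }
      rewrite E0. unfold qn. simpl. ring.
  - intros S HS. apply filter_In in HS. destruct HS as [HS Hm].
    unfold minsup in Hm. rewrite bdec_iff in Hm. destruct Hm as [He [Hmin _]].
    destruct (Hb S He) as [S' [H1 [H2 H3]]].
    pose proof (Hmin S' H1 H3) as H4.
    pose proof (NoDup_incl_length (sublists_NoDup _ _ Hnd HS) H4). lia.
Qed.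

(** * The polynomial-time computation of the score *)

Section Algorithm.
Variables (w : nat -> nat -> Q) (ent : abox -> Prop) (C : list nat) (m : nat).
Variables (M : TM) (cM dM : nat).
Hypothesis HM : forall n k, n <= k ->
    let inp := repeat 2 n ++ 3 :: repeat 2 k in
    exists t out, t <= cM * (S (length inp)) ^ dM /\
      halts_within M inp t out /\ encodesQ out (w n k).
Hypothesis Hmon : monotone ent.
Hypothesis Hinv : invariant C ent.
Hypothesis Hbd : bounded m ent.

(** Room for the input alphabet and for the shifted states and symbols of M with a separator above
    them. *)
Let B := nsyms M + nstates M + 10.

Lemma alphabet_ge8 : 8 <= B.
Proof. unfold B. lia. Qed.
Lemma alphabet_ge : nsyms M + nstates M + 1 < B.
Proof. unfold B. lia. Qed.

Notation FP := (FP B).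
Notation X := (abox * assertion)%type.

Definition valid_input (x : X) : Prop := NoDup (fst x) /\ In (snd x) (fst x).
Definition input (x : X) : str := encInput (fst x) (snd x).
Definition abox_size (x : X) : nat := length (fst x).

(** The output of M is a fraction equal to the weight up to [Qeq]; the numerator and denominator it
    prints are fixed here by choice. *)
Lemma weights : exists zp : nat -> X -> Z * positive, forall n x,
  (fst (zp n x) # snd (zp n x) == w (Nat.min n (abox_size x)) (abox_size x))%Q /\
  exists t, t <= cM * (S (length (unary (Nat.min n (abox_size x)) ++ 3 :: unary (abox_size x)))) ^ dM /\
    halts_within M (unary (Nat.min n (abox_size x)) ++ 3 :: unary (abox_size x)) t
      (encZ (fst (zp n x)) ++ 3 :: encP (snd (zp n x))).
Proof.
  assert (H : forall n k, exists zp : Z * positive,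
    (fst zp # snd zp == w (Nat.min n k) k)%Q /\
    exists t, t <= cM * (S (length (unary (Nat.min n k) ++ 3 :: unary k))) ^ dM /\
    halts_within M (unary (Nat.min n k) ++ 3 :: unary k) t
      (encZ (fst zp) ++ 3 :: encP (snd zp))).
  { intros n k. destruct (HM (Nat.min n k) k) as [t [out [H1 [H2 [z [p [-> H3]]]]]]]; [lia|].
    exists (z, p). split; auto. exists t. auto. }
  exists (fun n x => proj1_sig (constructive_indefinite_description _ (H n (abox_size x)))).
  intros n x. destruct (constructive_indefinite_description _ (H n (abox_size x))). auto.
Qed.

Lemma enc_lt8 l : Forall (fun s => 1 <= s < 7) (enc l).
Proof.
  induction l as [|a l IH]; [constructor|]. unfold enc. simpl. fold (enc l).
  assert (H : forall n, Forall (fun s => 1 <= s < 7) (encN n)).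
  { intros n. eapply Forall_impl; [|apply encN_bits]. simpl. lia. }
  apply Forall_app. split; auto.
  destruct a; simpl; repeat first [apply H | apply Forall_app; split | constructor]; lia.
Qed.

Lemma enc_single a : enc [a] = encAssertion a.
Proof. apply app_nil_r. Qed.

Lemma enc7 l : ~ In 7 (enc l).
Proof. intros H. pose proof (enc_lt8 l) as F. rewrite Forall_forall in F. apply F in H. lia. Qed.

Lemma FP_Ab : FP valid_input [input] (fun x => enc (fst x)).
Proof.
  apply (FP_ext _ valid_input valid_input _ (fun x => upto 7 (input x))); auto.
  - apply FP_upto; [apply alphabet_ge8|]. fpvar.
  - intros x _. unfold input, encInput. fold (enc (fst x)). rewrite upto_app; auto. apply enc7.
Qed.

Lemma FP_al : FP valid_input [input] (fun x => enc [snd x]).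
Proof.
  apply (FP_ext _ valid_input valid_input _ (fun x => after 7 (input x))); auto.
  - apply FP_after; [apply alphabet_ge8|]. fpvar.
  - intros x _. unfold input, encInput. fold (enc (fst x)). rewrite after_app by apply enc7.
    symmetry. apply enc_single.
Qed.

Lemma fld_length i a : i < 3 -> length (encZ (fld i a)) <= 2 + length (enc [a]).
Proof.
  intros Hi. rewrite enc_single.
  destruct a; destruct i as [|[|[|]]]; try lia; cbn [fld fields nth]; unfold fld; simpl nth;
    rewrite <- ?encN_encZ; cbn [encAssertion]; simpl;
    repeat (rewrite ?length_app; simpl); lia.
Qed.

(** Recursion over the one-element list serves only to decode its single assertion. *)
Lemma FP_fld i : i < 3 -> FP valid_input [input] (fun x => encZ (fld i (snd x))).
Proof.
  intros Hi. apply (FP_cut B alphabet_ge8 _ _ _ _ FP_al).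
  apply (FP_ext _ valid_input valid_input _ (fun x => match [snd x] with [] => [] | a :: _ => encZ (fld i a) end)); auto.
  apply (FP_recA B alphabet_ge8 valid_input _ (fun x => [snd x]) (fun x l => match l with [] => [] | a :: _ => encZ (fld i a) end)).
  - left. reflexivity.
  - apply FP_nil.
  - destruct i as [|[|[|]]]; [fpvar|fpvar|fpvar|lia].
  - exists (fun N => 2 + N). split; [mpoly_tac|]. intros x N pre l' _ HN E.
    pose proof (Forall_inv HN) as H1. cbv beta in H1.
    destruct l' as [|a l']; [simpl; lia|].
    assert (a = snd x).
    { destruct pre as [|b pre]; inversion E; auto. destruct pre; discriminate. }
    subst a. pose proof (fld_length i (snd x) Hi). lia.
Qed.

Lemma FP_k : FP valid_input [input] (fun x => unary (abox_size x)).
Proof.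
  apply (FP_cut B alphabet_ge8 _ _ _ _ FP_Ab).
  apply (FP_recA B alphabet_ge8 valid_input _ fst (fun x l => unary (length l))).
  - left. reflexivity.
  - apply FP_nil.
  - apply (FP_cons _ _ _ 2); [unfold symbol; pose proof alphabet_ge8; lia|]. fpvar.
  - exists (fun N => N). split; [mpoly_tac|]. intros x N pre l' _ HN E.
    pose proof (Forall_inv HN) as H1. cbv beta in H1. unfold unary. rewrite repeat_length.
    pose proof (length_enc (fst x)) as H2. rewrite E, length_app in H2.
    rewrite <- E in H2. lia.
Qed.

Lemma FP_count n : FP valid_input [input] (fun x => unary (cnt (minsup ent (snd x)) n [] (fst x))).
Proof.
  apply (FP_comp B alphabet_ge8 _ valid_input _ [input] _ (fun x : X => ((snd x, []), fst x))
          (FP_cnt B alphabet_ge8 C (minsup ent) (minsup_pattern C ent Hinv) n 0)).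
  - auto.
  - constructor; [exact FP_Ab|]. rewrite Forall_map. apply Forall_forall. intros z Hz.
    apply zvars_in in Hz. destruct Hz as [i [Hi [->|[t [Ht ->]]]]]; [|lia].
    apply FP_fld; auto.
Qed.

Lemma FP_firstn {Y} (DY : Y -> Prop) es n f : FP DY es f -> FP DY es (fun x => firstn n (f x)).
Proof.
  intros Hf. apply (FP_fun1 B alphabet_ge8 _ _ (firstn n)); auto. clear. induction n as [|n IH].
  - apply FP_nil.
  - apply FP1_match; [apply alphabet_ge8|constructor|]. intros s Hs. simpl. apply FP_cons; auto.
Qed.

Lemma encZ_sep z : ~ In 3 (encZ z).
Proof.
  destruct z; simpl; intros H; [lia| |destruct H as [H|H]; [lia|]];
    pose proof (encP_bits p) as F; rewrite Forall_forall in F; apply F in H; lia.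
Qed.

Lemma firstn_unary n k : firstn n (unary k) = unary (Nat.min n k).
Proof. revert k. induction n; intros [|k]; simpl; auto. unfold unary in *. simpl. f_equal. apply IHn. Qed.

Theorem wsms_FP : wsms_in_FP w ent.
Proof.
  destruct weights as [zp Hzp]. pose proof alphabet_ge8 as HB8.
  assert (Hout : forall n, FP valid_input [input] (fun x => encZ (fst (zp n x)) ++ 3 :: encP (snd (zp n x)))).
  { intros n. apply (FP_simulate B M alphabet_ge8 alphabet_ge valid_input [input] (fun x => unary (Nat.min n (abox_size x)) ++ 3 :: unary (abox_size x)) _ cM dM).
    - apply FP_app; [apply alphabet_ge8| |].
      + apply (FP_ext _ valid_input valid_input _ (fun x => firstn n (unary (abox_size x)))); auto.
        * apply FP_firstn. apply FP_k.
        * intros. apply firstn_unary.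
      + apply FP_cons; [unfold symbol; lia|]. apply FP_k.
    - intros x _. split.
      + assert (H : forall i, Forall (fun s => 1 <= s < 8) (unary i)).
        { intros i. apply Forall_forall. intros s Hs. apply repeat_spec in Hs. lia. }
        apply Forall_app. split; auto. constructor; auto. lia.
      + apply Hzp. }
  assert (Hz : forall n, FP valid_input [input] (fun x => encZ (fst (zp n x)))).
  { intros n. apply (FP_ext _ valid_input valid_input _ (fun x => upto 3 (encZ (fst (zp n x)) ++ 3 :: encP (snd (zp n x))))); auto.
    - apply FP_upto; auto.
    - intros. apply upto_app. apply encZ_sep. }
  assert (Hp : forall n, FP valid_input [input] (fun x => encP (snd (zp n x)))).
  { intros n. apply (FP_ext _ valid_input valid_input _ (fun x => after 3 (encZ (fst (zp n x)) ++ 3 :: encP (snd (zp n x))))); auto.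
    - apply FP_after; auto.
    - intros. apply after_app. apply encZ_sep. }
  set (cn := fun n (x : X) => cnt (minsup ent (snd x)) n [] (fst x)).
  (* The number of summands does not depend on the input, so bringing fractions to the product of
     their denominators stays polynomial. *)
  assert (Hsum : forall n, exists (a : X -> Z) (b : X -> positive),
    FP valid_input [input] (fun x => encZ (a x)) /\ FP valid_input [input] (fun x => encP (b x)) /\
    forall x, (a x # b x == qsum (fun i => qn (cn i x) * (fst (zp i x) # snd (zp i x))) n)%Q).
  { induction n as [|n [a [b [Ha [Hb Hab]]]]].
    - exists (fun _ => 0%Z), (fun _ => 1%positive). split; [|split].
      + apply FP_const. repeat constructor; lia.
      + apply FP_const. repeat constructor; lia.
      + reflexivity.
    - exists (fun x => a x * Zpos (snd (zp n x)) +
               Z.of_nat (length (unary (cn n x))) * (fst (zp n x) * Zpos (b x)))%Z,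
             (fun x => (b x * snd (zp n x))%positive). split; [|split].
      + apply FP_addZ; auto.
        * apply FP_mulP; auto.
        * apply FP_mulunary; auto; [|apply FP_count]. apply FP_mulP; auto.
      (* The codes of p and of [Zpos p] coincide, so integer multiplication also serves for
         denominators. *)
      + apply (FP_mulP B HB8 valid_input [input] (fun x => Zpos (b x)) (fun x => snd (zp n x))); auto.
      + intros x. simpl qsum. rewrite <- Hab. unfold unary, qn. rewrite repeat_length.
        unfold Qeq, Qplus, Qmult, inject_Z. cbn [Qnum Qden]. rewrite !Pos2Z.inj_mul.
        rewrite ?Pos.mul_1_l, ?Pos2Z.inj_mul. ring. }
  destruct (Hsum (S m)) as [a [b [Ha [Hb Hab]]]].
  assert (HF : FP valid_input [input] (fun x => encZ (a x) ++ [3] ++ encP (b x))).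
  { apply FP_app; auto. apply (FP_cons _ _ _ 3); auto. unfold symbol. lia. }
  destruct (FP_TM B HB8 valid_input input _ HF) as [M' [c [d H]]].
  { intros x _. unfold input, encInput. fold (enc (fst x)). rewrite <- enc_single.
    assert (F : Forall (fun s => 1 <= s < 8) (enc (fst x) ++ 7 :: enc [snd x])).
    { apply Forall_app. split; [|constructor; [lia|]];
        (eapply Forall_impl; [|apply enc_lt8]; simpl; lia). }
    split; (eapply Forall_impl; [|exact F]); unfold symbol; simpl; lia. }
  exists M', c, d. intros Ab al Hnd Hin.
  destruct (H (Ab, al) (conj Hnd Hin)) as [t [Ht Hh]].
  exists t, (encZ (a (Ab, al)) ++ [3] ++ encP (b (Ab, al))). split; [exact Ht|]. split; [exact Hh|].
  exists (a (Ab, al)), (b (Ab, al)). split; [reflexivity|].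
  rewrite Hab, (wsms_count w ent m) by auto. apply qsum_ext. intros i _.
  destruct (Hzp i (Ab, al)) as [E _]. rewrite E. reflexivity.
Qed.

End Algorithm.

(** * Bounded supports of rewritable and DL-Lite queries *)

Definition termC (t : term) : list nat := match t with TVar _ => [] | TCst a => [a] end.

Definition atomC (atm : qatom) : list nat :=
  match atm with
  | QC A t => A :: termC t
  | QR r t1 t2 => r :: termC t1 ++ termC t2
  | QNeq t1 t2 => termC t1 ++ termC t2
  end.

Definition ucqC (q : ucq) : list nat := flat_map (flat_map atomC) q.

Lemma atomC_ucqC q c atm : In c q -> In atm c -> incl (atomC atm) (ucqC q).
Proof.
  intros Hc Ha x Hx. apply in_flat_map. exists c. split; auto. apply in_flat_map. eauto.
Qed.

(** The predicate [holds] is abstract so that the lemma covers matches in the database as well as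
    matches in the canonical model. *)
Lemma gather {A} (c : list A) (Ab : abox) (holds : abox -> A -> Prop) :
  (forall Ab Ab' a, incl Ab Ab' -> holds Ab a -> holds Ab' a) ->
  (forall a, In a c -> exists S, incl S Ab /\ length S <= 1 /\ holds S a) ->
  exists S, incl S Ab /\ length S <= length c /\ forall a, In a c -> holds S a.
Proof.
  intros Hm. induction c as [|a c IH]; intros H.
  - exists []. split; [intros x []|]. split; auto. intros a [].
  - destruct IH as [S [H1 [H2 H3]]]; [intros; apply H; simpl; auto|].
    destruct (H a) as [S' [H1' [H2' H3']]]; [simpl; auto|].
    exists (S' ++ S). split; [apply incl_app; auto|]. split; [rewrite length_app; simpl; lia|].
    intros b [<-|Hb].
    + apply (Hm S'); auto. apply incl_appl, incl_refl.
    + apply (Hm S); auto. apply incl_appr, incl_refl.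
Qed.

Definition maxlen (q : ucq) : nat := list_max (map (@length qatom) q).

Lemma maxlen_le q c : In c q -> length c <= maxlen q.
Proof.
  intros H. pose proof (proj1 (list_max_le (map (@length qatom) q) _) (le_n _)) as F.
  rewrite Forall_forall in F. apply F. apply in_map. auto.
Qed.

(** * Queries with a rewriting *)

Section Database.
Variables (ent : abox -> Prop) (qs : ucq).
Hypothesis Hqs : forall Ab, ent Ab <-> evalDB Ab qs.

Lemma holdsDB_mono Ab Ab' f atm : incl Ab Ab' -> holdsDB Ab f atm -> holdsDB Ab' f atm.
Proof. intros H. destruct atm; simpl; auto. Qed.

Lemma rewritable_monotone : monotone ent.
Proof.
  intros Ab Ab' H. rewrite !Hqs. intros [c [Hc [f Hf]]]. exists c. split; auto. exists f.
  intros atm Ha. apply (holdsDB_mono Ab); auto.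
Qed.

(** A match composed with [pi] is a match again; injectivity preserves the inequality atoms, and the
    constants and predicates of the query are fixed. *)
Lemma rewritable_invariant : invariant (ucqC qs) ent.
Proof.
  intros pi Hi Hc Ab. rewrite !Hqs. intros [c [Hin [f Hf]]]. exists c. split; auto.
  exists (fun x => pi (f x)). intros atm Ha. specialize (Hf atm Ha).
  pose proof (atomC_ucqC _ _ _ Hin Ha) as HC.
  assert (Ht : forall t, incl (termC t) (ucqC qs) -> tval (fun x => pi (f x)) t = pi (tval f t)).
  { intros [x|a] H; simpl; auto. symmetry. apply Hc. apply H. simpl; auto. }
  destruct atm as [A t|r t1 t2|t1 t2]; simpl in *.
  - rewrite Ht by (intros x Hx; apply HC; simpl; auto).
    apply (in_map (ren pi)) in Hf. simpl in Hf. rewrite (Hc A) in Hf; auto. apply HC. simpl; auto.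
  - rewrite !Ht by (intros x Hx; apply HC; simpl; auto using in_or_app).
    apply (in_map (ren pi)) in Hf. simpl in Hf. rewrite (Hc r) in Hf; auto. apply HC. simpl; auto.
  - rewrite !Ht by (intros x Hx; apply HC; auto using in_or_app). auto.
Qed.

Lemma rewritable_bounded : bounded (maxlen qs) ent.
Proof.
  intros Ab. rewrite Hqs. intros [c [Hin [f Hf]]].
  destruct (gather c Ab (fun S => holdsDB S f)) as [S [H1 [H2 H3]]].
  - intros. eapply holdsDB_mono; eauto.
  - intros atm Ha. specialize (Hf atm Ha). destruct atm as [A t|r t1 t2|t1 t2]; simpl in *.
    + exists [CA A (tval f t)]. split; [intros x [<-|[]]; auto|]. simpl; auto.
    + exists [RA r (tval f t1) (tval f t2)]. split; [intros x [<-|[]]; auto|]. simpl; auto.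
    (* An inequality depends only on the match and needs no assertion. *)
    + exists []. split; [intros x []|]. simpl; auto.
  - exists S. split; auto. pose proof (maxlen_le _ _ Hin). split; [lia|].
    apply Hqs. exists c. split; auto. exists f. auto.
Qed.
End Database.

(** * DL-Lite queries and the canonical model *)

Section Ontology.
Variables (T : tbox) (q : ucq).
Hypothesis Hq : is_UCQ q.

Definition roleC (R : brole) : list nat := match R with RN r | RInv r => [r] end.
Definition concC (B : bconc) : list nat := match B with CN A => [A] | Ex R => roleC R end.
Definition axC (ax : dlaxiom) : list nat :=
  match ax with
  | CIncl B B' | CNegIncl B B' => concC B ++ concC B'
  | RIncl R R' | RNegIncl R R' => roleC R ++ roleC R'
  end.
Definition omqC : list nat := flat_map axC T ++ ucqC q.

Lemma entails_monotone : monotone (entails T q).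
Proof.
  intros Ab Ab' H He I [H1 [H2 H3]]. apply He. split; auto.
Qed.

(** Reads a model of the renamed ABox as a model of the original one. Injectivity of [pi] preserves
    unique names, and the vocabulary of the TBox and query is unaffected. *)
Definition pullback (pi : nat -> nat) (I : interp) : interp :=
  {| dom := dom I; iconc := fun A => iconc I (pi A); irole := fun r => irole I (pi r);
     iind := fun c => iind I (pi c) |}.

Lemma entails_invariant : invariant omqC (entails T q).
Proof.
  intros pi Hi Hc Ab He I [H1 [H2 H3]].
  assert (HR : forall R, incl (roleC R) omqC -> forall d e,
     roleI (pullback pi I) R d e = roleI I R d e).
  { intros [r|r] H d e; simpl; rewrite Hc; auto; apply H; simpl; auto. }
  assert (HB : forall B, incl (concC B) omqC -> forall d,
     concI (pullback pi I) B d <-> concI I B d).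
  { intros [A|R] H d; simpl.
    - rewrite Hc; [tauto|]. apply H; simpl; auto.
    - split; intros [e E]; exists e; [rewrite <- HR|rewrite HR]; auto. }
  assert (HI : is_model (pullback pi I) T Ab).
  { split; [|split].
    - intros ax Hax. specialize (H1 ax Hax).
      assert (Hinc : incl (axC ax) omqC).
      { intros x Hx. apply in_or_app. left. apply in_flat_map. eauto. }
      destruct ax as [B B'|B B'|R R'|R R']; simpl in *;
        assert (Hi1 := fun x H => Hinc x (in_or_app _ _ x (or_introl H)));
        assert (Hi2 := fun x H => Hinc x (in_or_app _ _ x (or_intror H))).
      + intros d. rewrite !HB by auto. apply H1.
      + intros d. rewrite !HB by auto. apply H1.
      + intros d e. rewrite !HR by auto. apply H1.
      + intros d e. rewrite !HR by auto. apply H1.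
    - intros a Ha. specialize (H2 _ (in_map (ren pi) _ _ Ha)). destruct a; exact H2.
    - intros b c E. apply Hi. apply H3. exact E. }
  destruct (He _ HI) as [c [Hin [f Hf]]]. exists c. split; auto. exists f.
  intros atm Ha. specialize (Hf atm Ha).
  pose proof (atomC_ucqC _ _ _ Hin Ha) as HC.
  assert (HCq : forall x, In x (ucqC q) -> pi x = x).
  { intros x Hx. apply Hc. apply in_or_app. auto. }
  assert (Ht : forall t, incl (termC t) (ucqC q) -> tvalI (pullback pi I) f t = tvalI I f t).
  { intros [x|a] H; simpl; auto. rewrite HCq; auto. apply H. simpl; auto. }
  destruct atm as [A t|r t1 t2|t1 t2]; simpl in *.
  - rewrite Ht, (HCq A) in Hf by (try intros x Hx; apply HC; simpl; auto). exact Hf.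
  - rewrite !Ht, (HCq r) in Hf by (try intros x Hx; apply HC; simpl; auto using in_or_app). exact Hf.
  - rewrite !Ht in Hf by (intros x Hx; apply HC; auto using in_or_app). exact Hf.
Qed.

Definition inv (R : brole) : brole := match R with RN r => RInv r | RInv r => RN r end.

Lemma inv_inv R : inv (inv R) = R.
Proof. destruct R; reflexivity. Qed.

Lemma roleI_inv I R d e : roleI I (inv R) d e = roleI I R e d.
Proof. destruct R; reflexivity. Qed.

Inductive subR (R : brole) : brole -> Prop :=
| subR_refl : subR R R
| subR_step R1 R2 : subR R R1 -> In (RIncl R1 R2) T -> subR R R2
| subR_inv R1 R2 : subR R (inv R1) -> In (RIncl R1 R2) T -> subR R (inv R2).

Inductive subC (B : bconc) : bconc -> Prop :=
| subC_refl : subC B B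
| subC_step B1 B2 : subC B B1 -> In (CIncl B1 B2) T -> subC B B2
| subC_role R1 R2 : subC B (Ex R1) -> subR R1 R2 -> subC B (Ex R2).

Lemma subR_opp R R' : subR R R' -> subR (inv R) (inv R').
Proof.
  induction 1.
  - apply subR_refl.
  - eapply subR_inv; eauto.
  - rewrite inv_inv in *. eapply subR_step; eauto.
Qed.

Lemma subC_trans B B' B'' : subC B B' -> subC B' B'' -> subC B B''.
Proof.
  intros H. induction 1; auto.
  - eapply subC_step; eauto.
  - eapply subC_role; eauto.
Qed.

Definition positive_model (I : interp) : Prop :=
  forall ax, In ax T -> match ax with CIncl _ _ | RIncl _ _ => satAx I ax | _ => True end.

Lemma subR_sound I R R' d e : positive_model I -> subR R R' -> roleI I R d e -> roleI I R' d e.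
Proof.
  intros HI H Hr. induction H; auto.
  - apply (HI _ H0). auto.
  - rewrite roleI_inv in *. apply (HI _ H0). auto.
Qed.

Lemma subC_sound I B B' d : positive_model I -> subC B B' -> concI I B d -> concI I B' d.
Proof.
  intros HI H Hr. induction H; auto.
  - apply (HI _ H0). auto.
  - destruct IHsubC as [e He]; auto. exists e. eapply subR_sound; eauto.
Qed.

(* The element [(a, p)] of the canonical model is the anonymous individual
   reached from [a] along the roles in [p], last role first; nothing holds at
   the elements that do not exist. Each fact is derived from a single assertion
   [al], which is what bounds the supports. *)
Definition elt : Type := nat * list brole.

Definition ev (al : assertion) (a : nat) (B : bconc) : Prop :=
  match al with
  | CA A c => a = c /\ B = CN A
  | RA r b c => (a = b /\ B = Ex (RN r)) \/ (a = c /\ B = Ex (RInv r))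
  end.

(** In DL-Lite everything that holds at an anonymous element follows from its being reached along R,
    that is, from [Ex (inv R)]; its existence goes back to its parent and finally to [al]. *)
Fixpoint der (al : assertion) (a : nat) (p : list brole) (B : bconc) : Prop :=
  match p with
  | [] => exists B0, ev al a B0 /\ subC B0 B
  | R :: p' => der al a p' (Ex R) /\ subC (Ex (inv R)) B
  end.

(** A child is created for each derivable [Ex R0], even if a witness is already present. No fact
    thus depends on the absence of others, and the model grows with the ABox. *)
Inductive edge (al : assertion) (R : brole) : elt -> elt -> Prop :=
| edge_fwd r b c : al = RA r b c -> subR (RN r) R -> edge al R (b, []) (c, [])
| edge_bwd r b c : al = RA r b c -> subR (RInv r) R -> edge al R (c, []) (b, [])
| edge_child a p R0 : der al a p (Ex R0) -> subR R0 R -> edge al R (a, p) (a, R0 :: p)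
| edge_parent a p R0 : der al a p (Ex R0) -> subR (inv R0) R -> edge al R (a, R0 :: p) (a, p).

Lemma der_subC al a p B B' : der al a p B -> subC B B' -> der al a p B'.
Proof.
  destruct p; simpl.
  - intros [B0 [H1 H2]] H. exists B0. split; auto. eapply subC_trans; eauto.
  - intros [H1 H2] H. split; auto. eapply subC_trans; eauto.
Qed.

Lemma subR_trans R R' R'' : subR R R' -> subR R' R'' -> subR R R''.
Proof.
  intros H. induction 1; auto.
  - eapply subR_step; eauto.
  - eapply subR_inv; eauto.
Qed.

Lemma edge_subR al R R' d e : edge al R d e -> subR R R' -> edge al R' d e.
Proof.
  intros H HR. inversion H; subst.
  - eapply edge_fwd; eauto using subR_trans.
  - eapply edge_bwd; eauto using subR_trans.
  - eapply edge_child; eauto using subR_trans.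
  - eapply edge_parent; eauto using subR_trans.
Qed.

Lemma edge_inv al R d e : edge al R d e -> edge al (inv R) e d.
Proof.
  intros H. inversion H; subst.
  - eapply edge_bwd; eauto. apply (subR_opp (RN r)). auto.
  - eapply edge_fwd; eauto. apply (subR_opp (RInv r)). auto.
  - eapply edge_parent; eauto. apply subR_opp. auto.
  - eapply edge_child; eauto. rewrite <- (inv_inv R0). apply subR_opp. auto.
Qed.

Definition canon (Ab : abox) : interp :=
  {| dom := elt;
     iconc := fun A d => exists al, In al Ab /\ der al (fst d) (snd d) (CN A);
     irole := fun r d e => exists al, In al Ab /\ edge al (RN r) d e;
     iind := fun a => (a, []) |}.

Lemma canon_role Ab R d e : roleI (canon Ab) R d e <-> exists al, In al Ab /\ edge al R d e.
Proof.
  destruct R as [r|r]; simpl; [tauto|].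
  split; intros [al [H1 H2]]; exists al; split; auto; apply edge_inv in H2; exact H2.
Qed.

(** From left to right, each of the four kinds of edges already yields the existential from its own
    assertion; conversely the child created for it is a witness. *)
Lemma canon_conc Ab B d : concI (canon Ab) B d <-> exists al, In al Ab /\ der al (fst d) (snd d) B.
Proof.
  destruct B as [A|R]; simpl; [tauto|]. split.
  - intros [e He]. apply canon_role in He. destruct He as [al [H1 H2]]. exists al. split; auto.
    inversion H2; subst; simpl.
    + exists (Ex (RN r)). split; [simpl; auto|]. eapply subC_role; eauto. apply subC_refl.
    + exists (Ex (RInv r)). split; [simpl; auto|]. eapply subC_role; eauto. apply subC_refl.
    + eapply der_subC; eauto. eapply subC_role; eauto. apply subC_refl.
    + split; auto. eapply subC_role; eauto. apply subC_refl.
  - intros [al [H1 H2]]. exists (fst d, R :: snd d). apply canon_role. exists al. split; auto.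
    destruct d as [a p]. apply edge_child; auto. apply subR_refl.
Qed.

Lemma canon_positive Ab : positive_model (canon Ab).
Proof.
  intros ax Hax. destruct ax as [B B'|B B'|R R'|R R']; simpl; auto.
  - intros d. rewrite !canon_conc. intros [al [H1 H2]]. exists al. split; auto.
    eapply der_subC; eauto. eapply subC_step; eauto. apply subC_refl.
  - intros d e. rewrite !canon_role. intros [al [H1 H2]]. exists al. split; auto.
    eapply edge_subR; eauto. eapply subR_step; eauto. apply subR_refl.
Qed.

Lemma canon_assert Ab a : In a Ab -> satAssert (canon Ab) a.
Proof.
  intros H. destruct a as [A c|r b c]; simpl.
  - exists (CA A c). split; auto. exists (CN A). split; [simpl; auto|apply subC_refl].
  - exists (RA r b c). split; auto. eapply edge_fwd; eauto. apply subR_refl.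
Qed.

(** The homomorphism into a model, with witnesses chosen along the path. It is defined on all paths
    and without reference to an assertion, so facts derived from different assertions are carried by
    one map. *)
Fixpoint hom (I : interp) (a : nat) (p : list brole) : dom I :=
  match p with
  | [] => iind I a
  | R :: p' => epsilon (inhabits (iind I a)) (fun e => roleI I R (hom I a p') e)
  end.

Lemma hom_der I al a p B : positive_model I -> satAssert I al -> der al a p B -> concI I B (hom I a p).
Proof.
  intros HI Ha. revert B. induction p as [|R p IH]; intros B; simpl.
  - intros [B0 [H1 H2]]. eapply subC_sound; eauto. destruct al as [A c|r b c]; simpl in H1.
    + destruct H1 as [-> ->]. exact Ha.
    + destruct H1 as [[-> ->]|[-> ->]]; simpl; eauto.
  - intros [H1 H2]. eapply subC_sound; eauto. apply IH in H1.
    exists (hom I a p). rewrite roleI_inv. apply epsilon_spec. exact H1.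
Qed.

Lemma hom_edge I al R d e : positive_model I -> satAssert I al -> edge al R d e ->
  roleI I R (hom I (fst d) (snd d)) (hom I (fst e) (snd e)).
Proof.
  intros HI Ha H. inversion H; subst; simpl.
  - eapply subR_sound; eauto.
  - eapply subR_sound; eauto.
  - eapply subR_sound; eauto. apply epsilon_spec. exact (hom_der I al a p _ HI Ha H0).
  - eapply subR_sound; eauto. rewrite roleI_inv. apply epsilon_spec.
    exact (hom_der I al a p _ HI Ha H0).
Qed.

Lemma model_positive I Ab : is_model I T Ab -> positive_model I.
Proof. intros [H _] ax Hax. specialize (H ax Hax). destruct ax; auto. Qed.

Lemma canon_mono Ab Ab' f atm : incl Ab Ab' -> holdsI (canon Ab) f atm -> holdsI (canon Ab') f atm.
Proof.
  intros H. destruct atm as [A t|r t1 t2|t1 t2]; simpl.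
  - intros [al [H1 H2]]. exists al. auto.
  - intros [al [H1 H2]]. exists al. auto.
  - auto.
Qed.

(** If the canonical model satisfies the TBox, it contains a match and each atom contributes one
    assertion; otherwise two assertions already contradict a negative inclusion. The bound covers
    both cases. *)
Lemma entails_bounded : bounded (2 + maxlen q) (entails T q).
Proof.
  intros Ab He.
  destruct (excluded_middle_informative (forall ax, In ax T -> satAx (canon Ab) ax)) as [Hm|Hm].
  - destruct (He (canon Ab)) as [c [Hin [f Hf]]].
    { split; [auto|]. split; [apply canon_assert|]. intros b c E. inversion E. auto. }
    destruct (gather c Ab (fun S => holdsI (canon S) f)) as [S [H1 [H2 H3]]].
    + intros Ab1 Ab2 atm. apply canon_mono.
    + intros atm Ha. pose proof (Hq _ _ Hin Ha) as Hpos. specialize (Hf atm Ha).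
      destruct atm as [A t|r t1 t2|t1 t2]; simpl in Hf; [| |tauto];
        destruct Hf as [al [Hal Hd]]; exists [al]; (split; [intros x [<-|[]]; auto|]);
        (split; [simpl; auto|]); exists al; split; simpl; auto.
    (* The match over [canon S] is composed with [hom]. This is where inequalities have to be
       excluded: [hom] may identify elements. *)
    + exists S. split; auto. pose proof (maxlen_le _ _ Hin). split; [lia|].
      intros I HI. exists c. split; auto.
      exists (fun x => hom I (fst (f x)) (snd (f x))).
      pose proof (model_positive _ _ HI) as HP. destruct HI as [_ [HA _]].
      assert (Ht : forall t, tvalI I (fun x => hom I (fst (f x)) (snd (f x))) t =
         hom I (fst (tvalI (canon S) f t)) (snd (tvalI (canon S) f t))).
      { intros [x|a]; reflexivity. }
      intros atm Ha. pose proof (Hq _ _ Hin Ha) as Hpos. specialize (H3 atm Ha).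
      destruct atm as [A t|r t1 t2|t1 t2]; [| |tauto]; simpl in *;
        destruct H3 as [al [Hal Hd]]; rewrite !Ht.
      * exact (hom_der I al _ _ _ HP (HA _ Hal) Hd).
      * exact (hom_edge I al _ _ _ HP (HA _ Hal) Hd).
  (* The canonical model satisfies all positive axioms, so a negative one fails, at two facts with
     one source assertion each. [hom] carries the failure into every model of these two assertions,
     so they have none and entail q vacuously. *)
  - assert (Hax : exists ax, In ax T /\ ~ satAx (canon Ab) ax).
    { apply NNPP. intros Hn. apply Hm. intros ax Hax. apply NNPP. intros Hs. eauto. }
    destruct Hax as [ax [Hax Hns]].
    destruct ax as [B B'|B B'|R R'|R R']; try (destruct Hns; exact (canon_positive Ab _ Hax)).
    + assert (Hd : exists d, concI (canon Ab) B d /\ concI (canon Ab) B' d).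
      { apply NNPP. intros Hn. apply Hns. intros d H1 H2. eauto. }
      destruct Hd as [d [H1 H2]]. apply canon_conc in H1. apply canon_conc in H2.
      destruct H1 as [al [Ha Hd]], H2 as [al' [Ha' Hd']].
      exists [al; al']. split; [intros x [<-|[<-|[]]]; auto|]. split; [simpl; lia|].
      intros I HI. pose proof (model_positive _ _ HI) as HP. destruct HI as [HT [HA _]].
      exfalso. apply (HT _ Hax (hom I (fst d) (snd d))).
      * apply (hom_der I al); auto. apply HA. simpl; auto.
      * apply (hom_der I al'); auto. apply HA. simpl; auto.
    + assert (Hd : exists d e, roleI (canon Ab) R d e /\ roleI (canon Ab) R' d e).
      { apply NNPP. intros Hn. apply Hns. intros d e H1 H2. eauto. }
      destruct Hd as [d [e [H1 H2]]]. apply canon_role in H1. apply canon_role in H2.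
      destruct H1 as [al [Ha Hd]], H2 as [al' [Ha' Hd']].
      exists [al; al']. split; [intros x [<-|[<-|[]]]; auto|]. split; [simpl; lia|].
      intros I HI. pose proof (model_positive _ _ HI) as HP. destruct HI as [HT [HA _]].
      exfalso. apply (HT _ Hax (hom I (fst d) (snd d)) (hom I (fst e) (snd e))).
      * apply (hom_edge I al); auto. apply HA. simpl; auto.
      * apply (hom_edge I al'); auto. apply HA. simpl; auto.
Qed.
End Ontology.

Theorem theorem1 :
  (forall (w : nat -> nat -> Q) (ent : abox -> Prop),
     tractable w -> UCQneq_rewritable ent -> wsms_in_FP w ent) /\
  (forall (w : nat -> nat -> Q) (T : tbox) (q : ucq),
     tractable w -> is_UCQ q -> wsms_in_FP w (entails T q)).
Proof.
  split.
  - intros w ent [M [c [d HM]]] [qs Hqs].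
    apply (wsms_FP w ent (ucqC qs) (maxlen qs) M c d HM).
    + apply (rewritable_monotone ent qs Hqs).
    + apply (rewritable_invariant ent qs Hqs).
    + apply (rewritable_bounded ent qs Hqs).
  (* The three properties are established semantically, so no rewriting of (T, q) is constructed. *)
  - intros w T q [M [c [d HM]]] Hq.
    apply (wsms_FP w (entails T q) (omqC T q) (2 + maxlen q) M c d HM).
    + apply entails_monotone.
    + apply entails_invariant.
    + apply entails_bounded. exact Hq.
Qed.
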